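(* Let $\Omega$ be a connected Stein manifold, let $\varphi:\Omega\to\Omega$ be holomorphic, and let $(n_l)_{l\in\mathbb{N}}$ be an increasing sequence of natural numbers. Then: (1) The operator $C_\varphi$ is hypercyclic with respect to $(n_l)_l$ if and only if $\varphi$ is injective, $\varphi(\Omega)$ is a Runge domain with respect to $\Omega$, and for every $\Omega$-convex compact subset $K\subset\Omega$ there is $l\in\mathbb{N}$ such that the sets $K$ and $\varphi^{[n_l]}(K)$ are separable in $\Omega$. (2) The operator $C_\varphi$ is hereditarily hypercyclic with respect to $(n_l)_l$ if and only if $\varphi$ is injective, $\varphi(\Omega)$ is a Runge domain with respect to $\Omega$, and for every $\Omega$-convex compact subset $K\subset\Omega$ there exists $l_0$ such that for each $l\geq l_0$ the sets $K$ and $\varphi^{[n_l]}(K)$ are separable in $\Omega$.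
   Context: A Stein manifold is a complex analytic manifold $\Omega$ of finite dimension $N$ such that: $\Omega$ has an exhaustion by compact sets $K_l$ with $K_l\subset\operatorname{int}K_{l+1}$ and $\bigcup_l K_l=\Omega$; the holomorphic hull of every compact set is compact; holomorphic functions on $\Omega$ separate points; and for each $z\in\Omega$ some holomorphic map $F:\Omega\to\mathbb{C}^N$ has invertible derivative at $z$. $\mathcal{O}(\Omega)$ is the space of holomorphic functions $\Omega\to\mathbb{C}$ with the topology of uniform convergence on compact sets. $C_\varphi:\mathcal{O}(\Omega)\to\mathcal{O}(\Omega)$ is $C_\varphi(f)=f\circ\varphi$. For a self-map $T$, $T^{[n]}$ denotes its $n$-th iterate. ''Increasing'' means strictly increasing. For compact $K\subset\Omega$ the holomorphic hull is $\widehat{K}_\Omega=\{z\in\Omega: |f(z)|\le\sup_K|f| \text{ for every } f\in\mathcal{O}(\Omega)\}$; a compact set $K$ is called $\Omega$-convex if $K=\widehat{K}_\Omega$. For $\Omega=\mathbb{C}$ the hull (polynomial hull) is denoted $\widehat{K}$. Compact sets $K,L\subset\Omega$ are separable in $\Omega$ if there is $F\in\mathcal{O}(\Omega)$ with $\widehat{F(K)}\cap\widehat{F(L)}=\varnothing$ (polynomial hulls in $\mathbb{C}$). A domain $U\subset\Omega$ is a Runge domain with respect to $\Omega$ if every function in $\mathcal{O}(U)$ can be approximated locally uniformly on $U$ by functions from $\mathcal{O}(\Omega)$. A sequence $(T_l)_l$ of continuous self-maps of a topological space $X$ is universal if there is $x\in X$ with $\{T_l(x): l\in\mathbb{N}\}$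 dense in $X$; it is hereditarily universal if each of its subsequences is universal. A continuous linear operator $T$ on a topological vector space is hypercyclic (resp. hereditarily hypercyclic) with respect to $(n_l)_l$ if $(T^{[n_l]})_l$ is universal (resp. hereditarily universal). *)

(* Defs.v *)
From HB Require Import structures.
From mathcomp Require Import all_boot all_order all_algebra complex.
From mathcomp Require Import all_classical all_reals all_analysis.

Set Implicit Arguments.
Unset Strict Implicit.
Unset Printing Implicit Defensive.

Import Order.TTheory GRing.Theory Num.Theory.
Import numFieldNormedType.Exports.
Import Normc.

Local Open Scope classical_set_scope.
Local Open Scope complex_scope.
Local Open Scope ring_scope.

HB.instance Definition _ (R : realType) := PseudoMetric.copy R[i] R[i]^o.
HB.instance Definition _ (R : realType) := Pointed.copy R[i] R[i]^o.

(* [R[i]^o] is the complex plane as a normed space over itself; differentials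
   between normed modules over [R[i]] are [R[i]]-linear, so [differentiable]
   is complex differentiability. *)
Notation Cplane R := (R[i]^o).

(* A chart is a homeomorphism from the open set [chart_dom] onto an open subset
   of C^N; both [chart_to] and [chart_from] are total functions whose values
   outside of [chart_dom] and [chart_to @` chart_dom] are irrelevant. *)
Record chart (R : realType) (N : nat) (T : topologicalType) := Chart {
  chart_dom : set T;
  chart_to : T -> 'rV[R[i]]_N;
  chart_from : 'rV[R[i]]_N -> T;
  chart_dom_open : open chart_dom;
  chart_img_open : open (chart_to @` chart_dom);
  chart_toK : forall z, chart_dom z -> chart_from (chart_to z) = z;
  chart_to_continuous : {within chart_dom, continuous chart_to};
  chart_from_continuous :
    {within chart_to @` chart_dom, continuous chart_from} }.

Record complexManifold (R : realType) (N : nat) := ComplexManifold {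
  mfd_space :> topologicalType;
  mfd_hausdorff : hausdorff_space mfd_space;
  atlas : set (chart R N mfd_space);
  atlas_cover : forall z : mfd_space, exists2 c, atlas c & chart_dom c z;
  atlas_compatible : forall c d, atlas c -> atlas d ->
    forall z, chart_dom c z -> chart_dom d z ->
      differentiable (chart_to d \o chart_from c) (chart_to c z) }.

Section Holomorphy.
Context {R : realType} {N : nat} (M : complexManifold R N).

Definition holomorphic_on (V : normedModType R[i]) (U : set M) (f : M -> V) :=
  forall c, atlas c -> forall z, U z -> chart_dom c z ->
    differentiable (f \o chart_from c) (chart_to c z).

Definition holomorphic (V : normedModType R[i]) (f : M -> V) :=
  holomorphic_on setT f.

Definition holomorphic_self_map (phi : M -> M) :=
  continuous phi /\
  forall c d, atlas c -> atlas d ->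
    forall z, chart_dom c z -> chart_dom d (phi z) ->
      differentiable (chart_to d \o phi \o chart_from c) (chart_to c z).

(* O(M): the holomorphic functions with the subspace topology induced by the
   topology of uniform convergence on compact sets. *)
Definition holomorphic_functions : set {family compact, M -> Cplane R} :=
  [set f : M -> Cplane R | holomorphic f].

Definition holo_space : topologicalType := set_type holomorphic_functions.

End Holomorphy.

Arguments holo_space {R N} M.

(* [hull A K] is the hull of [K] with respect to the class of functions [A].
   On compact sets the suprema of continuous functions are finite; the empty
   set has an empty hull as soon as [A] contains a nonzero constant, since
   [sup set0 = 0]. *)
Definition hull (R : realType) (T : Type) (A : set (T -> Cplane R))
    (K : set T) : set T :=
  [set z | forall f, A f -> normc (f z) <= sup [set normc (f w) | w in K]].

Definition entire (R : realType) : set (Cplane R -> Cplane R) :=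
  [set f | forall z : Cplane R, differentiable f z].

Definition polynomial_hull (R : realType) (K : set (Cplane R)) :=
  hull (@entire R) K.

Section Stein.
Context {R : realType} {N : nat} (M : complexManifold R N).

Definition holomorphic_hull (K : set M) : set M :=
  hull [set f | holomorphic f] K.

Definition holomorphically_convex (K : set M) := K = holomorphic_hull K.

Record stein_manifold : Prop := SteinManifold {
  stein_exhaustion : exists K : nat -> set M,
    [/\ forall l, compact (K l),
        forall l, K l `<=` interior (K l.+1) &
        \bigcup_l K l = setT];
  stein_hull_compact : forall K : set M, compact K ->
    compact (holomorphic_hull K);
  stein_separates_points : forall z w : M, z <> w ->
    exists2 f : M -> Cplane R, holomorphic f & f z <> f w;
  stein_coordinates : forall z : M, exists2 F : M -> 'rV[R[i]]_N,
    holomorphic F &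
    forall c, atlas c -> chart_dom c z ->
      jacobian (F \o chart_from c) (chart_to c z) \in unitmx }.

Definition separable (K L : set M) := exists2 F : M -> Cplane R,
  holomorphic F & polynomial_hull (F @` K) `&` polynomial_hull (F @` L) = set0.

(* An element of O(U) is represented by a total function holomorphic on [U]. *)
Definition runge_domain (U : set M) :=
  [/\ open U, connected U &
    forall f : M -> Cplane R, holomorphic_on U f ->
      exists2 g : nat -> M -> Cplane R, (forall k, holomorphic (g k)) &
        forall z, U z -> exists2 V, nbhs z V & {uniform V, g @ \oo --> f}].

End Stein.

Definition universal (X : topologicalType) (T : nat -> X -> X) :=
  exists x, dense (range (fun l => T l x)).

Definition hereditarily_universal (X : topologicalType) (T : nat -> X -> X) :=
  forall k : nat -> nat, {homo k : i j / (i < j)%N} ->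
    universal (fun l => T (k l)).

Definition hypercyclic_wrt (X : topologicalType) (T : X -> X) (n : nat -> nat) :=
  universal (fun l => iter (n l) T).

Definition hereditarily_hypercyclic_wrt (X : topologicalType) (T : X -> X)
    (n : nat -> nat) :=
  hereditarily_universal (fun l => iter (n l) T).

Section CompositionOperator.
Context {R : realType} {N : nat} (M : complexManifold R N).

Lemma near_eq_differentiable (V W : normedModType R[i]) (f g : V -> W) (x : V) :
  (\forall y \near x, f y = g y) -> differentiable f x -> differentiable g x.
Proof.
move=> fg df.
have [cdf /eqaddoP fE] := (diff_locallyP x f).1 df.
have gE : g \o shift x = cst (g x) + 'd f x +o_ 0 id.
  apply/eqaddoP => e e0; have := fE e e0.
  have : \forall h \near (0 : V), f (h + x) = g (h + x).
    by move: fg; rewrite (near_shift 0 x) subr0.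
  by apply: filterS2 => h; rewrite !fctE /= (nbhs_singleton fg) => ->.
have dgE := diff_unique cdf gE.
apply: (diff_locallyP x g).2; rewrite dgE; exact: (conj cdf gE).
Qed.

Lemma holomorphic_comp (phi : M -> M) (f : M -> Cplane R) :
  holomorphic_self_map phi -> holomorphic f -> holomorphic (f \o phi).
Proof.
move=> [cphi hphi] hf c ac z _ cz.
have [d ad dz] := atlas_cover (phi z).
apply: (@near_eq_differentiable _ _
  ((f \o chart_from d) \o (chart_to d \o phi \o chart_from c))); last first.
  apply: differentiable_comp; first exact: hphi.
  by rewrite /= (chart_toK cz); exact: hf.
have cfz : chart_from c w @[w --> chart_to c z] --> z.
  rewrite -[X in _ --> X](chart_toK cz).
  have := @chart_from_continuous _ _ _ c.
  rewrite (continuous_open_subspace _ (@chart_img_open _ _ _ c)).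
  by apply; apply/mem_set; exists z.
have : nbhs z (phi @^-1` chart_dom d).
  by apply: cphi; exact: (open_nbhs_nbhs (conj (@chart_dom_open _ _ _ d) dz)).
move=> /cfz dw; near=> w.
have /= /chart_toK -> // : (chart_from c @^-1` (phi @^-1` chart_dom d)) w.
by near: w.
Unshelve. all: by end_near.
Qed.

Definition comp_op (phi : M -> M) (hphi : holomorphic_self_map phi)
    (f : holo_space M) : holo_space M :=
  exist _ (\val f \o phi : {family compact, M -> Cplane R})
    (mem_set (holomorphic_comp hphi (set_mem (valP f)))).

Lemma comp_op_continuous (phi : M -> M) (hphi : holomorphic_self_map phi) :
  continuous (comp_op hphi).
Proof.
have [cphi _] := hphi.
apply: continuous_comp_initial => f.
apply/(@fam_cvgP _ _ _ _ _ 
  (fmap_filter _ (nbhs_filter (f : holo_space M)))) => K cK P /uniform_nbhs[E [entE EP]].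
have cK' : compact (phi @` K).
  by apply: continuous_compact => //; exact: continuous_subspaceT.
have Q := @fam_nbhs M (Cplane R) compact _ _ (set_val f) entE cK'.
have /= Q' := @initial_continuous (holo_space M) _ set_val f _ Q.
apply: (@filterS _ _ (nbhs_filter (f : holo_space M)) _ _ _ Q') => g /= H.
by apply: EP => y Ky; apply: H; exists y.
Qed.

End CompositionOperator.

(* Main.v *)
(**
Necessity.  If the orbit of f is dense, then phi is injective because functions
separate points, and g = h o phi with h holomorphic on phi(Omega) is a limit of
functions f o phi^(n_l) = (f o phi^(n_l - 1)) o phi, so h is a limit of the
global functions f o phi^(n_l - 1).  If f o phi^(n_m) is close to 0 on K and
f o phi^(n_l) is close to 1 on phi^(n_m)(K), then F = f o phi^(n_m) maps K and
phi^(n_l)(K) into disjoint discs.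

Sufficiency.  An injective holomorphic map has invertible derivative (Osgood),
so phi is biholomorphic onto its image, and the Runge property makes C_phi^m
have dense range: some g' satisfies g' o phi^m ~ g on K.  If K and phi^m(K) are
separated by F, an entire function p is close to 0 on the hull of F(K) and
close to 1 on the hull of F(phi^m(K)); then h = f + (g' - f) (p o F) is close
to f on K while h o phi^m is close to g on K.  A universal function is obtained
as the limit of such successive corrections, the targets running through a
countable dense family.  Part (2) is part (1) applied to subsequences.

The planar function p.  If K1 and K2 are disjoint polynomially convex compact
sets, a discrete form of Janiszewski's theorem shows that every point off
K1 U K2 can be joined to infinity off K1 U K2, so by pole pushing 1/(z - a) is
uniformly approximable by entire functions on K1 U K2.  Surround K2 by a cycle
of short grid edges [a, b]; the product of the principal square roots of
(z - b)/(z - a) over the edges is -1 on K2 and 1 on K1.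
*)

Require Import Defs.
From HB Require Import structures.
From mathcomp Require Import all_boot all_order all_algebra complex.
From mathcomp Require Import all_classical all_reals all_analysis.
From mathcomp Require Import ring lra.

Set Implicit Arguments.
Unset Strict Implicit.
Unset Printing Implicit Defensive.

Import Order.TTheory GRing.Theory Num.Theory.
Import numFieldNormedType.Exports.
Import Normc.

Local Open Scope classical_set_scope.
Local Open Scope complex_scope.
Local Open Scope ring_scope.

(** * Complex differentiability in normed spaces *)

Section RealNorm.
Variable R : realType.
Local Notation C := (R[i]^o).

(** In several variables a vanishing Jacobian determinant does not at once contradict injectivity.
    Osgood's theorem is therefore proved by induction on the dimension: slicing shows that the whole
    derivative vanishes wherever the determinant does. Then a holomorphic function vanishing on the
    singular set has derivatives vanishing there too, since otherwise that set would contain a curve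
    on which the map, having zero derivative, is constant. So the determinant vanishes to infinite
    order, hence near the point, and the map is locally constant. Cauchy's theory is kept
    quantitative: integrals run over squares, and the lower bound 4 for the modulus of the winding
    integral replaces its exact value. The constants are not sharp, which is harmless. In the plane
    the hypotheses concern K1 and K2 separately, whereas a pole has to avoid both on its way to
    infinity; this is the reason for the lattice paths. Square roots rather than logarithms are used
    because signs then replace winding numbers, and the bookkeeping of branches becomes Boolean. *)

Definition rn (V : normedModType R[i]) (v : V) : R := complex.Re `|v|.

(** Norms of modules over [R[i]] are complex numbers; the real number [rn v] makes estimates
    accessible to order reasoning in [R]. *)
Lemma rnE (V : normedModType R[i]) (v : V) : `|v| = (rn v)%:C.
Proof. by rewrite /rn RRe_real // ger0_real. Qed.

Lemma rn_ge0 (V : normedModType R[i]) (v : V) : 0 <= rn v.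
Proof. by rewrite -ler0c -rnE normr_ge0. Qed.

Lemma rn0 (V : normedModType R[i]) : rn (0 : V) = 0.
Proof. by apply: complexI; rewrite -rnE normr0. Qed.

Lemma rnN (V : normedModType R[i]) (v : V) : rn (- v) = rn v.
Proof. by rewrite /rn normrN. Qed.

Lemma rnBC (V : normedModType R[i]) (v w : V) : rn (v - w) = rn (w - v).
Proof. by rewrite /rn distrC. Qed.

Lemma rnD (V : normedModType R[i]) (v w : V) : rn (v + w) <= rn v + rn w.
Proof. by rewrite -lecR rmorphD /= -!rnE ler_normD. Qed.

Lemma rnB (V : normedModType R[i]) (v w : V) : rn (v - w) <= rn v + rn w.
Proof. by rewrite (le_trans (rnD _ _))// rnN. Qed.

Lemma rn_dist (V : normedModType R[i]) (u v w : V) :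
  rn (v - w) <= rn (v - u) + rn (u - w).
Proof. by rewrite (le_trans _ (rnD _ _))// addrA subrK. Qed.

Lemma rn_eq0 (V : normedModType R[i]) (v : V) : rn v = 0 -> v = 0.
Proof. by move=> v0; apply/normr0_eq0; rewrite rnE v0. Qed.

Lemma rn_gt0 (V : normedModType R[i]) (v : V) : v != 0 -> 0 < rn v.
Proof.
by move=> v0; rewrite lt_neqAle rn_ge0 andbT; apply: contra v0 => /eqP/esym/rn_eq0 ->.
Qed.

Lemma normcE_C (z : C) : `|z| = (normc z)%:C.
Proof. by rewrite normc_def; case: z. Qed.

Lemma rnC (z : C) : rn z = normc z.
Proof. by rewrite /rn normcE_C. Qed.

Lemma rnZ (V : normedModType R[i]) (a : C) (v : V) : rn (a *: v) = normc a * rn v.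
Proof. by apply: complexI; rewrite rmorphM /= -rnE normrZ rnE normcE_C. Qed.

Lemma normc_ge0 (z : C) : 0 <= normc z.
Proof. by rewrite -rnC rn_ge0. Qed.

Lemma normc_gt0 (z : C) : (0 < normc z) = (z != 0).
Proof.
apply/idP/idP => [|z0]; last by rewrite -rnC rn_gt0.
by apply: contraTN => /eqP ->; rewrite normc0 ltxx.
Qed.

Lemma normcD (z w : C) : normc (z + w) <= normc z + normc w.
Proof. exact: le_normcD. Qed.

Lemma normcB (z w : C) : normc (z - w) <= normc z + normc w.
Proof. by rewrite -!rnC rnB. Qed.

Lemma normcBC (z w : C) : normc (z - w) = normc (w - z).
Proof. by rewrite -!rnC rnBC. Qed.

Lemma normc_dist (u v w : C) : normc (v - w) <= normc (v - u) + normc (u - w).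
Proof. by rewrite -!rnC rn_dist. Qed.

Lemma normcX (z : C) n : normc (z ^+ n) = normc z ^+ n.
Proof. by elim: n => [|n IH]; rewrite ?normc1// !exprS normcM IH. Qed.

Lemma normc_real (x : R) : normc (x%:C : C) = `|x|.
Proof. by rewrite /normc /= expr0n /= addr0 sqrtr_sqr. Qed.

Lemma normci : normc ('i : C) = 1 :> R.
Proof. by rewrite /normc /= expr0n /= add0r expr1n sqrtr1. Qed.

Lemma normc_nat n : normc (n%:R : C) = n%:R :> R.
Proof. by rewrite -[n%:R : C](rmorph_nat (real_complex R)) normc_real normr_nat. Qed.

Lemma normc_sqr (z : C) : normc z ^+ 2 = complex.Re z ^+ 2 + complex.Im z ^+ 2.
Proof. by case: z => a b /=; rewrite sqr_sqrtr // addr_ge0 // sqr_ge0. Qed.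

Lemma normc_Re (z : C) : `|complex.Re z| <= normc z.
Proof.
rewrite -(@ler_pXn2r _ 2) // ?nnegrE ?normc_ge0 // real_normK ?num_real //.
by rewrite normc_sqr lerDl sqr_ge0.
Qed.

Lemma normc_Im (z : C) : `|complex.Im z| <= normc z.
Proof.
rewrite -(@ler_pXn2r _ 2) // ?nnegrE ?normc_ge0 // real_normK ?num_real //.
by rewrite normc_sqr lerDr sqr_ge0.
Qed.

Lemma normc_ReIm (z : C) : normc z <= `|complex.Re z| + `|complex.Im z|.
Proof.
rewrite -(@ler_pXn2r _ 2) // ?nnegrE ?normc_ge0 ?addr_ge0 //.
rewrite normc_sqr sqrrD !real_normK ?num_real //.
have := mulr_ge0 (normr_ge0 (complex.Re z)) (normr_ge0 (complex.Im z)); lra.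
Qed.

Lemma normc_ReB (z w : C) : `|complex.Re z - complex.Re w| <= normc (z - w).
Proof. by apply: le_trans (normc_Re _); case: z w => ? ? []. Qed.

Lemma normc_ImB (z w : C) : `|complex.Im z - complex.Im w| <= normc (z - w).
Proof. by apply: le_trans (normc_Im _); case: z w => ? ? []. Qed.

Lemma nbhs_rn (V : normedModType R[i]) (x : V) (A : set V) :
  nbhs x A <-> exists2 e : R, 0 < e & forall y, rn (y - x) < e -> A y.
Proof.
split=> [/nbhs_normP[e /= e0 eA]|[e e0 eA]].
  have ee : e = (complex.Re e)%:C by rewrite RRe_real // gtr0_real.
  exists (complex.Re e); first by rewrite -ltcR -ee.
  by move=> y yx; apply: eA => /=; rewrite rnE ee ltcR rnBC.
apply/nbhs_normP; exists e%:C; first by rewrite /= ltcR.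
by move=> y /=; rewrite rnE ltcR rnBC => /eA.
Qed.

Lemma continuous_rn (V W : normedModType R[i]) (f : V -> W) (x : V) :
  {for x, continuous f} <-> forall e : R, 0 < e ->
    exists2 d : R, 0 < d & forall y, rn (y - x) < d -> rn (f y - f x) < e.
Proof.
split=> [cf e e0|cf A /nbhs_rn[e e0 eA]].
  have /nbhs_rn[d d0 dA] : nbhs x (f @^-1` [set y | rn (y - f x) < e]).
    by apply: cf; apply/nbhs_rn; exists e.
  by exists d.
have [d d0 dA] := cf e e0; apply/nbhs_rn; exists d => // y /dA; exact: eA.
Qed.

Lemma differentiable_rn (V W : normedModType R[i]) (f : V -> W) (x : V) :
  differentiable f x -> forall e : R, 0 < e -> exists2 d : R, 0 < d &
    forall h, rn h < d -> rn (f (x + h) - f x - 'd f x h) <= e * rn h.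
Proof.
move=> df e e0.
have [cdf /eqaddoP fE] := (diff_locallyP x f).1 df.
have /nbhs_rn[d d0 dE] := fE e%:C (ltac:(by rewrite ltcR)).
exists d => // h hd; have := dE h; rewrite subr0 => /(_ hd).
by rewrite !fctE /= !rnE -rmorphM /= lecR opprD addrA [h + x]addrC.
Qed.

Lemma rn_differentiable (V W : normedModType R[i]) (f : V -> W) (x : V)
    (L : {linear V -> W}) :
  continuous L -> (forall e : R, 0 < e -> exists2 d : R, 0 < d &
    forall h, rn h < d -> rn (f (x + h) - f x - L h) <= e * rn h) ->
  differentiable f x /\ 'd f x = L :> (V -> W).
Proof.
move=> cL H.
have fE : f \o shift x = cst (f x) + L +o_ 0 id.
  apply/eqaddoP => e e0; apply/nbhs_rn.
  have ee : e = (complex.Re e)%:C by rewrite RRe_real // gtr0_real.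
  have [d d0 dH] := H (complex.Re e) (ltac:(by rewrite -ltcR -ee)).
  exists d => // h; rewrite subr0 => /dH.
  by rewrite ee !fctE /= !rnE -rmorphM /= lecR opprD addrA [h + x]addrC.
have dE := diff_unique cL fE.
split=> //; apply: (diff_locallyP x f).2; rewrite dE; exact: (conj cL fE).
Qed.

Lemma exp2_small (K e : R) : 0 <= K -> 0 < e ->
  exists k, forall j, (k <= j)%N -> K / 2 ^+ j < e.
Proof.
move=> K0 e0; exists (Num.bound (K / e)) => j kj.
rewrite ltr_pdivrMr ?exprn_gt0 // mulrC -ltr_pdivrMr //.
apply: lt_le_trans (archi_boundP _) _; first by rewrite divr_ge0 // ltW.
by rewrite -natrX ler_nat (leq_trans kj) // ltnW // ltn_expl.
Qed.

(** Completeness in the form used throughout: the explicit tail bound is what later estimates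
    consume. Real and imaginary parts converge by comparison with a geometric series. *)
Lemma geometric_limit (u : nat -> C) (K : R) :
  (forall k, normc (u k.+1 - u k) <= K / 2 ^+ k) ->
  exists l : C, forall k, normc (u k - l) <= 2 * K / 2 ^+ k.
Proof.
move=> uK.
have real_lim (v : nat -> R) : (forall k, `|v k.+1 - v k| <= K / 2 ^+ k) ->
    exists l : R, v @ \oo --> l.
  move=> vK; suff : cvgn v by move=> /cvg_ex.
  have -> : v = series (fun k => v k.+1 - v k) + cst (v 0%N).
    by apply/funext => k; rewrite !fctE /= /series /= telescope_sumr // subrK.
  apply: is_cvgD; last exact: is_cvg_cst.
  apply: normed_cvg.
  apply: (@series_le_cvg _ _ (geometric K (2^-1))) => [k|k|k|].
  - exact: normr_ge0.
  - by rewrite /geometric /= exprVn; apply: le_trans (vK k); exact: normr_ge0.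
  - by rewrite /geometric /= exprVn; apply: vK.
  - apply: is_cvg_geometric_series; rewrite ger0_norm ?invr_ge0//.
    by rewrite invf_lt1// ltr1n.
have [a ua] := real_lim (fun k => complex.Re (u k)) (fun k =>
  le_trans (normc_ReB _ _) (uK k)).
have [b ub] := real_lim (fun k => complex.Im (u k)) (fun k =>
  le_trans (normc_ImB _ _) (uK k)).
have uD k m : normc (u (k + m)%N - u k) <= 2 * K / 2 ^+ k - 2 * K / 2 ^+ (k + m).
  elim: m => [|m IH]; first by rewrite addn0 !subrr normc0.
  apply: le_trans (normc_dist (u (k + m)%N) _ _) _.
  rewrite addnS; apply: le_trans (lerD (uK _) IH) _; rewrite exprS.
  have e0 : (2 ^+ (k + m) : R) != 0 by rewrite expf_neq0.
  by rewrite le_eqVlt; apply/orP; left; apply/eqP; field; rewrite expf_neq0//=.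
have K0 : 0 <= K by have := uK 0%N; rewrite expr0 divr1; apply: le_trans; exact: normc_ge0.
exists (a +i* b) => k; apply/ler_addgt0Pr => e e0.
have e2 : 0 < e / 2 by rewrite divr_gt0.
have /cvgrPdist_lt/(_ _ e2) [p _ pa] := ua.
have /cvgrPdist_lt/(_ _ e2) [q _ qb] := ub.
pose m := (p + q)%N.
have /= := pa (k + m)%N (ltac:(by rewrite /= /m addnCA leq_addr)).
have /= := qb (k + m)%N (ltac:(by rewrite /= /m addnA leq_addl)).
move=> hb ha; apply: le_trans (normc_dist (u (k + m)%N) _ _) _.
apply: lerD.
  rewrite normcBC; apply: le_trans (uD _ _) _; rewrite gerBl.
  by rewrite divr_ge0 ?mulr_ge0 ?exprn_ge0.
apply: le_trans (normc_ReIm _) _; move: ha hb.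
by case: (u (k + m)%N) => x y /=; rewrite distrC [`|b - _|]distrC; lra.
Qed.

End RealNorm.

Arguments normc {R} x : simpl never.

Section Calculus.
Variables (R : realType) (V : normedModType R[i]).
Local Notation C := (R[i]^o).
Implicit Types (f g : V -> C) (x : V).

Lemma dfC_cst (c : C) x : differentiable (fun _ : V => c) x.
Proof. exact: differentiable_cst. Qed.

Lemma dfC_D f g x : differentiable f x -> differentiable g x ->
  differentiable (fun y => f y + g y : C) x.
Proof. exact: differentiableD. Qed.

Lemma dfC_B f g x : differentiable f x -> differentiable g x ->
  differentiable (fun y => f y - g y : C) x.
Proof. exact: differentiableB. Qed.

Lemma dC_B f g x v : differentiable f x -> differentiable g x ->
  'd (fun y => f y - g y : C) x v = 'd f x v - 'd g x v.
Proof. by move=> df dg; exact: (congr1 (fun h => h v) (diffB df dg)). Qed.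

Lemma dfC_M f g x : differentiable f x -> differentiable g x ->
  differentiable (fun y => f y * g y : C) x.
Proof. exact: (@differentiableM _ V f g x). Qed.

Lemma dfC_V f x : differentiable f x -> f x != 0 ->
  differentiable (fun y => (f y)^-1 : C) x.
Proof. exact: (@differentiableV _ V f x). Qed.

Lemma dfC_X f x n : differentiable f x -> differentiable (fun y => f y ^+ n : C) x.
Proof.
move=> df; elim: n => [|n IH]; first exact: dfC_cst.
by under eq_fun do rewrite exprS; apply: dfC_M.
Qed.

Lemma dfC_sum (I : Type) (r : seq I) (P : pred I) (F : I -> V -> C) x :
  (forall i, P i -> differentiable (F i) x) ->
  differentiable (fun y => \sum_(i <- r | P i) F i y : C) x.
Proof.
move=> dF; elim: r => [|i r IH].
  by under eq_fun do rewrite big_nil; exact: dfC_cst.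
under eq_fun do rewrite big_cons; case: (boolP (P i)) => [Pi|_]; last exact: IH.
exact: dfC_D (dF i Pi) IH.
Qed.

Lemma dfC_prod (I : Type) (r : seq I) (P : pred I) (F : I -> V -> C) x :
  (forall i, P i -> differentiable (F i) x) ->
  differentiable (fun y => \prod_(i <- r | P i) F i y : C) x.
Proof.
move=> dF; elim: r => [|i r IH].
  by under eq_fun do rewrite big_nil; exact: dfC_cst.
under eq_fun do rewrite big_cons; case: (boolP (P i)) => [Pi|_]; last exact: IH.
exact: dfC_M (dF i Pi) IH.
Qed.

Lemma df_id (W : normedModType R[i]) (w : W) : differentiable (fun y : W => y) w.
Proof. exact: (@differentiable_id _ W w) || exact: ex_diff. Qed.

Lemma df_cst (W W' : normedModType R[i]) (c : W') (w : W) : differentiable (fun _ : W => c) w.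
Proof. exact: differentiable_cst. Qed.

Lemma df_D (W W' : normedModType R[i]) (f g : W -> W') (w : W) :
  differentiable f w -> differentiable g w -> differentiable (fun y => f y + g y) w.
Proof. exact: differentiableD. Qed.

Lemma df_comp (W W' : normedModType R[i]) (f : V -> W) (g : W -> W') x :
  differentiable f x -> differentiable g (f x) -> differentiable (fun y => g (f y)) x.
Proof. exact: differentiable_comp. Qed.

Lemma df_line (W : normedModType R[i]) (a v : W) (t : C) :
  differentiable (fun s : C => a + s *: v) t.
Proof.
apply: df_D; first exact: df_cst.
exact: (@differentiableZl _ _ _ (fun s : C => s) v t (df_id t)).
Qed.

Lemma near_eq_df (W W' : normedModType R[i]) (f g : W -> W') (x : W) (r : R) :
  0 < r -> (forall y, rn (y - x) < r -> f y = g y) ->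
  differentiable f x -> differentiable g x.
Proof.
move=> r0 fg; apply: near_eq_differentiable; apply/nbhs_rn; by exists r.
Qed.

Lemma df_continuous (W W' : normedModType R[i]) (f : W -> W') (x : W) :
  differentiable f x -> {for x, continuous f}.
Proof. by move=> /differentiable_continuous. Qed.

End Calculus.

(** * Cauchy's formula on rectangles and Taylor expansion *)

Section ComplexIntegral.
Variable R : realType.
Local Notation C := (R[i]^o).
Local Notation mu := (@lebesgue_measure R).

Definition seg_continuous (a b : R) (f : R -> C) :=
  forall x, a <= x <= b -> forall e : R, 0 < e -> exists2 d : R, 0 < d &
    forall y, a <= y <= b -> `|y - x| < d -> normc (f y - f x) < e.

Definition cint (a b : R) (f : R -> C) : C :=
  (Rintegral mu `[a, b] (fun x => complex.Re (f x))) +i*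
  (Rintegral mu `[a, b] (fun x => complex.Im (f x))).

Lemma seg_integrable a b (f : R -> R) :
  (forall x, a <= x <= b -> forall e : R, 0 < e -> exists2 d : R, 0 < d &
    forall y, a <= y <= b -> `|y - x| < d -> `|f y - f x| < e) ->
  mu.-integrable `[a, b] (EFin \o f).
Proof.
move=> cf; apply: continuous_compact_integrable; first exact: segment_compact.
apply/subspace_continuousP => x /=; rewrite in_itv /= => xab.
apply/cvgrPdist_lt => e e0; have [d d0 df] := cf x xab e e0.
rewrite near_withinE; near=> y => yab; rewrite distrC; apply: df.
  by move: yab; rewrite /= in_itv.
by rewrite distrC; near: y; exact: cvgr_dist_lt.
Unshelve. all: by end_near. Qed.

Lemma seg_integrable_Re a b f : seg_continuous a b f ->
  mu.-integrable `[a, b] (EFin \o (fun x => complex.Re (f x))).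
Proof.
move=> cf; apply: seg_integrable => x xab e e0; have [d d0 df] := cf x xab e e0.
by exists d => // y yab yx; apply: le_lt_trans (normc_ReB _ _) (df y yab yx).
Qed.

Lemma seg_integrable_Im a b f : seg_continuous a b f ->
  mu.-integrable `[a, b] (EFin \o (fun x => complex.Im (f x))).
Proof.
move=> cf; apply: seg_integrable => x xab e e0; have [d d0 df] := cf x xab e e0.
by exists d => // y yab yx; apply: le_lt_trans (normc_ImB _ _) (df y yab yx).
Qed.

Lemma cint_eq a b f g : (forall x, a <= x <= b -> f x = g x) ->
  cint a b f = cint a b g.
Proof.
by move=> fg; congr (_ +i* _); apply: eq_Rintegral => x;
  rewrite inE /= in_itv /= => /fg ->.
Qed.

Lemma cintD a b f g : seg_continuous a b f -> seg_continuous a b g ->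
  cint a b (fun x => f x + g x) = cint a b f + cint a b g.
Proof.
move=> cf cg; rewrite /cint -[LHS]/(_ +i* _) -[RHS]/(_ +i* _).
congr (_ +i* _).
  rewrite -RintegralD //; try exact: seg_integrable_Re.
  by apply: eq_Rintegral => x _; case: (f x) (g x) => ? ? [].
rewrite -RintegralD //; try exact: seg_integrable_Im.
by apply: eq_Rintegral => x _; case: (f x) (g x) => ? ? [].
Qed.

Lemma cintZ a b (c : C) f : seg_continuous a b f ->
  cint a b (fun x => c * f x) = c * cint a b f.
Proof.
move=> cf; have iR := seg_integrable_Re cf; have iI := seg_integrable_Im cf.
case: c => u v; rewrite /cint -[RHS]/((_ - _) +i* (_ + _)).
have iZ r g : mu.-integrable `[a, b] (EFin \o g) ->
    mu.-integrable `[a, b] (EFin \o (fun x => r * g x)).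
  by move=> ig; apply: (eq_integrable _ (fun x => r%:E * (EFin \o g) x)%E) => //;
    apply: integrableZl.
congr (_ +i* _); rewrite -!RintegralZl //.
  rewrite -RintegralB //; try exact: iZ.
  by apply: eq_Rintegral => x _; case: (f x).
rewrite -RintegralD //; try exact: iZ.
by apply: eq_Rintegral => x _; case: (f x).
Qed.

Lemma cint_cst a b (c : C) : a <= b -> cint a b (fun=> c) = (b - a)%:C * c.
Proof.
move=> ab; rewrite /cint !Rintegral_cst //= lebesgue_measure_itv /= lte_fin.
have -> : fine (if a < b then (b%:E - a%:E)%E else 0%E) = b - a.
  by case: ltgtP ab => //= ->; rewrite subrr.
by case: c => u v /=; rewrite -[RHS]/((_ - _) +i* (_ + _)) !mul0r subr0 addr0 ![_ * (b - a)]mulrC.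
Qed.

Lemma cint_split a m b f : a <= m -> m <= b -> seg_continuous a b f ->
  cint a b f = cint a m f + cint m b f.
Proof.
move=> am mb cf; rewrite /cint -[RHS]/(_ +i* _).
have iR := seg_integrable_Re cf; have iI := seg_integrable_Im cf.
have split g : mu.-integrable `[a, b] (EFin \o g) ->
    Rintegral mu `[a, b] g = Rintegral mu `[a, m] g + Rintegral mu `[m, b] g.
  move=> ig; rewrite -[X in _ + X](@Rintegral_itv_obnd_cbnd _ m (BRight b)); last first.
    apply: integrableS ig => //; apply: subset_itvr; by rewrite bnd_simp.
  by rewrite -(Rintegral_itvB ig (x := m)) ?bnd_simp // addrCA subrr addr0.
by congr (_ +i* _); apply: split.
Qed.

(** The factor 2 comes from bounding real and imaginary parts separately; it is one source of the
    non-sharp constants below. *)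
Lemma cint_bound a b f (M : R) : a <= b -> seg_continuous a b f ->
  (forall x, a <= x <= b -> normc (f x) <= M) ->
  normc (cint a b f) <= 2 * M * (b - a).
Proof.
move=> ab cf fM; apply: le_trans (normc_ReIm _) _ => /=.
have bnd g : mu.-integrable `[a, b] (EFin \o g) ->
    (forall x, a <= x <= b -> `|g x| <= M) -> `|Rintegral mu `[a, b] g| <= M * (b - a).
  move=> ig gM; apply: le_trans (le_normr_Rintegral _ ig) _ => //.
  have icst : mu.-integrable `[a, b] (EFin \o (fun=> M)).
    by apply: seg_integrable => x _ e e0; exists 1 => // y _ _; rewrite subrr normr0.
  have -> : M * (b - a) = Rintegral mu `[a, b] (fun=> M).
    rewrite Rintegral_cst //= lebesgue_measure_itv /= lte_fin.
    by case: ltgtP ab => //= ->; rewrite subrr.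
  apply: le_Rintegral => //; first exact: integrable_norm.
have h1 := bnd _ (seg_integrable_Re cf) (fun x xab => le_trans (normc_Re _) (fM x xab)).
have h2 := bnd _ (seg_integrable_Im cf) (fun x xab => le_trans (normc_Im _) (fM x xab)).
by rewrite -mulrA mulr_natl mulr2n lerD.
Qed.

Lemma cint_Re_ge a b f (m : R) : a <= b -> seg_continuous a b f ->
  (forall x, a <= x <= b -> m <= complex.Re (f x)) ->
  m * (b - a) <= complex.Re (cint a b f).
Proof.
move=> ab cf fm /=.
have icst : mu.-integrable `[a, b] (EFin \o (fun=> m)).
  by apply: seg_integrable => x _ e e0; exists 1 => // y _ _; rewrite subrr normr0.
have -> : m * (b - a) = Rintegral mu `[a, b] (fun=> m).
  rewrite Rintegral_cst //= lebesgue_measure_itv /= lte_fin.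
  by case: ltgtP ab => //= ->; rewrite subrr.
apply: le_Rintegral => //; first exact: seg_integrable_Re.
Qed.

End ComplexIntegral.

Arguments cint {R} a b f : simpl never.

Section Goursat.
Variable R : realType.
Local Notation C := (R[i]^o).

Definition rect : Type := ((R * R) * (R * R))%type.

Definition wf (q : rect) := q.1.1 <= q.1.2 /\ q.2.1 <= q.2.2.

Definition in_rect (q : rect) (z : C) :=
  (q.1.1 <= complex.Re z <= q.1.2) && (q.2.1 <= complex.Im z <= q.2.2).

Definition on_bd (q : rect) (z : C) :=
  in_rect q z && [|| complex.Re z == q.1.1, complex.Re z == q.1.2,
                     complex.Im z == q.2.1 | complex.Im z == q.2.2].

(** The counterclockwise boundary integral: bottom minus top, plus ['i] times right minus left
    because dz = i dy on vertical sides. *)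
Definition rint (F : C -> C) (q : rect) : C :=
  cint q.1.1 q.1.2 (fun x => F (x +i* q.2.1))
  - cint q.1.1 q.1.2 (fun x => F (x +i* q.2.2))
  + 'i * (cint q.2.1 q.2.2 (fun y => F (q.1.2 +i* y))
          - cint q.2.1 q.2.2 (fun y => F (q.1.1 +i* y))).

Arguments rint : simpl never.

Definition bd_continuous (F : C -> C) (q : rect) :=
  forall z, on_bd q z -> {for z, continuous F}.

Lemma seg_continuous_h (F : C -> C) a b y :
  (forall x, a <= x <= b -> {for (x +i* y : C), continuous F}) ->
  seg_continuous a b (fun x => F (x +i* y)).
Proof.
move=> cF x xab e e0; have /continuous_rn/(_ _ e0) [d d0 df] := cF x xab.
exists d => // x' _ xx'; rewrite -rnC; apply: df.
by rewrite rnC -[_ - _]/(_ +i* _) subrr normc_real.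
Qed.

Lemma seg_continuous_v (F : C -> C) a b x :
  (forall y, a <= y <= b -> {for (x +i* y : C), continuous F}) ->
  seg_continuous a b (fun y => F (x +i* y)).
Proof.
move=> cF y yab e e0; have /continuous_rn/(_ _ e0) [d d0 df] := cF y yab.
exists d => // y' _ yy'; rewrite -rnC; apply: df.
by rewrite rnC -[_ - _]/(_ +i* _) subrr /normc /= expr0n /= add0r sqrtr_sqr.
Qed.

Lemma bd_continuous_sides F q : wf q -> bd_continuous F q ->
  [/\ seg_continuous q.1.1 q.1.2 (fun x => F (x +i* q.2.1)),
      seg_continuous q.1.1 q.1.2 (fun x => F (x +i* q.2.2)),
      seg_continuous q.2.1 q.2.2 (fun y => F (q.1.2 +i* y)) &
      seg_continuous q.2.1 q.2.2 (fun y => F (q.1.1 +i* y))].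
Proof.
move=> [w1 w2] cF; split.
- by apply: seg_continuous_h => x xab; apply: cF; rewrite /on_bd /in_rect /= xab w2 lexx eqxx !orbT.
- by apply: seg_continuous_h => x xab; apply: cF; rewrite /on_bd /in_rect /= xab w2 lexx eqxx !orbT.
- by apply: seg_continuous_v => x xab; apply: cF; rewrite /on_bd /in_rect /= xab w1 lexx eqxx !orbT.
- by apply: seg_continuous_v => x xab; apply: cF; rewrite /on_bd /in_rect /= xab w1 lexx eqxx.
Qed.

Lemma rintD F G q : wf q -> bd_continuous F q -> bd_continuous G q ->
  rint (fun z => F z + G z) q = rint F q + rint G q.
Proof.
move=> w /(bd_continuous_sides w) [? ? ? ?] /(bd_continuous_sides w) [? ? ? ?].
by rewrite /rint !cintD //; ring.
Qed.

Lemma rintZ (c : C) F q : wf q -> bd_continuous F q ->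
  rint (fun z => c * F z) q = c * rint F q.
Proof.
move=> w /(bd_continuous_sides w) [? ? ? ?].
by rewrite /rint !cintZ //; ring.
Qed.

Lemma rint_eq F G q : wf q -> (forall z, on_bd q z -> F z = G z) ->
  rint F q = rint G q.
Proof.
move=> [w1 w2] FG; rewrite /rint.
congr (_ - _ + 'i * (_ - _)); apply: cint_eq => x xab; apply: FG;
  by rewrite /on_bd /in_rect /= xab ?w1 ?w2 lexx eqxx ?orbT.
Qed.

Lemma rint_cst (c : C) q : wf q -> rint (fun=> c) q = 0.
Proof. by move=> [w1 w2]; rewrite /rint !cint_cst // !subrr mulr0 addr0. Qed.

Lemma rint_id q : wf q -> rint id q = 0.
Proof.
move=> [w1 w2]; rewrite /rint.
have cid z : {for z, continuous (id : C -> C)} by exact: cvg_id.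
have h0 : seg_continuous q.1.1 q.1.2 (fun x => (x +i* q.2.1 : C)).
  exact: (@seg_continuous_h id).
have v0 : seg_continuous q.2.1 q.2.2 (fun y => (q.1.1 +i* y : C)).
  exact: (@seg_continuous_v id).
have cc a b (c : C) : seg_continuous a b (fun=> c).
  by move=> x _ e e0; exists 1 => // y _ _; rewrite subrr normc0.
rewrite (@cint_eq _ _ _ (fun x => x +i* q.2.2) (fun x => (x +i* q.2.1) + (0 +i* (q.2.2 - q.2.1)))); last first.
  by move=> x _; rewrite -[RHS]/(_ +i* _); congr (_ +i* _); ring.
rewrite (@cint_eq _ _ _ (fun x => q.1.2 +i* x) (fun x => (q.1.1 +i* x) + (q.1.2 - q.1.1)%:C)); last first.
  by move=> x _; rewrite -[RHS]/(_ +i* _); congr (_ +i* _); ring.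
rewrite !cintD // !cint_cst //.
set a := cint _ _ _; set b := cint _ _ _.
rewrite (_ : a - _ + _ = 'i * ((q.2.2 - q.2.1)%:C * (q.1.2 - q.1.1)%:C)
  - (q.1.2 - q.1.1)%:C * (0 +i* (q.2.2 - q.2.1))); last by ring.
by apply/eqP; rewrite eq_complex /=; apply/andP; split; apply/eqP; ring.
Qed.

Lemma rint_bound F q (M : R) : wf q -> bd_continuous F q ->
  (forall z, on_bd q z -> normc (F z) <= M) ->
  normc (rint F q) <= 4 * M * ((q.1.2 - q.1.1) + (q.2.2 - q.2.1)).
Proof.
move=> w cF FM; have [h1 h2 h3 h4] := bd_continuous_sides w cF; case: w => w1 w2.
apply: le_trans (normcD _ _) _; rewrite normcM normci mul1r.
have := normcB (cint q.1.1 q.1.2 (fun x => F (x +i* q.2.1))) (cint q.1.1 q.1.2 (fun x => F (x +i* q.2.2))).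
have := normcB (cint q.2.1 q.2.2 (fun y => F (q.1.2 +i* y))) (cint q.2.1 q.2.2 (fun y => F (q.1.1 +i* y))).
suff : [/\ normc (cint q.1.1 q.1.2 (fun x => F (x +i* q.2.1))) <= 2 * M * (q.1.2 - q.1.1),
 normc (cint q.1.1 q.1.2 (fun x => F (x +i* q.2.2))) <= 2 * M * (q.1.2 - q.1.1),
 normc (cint q.2.1 q.2.2 (fun y => F (q.1.2 +i* y))) <= 2 * M * (q.2.2 - q.2.1) &
 normc (cint q.2.1 q.2.2 (fun y => F (q.1.1 +i* y))) <= 2 * M * (q.2.2 - q.2.1)].
  by case; lra.
by split; apply: cint_bound => // x xab; apply: FM;
  rewrite /on_bd /in_rect /= xab ?w1 ?w2 lexx eqxx ?orbT.
Qed.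

Lemma rint_splitx F x0 m x1 y0 y1 : x0 <= m -> m <= x1 -> y0 <= y1 ->
  bd_continuous F ((x0, m), (y0, y1)) -> bd_continuous F ((m, x1), (y0, y1)) ->
  rint F ((x0, x1), (y0, y1)) =
  rint F ((x0, m), (y0, y1)) + rint F ((m, x1), (y0, y1)).
Proof.
move=> x0m mx1 y01 c1 c2; rewrite /rint /=.
have cs y : y = y0 \/ y = y1 -> forall x, x0 <= x <= x1 -> {for (x +i* y : C), continuous F}.
  move=> yy x /andP[x0x xx1]; have [xm|mx] := leP x m.
    by apply: c1; rewrite /on_bd /in_rect /= x0x xm; case: yy => ->; rewrite y01 lexx eqxx !orbT.
  by apply: c2; rewrite /on_bd /in_rect /= xx1 (ltW mx); case: yy => ->; rewrite y01 lexx eqxx !orbT.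
rewrite !(@cint_split _ x0 m x1) //; first by ring.
- by apply: seg_continuous_h; apply: cs; right.
- by apply: seg_continuous_h; apply: cs; left.
Qed.

Lemma rint_splity F x0 x1 y0 m y1 : x0 <= x1 -> y0 <= m -> m <= y1 ->
  bd_continuous F ((x0, x1), (y0, m)) -> bd_continuous F ((x0, x1), (m, y1)) ->
  rint F ((x0, x1), (y0, y1)) =
  rint F ((x0, x1), (y0, m)) + rint F ((x0, x1), (m, y1)).
Proof.
move=> x01 y0m my1 c1 c2; rewrite /rint /=.
have cs x : x = x0 \/ x = x1 -> forall y, y0 <= y <= y1 -> {for (x +i* y : C), continuous F}.
  move=> xx y /andP[y0y yy1]; have [ym|my] := leP y m.
    by apply: c1; rewrite /on_bd /in_rect /= y0y ym; case: xx => ->; rewrite x01 lexx eqxx ?orbT.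
  by apply: c2; rewrite /on_bd /in_rect /= yy1 (ltW my); case: xx => ->; rewrite x01 lexx eqxx ?orbT.
rewrite !(@cint_split _ y0 m y1) //; first by ring.
- by apply: seg_continuous_v; apply: cs; left.
- by apply: seg_continuous_v; apply: cs; right.
Qed.

Definition half (q q' : rect) :=
  [/\ q.1.1 <= q'.1.1 /\ q'.1.2 <= q.1.2, q.2.1 <= q'.2.1 /\ q'.2.2 <= q.2.2,
      q'.1.2 - q'.1.1 = (q.1.2 - q.1.1) / 2 &
      q'.2.2 - q'.2.1 = (q.2.2 - q.2.1) / 2].

Lemma half_in_rect q q' z : half q q' -> in_rect q' z -> in_rect q z.
Proof.
move=> [[a b] [c d] _ _] /andP[/andP[e f] /andP[g h]]; rewrite /in_rect.
by rewrite (le_trans a)//= (le_trans f)//= (le_trans c)//= (le_trans h).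
Qed.

(** Pigeonhole: inner edges cancel, so some quarter carries at least a quarter of the integral. *)
Lemma rint_half F q : wf q -> (forall z, in_rect q z -> {for z, continuous F}) ->
  exists q', half q q' /\ normc (rint F q) <= 4 * normc (rint F q').
Proof.
case: q => [[x0 x1] [y0 y1]] [/= w1 w2] cF.
pose m := (x0 + x1) / 2; pose n := (y0 + y1) / 2.
have m1 : x0 <= m by rewrite /m; lra.
have m2 : m <= x1 by rewrite /m; lra.
have n1 : y0 <= n by rewrite /n; lra.
have n2 : n <= y1 by rewrite /n; lra.
have mE1 : m - x0 = (x1 - x0) / 2 by rewrite /m; field.
have mE2 : x1 - m = (x1 - x0) / 2 by rewrite /m; field.
have nE1 : n - y0 = (y1 - y0) / 2 by rewrite /n; field.
have nE2 : y1 - n = (y1 - y0) / 2 by rewrite /n; field.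
have cb a b c d : x0 <= a -> b <= x1 -> y0 <= c -> d <= y1 ->
    bd_continuous F ((a, b), (c, d)).
  move=> h1 h2 h3 h4 z /andP[/andP[/andP[e f] /andP[g h]] _]; apply: cF.
  by rewrite /in_rect /= (le_trans h1)//= (le_trans f)//= (le_trans h3)//= (le_trans h).
rewrite (@rint_splitx F x0 m x1) //; try by apply: cb.
rewrite (@rint_splity F x0 m y0 n y1) //; try by apply: cb.
rewrite (@rint_splity F m x1 y0 n y1) //; try by apply: cb.
set A := rint F _; set B := rint F _; set D := rint F _; set E := rint F _.
have := normcD (A + B) (D + E); have := normcD A B; have := normcD D E.
move=> t1 t2 t3.
have [hA|hA] := leP (normc (A + B + (D + E))) (4 * normc A).
  by exists ((x0, m), (y0, n)); split.
have [hB|hB] := leP (normc (A + B + (D + E))) (4 * normc B).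
  by exists ((x0, m), (n, y1)); split.
have [hD|hD] := leP (normc (A + B + (D + E))) (4 * normc D).
  by exists ((m, x1), (y0, n)); split.
by exists ((m, x1), (n, y1)); split; [|rewrite -/E; lra].
Qed.

Lemma differentiable_C (F : C -> C) (z : C) : differentiable F z ->
  exists a : C, forall e : R, 0 < e -> exists2 d : R, 0 < d &
    forall w, normc (w - z) < d ->
      normc (F w - (F z + a * (w - z))) <= e * normc (w - z).
Proof.
move=> dF; exists ('d F z 1) => e e0.
have [d d0 dE] := differentiable_rn dF e0; exists d => // w wz.
have := dE (w - z); rewrite !rnC => /(_ wz); rewrite (addrC z) subrK.
have -> : 'd F z (w - z) = (w - z) * 'd F z 1.
  by rewrite -[w - z in LHS]mulr1 linearZ.
by rewrite opprD addrA [_ * (w - z)]mulrC.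
Qed.

(** Each quartering costs a factor 4. On the k-th rectangle [F] differs from its affine part at the
    common point [l] by a small multiple of the diameter, so its integral is a small multiple of
    4^-k, which pays for the loss; affine functions integrate to zero. *)
Theorem goursat F q : wf q -> (forall z, in_rect q z -> differentiable F z) ->
  rint F q = 0.
Proof.
move=> wq dF.
have cF z : in_rect q z -> {for z, continuous F}.
  by move=> /dF /differentiable_continuous.
have [nx nxP] : exists nx : rect -> rect, forall q', wf q' ->
    (forall z, in_rect q' z -> {for z, continuous F}) ->
    half q' (nx q') /\ normc (rint F q') <= 4 * normc (rint F (nx q')).
  have /choice[nx nxP] : forall q', exists q'', wf q' ->
    (forall z, in_rect q' z -> {for z, continuous F}) ->
    half q' q'' /\ normc (rint F q') <= 4 * normc (rint F q'').
    move=> q'; have [w|nw] := pselect (wf q'); last by exists q'.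
    have [c|nc] := pselect (forall z, in_rect q' z -> {for z, continuous F}).
      by have [q'' h] := rint_half w c; exists q''.
    by exists q'.
  by exists nx.
pose Q k := iter k nx q.
have QP k : [/\ wf (Q k), (forall z, in_rect (Q k) z -> in_rect q z),
     [/\ (Q k).1.2 - (Q k).1.1 = (q.1.2 - q.1.1) / 2 ^+ k &
      (Q k).2.2 - (Q k).2.1 = (q.2.2 - q.2.1) / 2 ^+ k] &
     normc (rint F q) <= 4 ^+ k * normc (rint F (Q k))].
  elim: k => [|k [w i [s1 s2] n]]; first by split => //; rewrite ?expr0 ?divr1 ?mul1r.
  have [h hn] := nxP _ w (fun z zk => cF z (i z zk)); rewrite /Q iterS -/(Q k).
  split.
  - by case: h => [_ _ h1 h2]; case: w => w1 w2; split; rewrite -subr_ge0 ?h1 ?h2 divr_ge0 // subr_ge0.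
  - by move=> z /(half_in_rect h)/i.
  - by case: h => _ _ -> ->; rewrite s1 s2 !exprS !invfM; split; rewrite -mulrA [_^-1 * 2^-1]mulrC.
  - by apply: le_trans n _; rewrite exprSr -mulrA ler_wpM2l // exprn_ge0.
have hQ k : half (Q k) (Q k.+1).
  by have [w i _ _] := QP k; have [] := nxP _ w (fun z zk => cF z (i z zk)).
pose u k : C := (Q k).1.1 +i* (Q k).2.1.
pose K := (q.1.2 - q.1.1) + (q.2.2 - q.2.1).
have K0 : 0 <= K by case: wq => h1 h2; rewrite addr_ge0 // subr_ge0.
have near_corner k z : in_rect (Q k) z -> normc (z - u k) <= K / 2 ^+ k.
  move=> /andP[/andP[a b] /andP[c d]]; apply: le_trans (normc_ReIm _) _.
  have [_ _ [s1 s2] _] := QP k; rewrite /K mulrDl -s1 -s2.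
  case: z a b c d => x y /= a b c d.
  by rewrite !ger0_norm ?subr_ge0 // lerD // lerD2r.
have in_corner k : in_rect (Q k) (u k).
  by have [[w1 w2] _ _ _] := QP k; rewrite /in_rect /u /= !lexx w1 w2.
have [l lP] : exists l : C, forall k, normc (u k - l) <= 2 * K / 2 ^+ k.
  apply: geometric_limit => k; apply: near_corner; apply: half_in_rect (hQ k) _.
  exact: in_corner.
have exp2_gt0 k : 0 < (2 ^+ k : R) by rewrite exprn_gt0.
have small e : 0 < e -> exists k, 2 * K / 2 ^+ k < e.
  move=> e0; have [k hk] := exp2_small (mulr_ge0 (ler0n R 2) K0) e0.
  by exists k; apply: hk.
have lq : in_rect q l.
  have dist k : [/\ q.1.1 <= (Q k).1.1 <= q.1.2 & q.2.1 <= (Q k).2.1 <= q.2.2].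
    by have [_ /(_ _ (in_corner k)) /andP[h1 h2] _ _] := QP k; split.
  have lb e : 0 < e -> [/\ q.1.1 <= complex.Re l + e, complex.Re l <= q.1.2 + e,
     q.2.1 <= complex.Im l + e & complex.Im l <= q.2.2 + e].
    move=> /small [k hk]; have := le_lt_trans (lP k) hk => hl.
    have := le_lt_trans (normc_ReB _ _) hl; have := le_lt_trans (normc_ImB _ _) hl.
    rewrite /u /= !ltr_norml => /andP[a b] /andP[c d].
    by have [/andP[e1 e2] /andP[e3 e4]] := dist k; split; lra.
  rewrite /in_rect; apply/andP; split; apply/andP; split;
    by apply/ler_addgt0Pr => e /lb[].
have [a aP] := differentiable_C (dF l lq).
apply: (@eq0_normc R); apply/eqP; rewrite eq_le normc_ge0 andbT.
apply/ler_addgt0Pr => e e0; rewrite add0r.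
(* Points of the k-th rectangle lie within [3 * K / 2 ^+ k] of [l] and [rint_bound] contributes a
   factor 4, hence 12; the [+ 1] covers [K = 0]. *)
have e'0 : 0 < e / (12 * K * K + 1).
  by rewrite divr_gt0 // ltr_wpDl // !mulr_ge0.
have [d d0 dP] := aP _ e'0.
have [k kd] := small (d / 2) (ltac:(by rewrite divr_gt0)).
have [wk ik [s1 s2] nk] := QP k.
have far z : in_rect (Q k) z -> normc (z - l) <= 3 * K / 2 ^+ k.
  move=> /near_corner h; apply: le_trans (normc_dist (u k) _ _) _.
  have := lP k; move: h; rewrite -!mulrA; lra.
have far' z : in_rect (Q k) z -> normc (z - l) < d.
  move=> /far h; apply: le_lt_trans h _.
  have : K / 2 ^+ k <= 2 * K / 2 ^+ k by rewrite -mulrA ler_peMl ?ler1n // divr_ge0 // ltW.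
  move: kd; rewrite -!mulrA; lra.
pose E z := F z - (F l + a * (z - l)).
have cE : bd_continuous E (Q k).
  move=> z /andP[zk _]; apply: df_continuous; apply: dfC_B; first exact/dF/ik.
  by apply: dfC_D; [exact: dfC_cst|apply: dfC_M;
    [exact: dfC_cst|apply: dfC_B; [exact: df_id|exact: dfC_cst]]].
have FE : rint F (Q k) = rint E (Q k).
  have cA z : {for z, continuous (fun z : C => F l + a * (z - l) : C)}.
    by apply: df_continuous; apply: dfC_D; [exact: dfC_cst|apply: dfC_M;
      [exact: dfC_cst|apply: dfC_B; [exact: df_id|exact: dfC_cst]]].
  rewrite (@rint_eq F (fun z => E z + (F l + a * (z - l)))) //; last first.
    by move=> z _; rewrite /E subrK.
  rewrite (@rintD E (fun z => F l + a * (z - l)) _ wk cE); last by move=> z _; apply: cA.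
  rewrite (@rint_eq (fun z => F l + a * (z - l)) (fun z => (F l - a * l) + a * z)) //; last first.
    by move=> z _; ring.
  rewrite (@rintD (fun=> F l - a * l) (fun z => a * z) _ wk); last 2 first.
    by move=> z _; apply: df_continuous; exact: dfC_cst.
    by move=> z _; apply: df_continuous; apply: dfC_M; [exact: dfC_cst|exact: df_id].
  rewrite (@rint_cst (F l - a * l) _ wk) (@rintZ a id _ wk); first by rewrite (rint_id wk) mulr0 !addr0.
  by move=> z _; apply: df_continuous; exact: df_id.
have bE : normc (rint E (Q k)) <= 4 * (e / (12 * K * K + 1) * (3 * K / 2 ^+ k)) * (K / 2 ^+ k).
  have -> : K / 2 ^+ k = ((Q k).1.2 - (Q k).1.1) + ((Q k).2.2 - (Q k).2.1).
    by rewrite s1 s2 -mulrDl.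
  apply: rint_bound => // z /andP[zk _].
  apply: le_trans (dP z (far' z zk)) _; apply: ler_wpM2l; [exact: ltW|exact: far].
apply: le_trans nk _; rewrite FE.
apply: le_trans (ler_wpM2l (exprn_ge0 _ _) bE) _ => //.
have -> : 4 ^+ k = 2 ^+ k * 2 ^+ k :> R by rewrite -exprMn -natrM.
have e2 : (2 ^+ k : R) != 0 by rewrite gt_eqF.
have eK : 12 * K * K + 1 != 0 by rewrite gt_eqF // ltr_wpDl // !mulr_ge0.
rewrite [X in X <= _](_ : _ = e * ((12 * K * K) / (12 * K * K + 1))); last by field; rewrite eK e2.
have KK : 0 < 12 * K * K + 1 by rewrite ltr_wpDl // !mulr_ge0.
by apply: ler_piMr; [exact: ltW|rewrite ler_pdivrMr // mul1r lerDl].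
Qed.

End Goursat.

Section Cauchy.
Variable R : realType.
Local Notation C := (R[i]^o).

Definition sq (w : C) (r : R) : rect R :=
  ((complex.Re w - r, complex.Re w + r), (complex.Im w - r, complex.Im w + r)).

Lemma ReD (z w : C) : complex.Re (z + w) = complex.Re z + complex.Re w.
Proof. by case: z w => ? ? []. Qed.

Definition in_open (q : rect R) (z : C) :=
  (q.1.1 < complex.Re z < q.1.2) && (q.2.1 < complex.Im z < q.2.2).

Lemma wf_sq w r : 0 <= r -> wf (sq w r).
Proof. by move=> r0; split => /=; lra. Qed.

Lemma on_bd_sq_ge w r z : 0 <= r -> on_bd (sq w r) z -> r <= normc (z - w).
Proof.
move=> r0 /andP[_ /or4P[] /= /eqP h].
- apply: le_trans (normc_ReB _ _); rewrite h; rewrite addrAC subrr add0r normrN ger0_norm //.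
- apply: le_trans (normc_ReB _ _); rewrite h; rewrite addrAC subrr add0r ger0_norm //.
- apply: le_trans (normc_ImB _ _); rewrite h; rewrite addrAC subrr add0r normrN ger0_norm //.
- apply: le_trans (normc_ImB _ _); rewrite h; rewrite addrAC subrr add0r ger0_norm //.
Qed.

Lemma in_sq_le w r z : in_rect (sq w r) z -> normc (z - w) <= 2 * r.
Proof.
move=> /andP[/andP[a b] /andP[c d]]; apply: le_trans (normc_ReIm _) _.
case: z w a b c d => x y [u v] /= a b c d.
have : `|x - u| <= r by rewrite ler_norml; lra.
have : `|y - v| <= r by rewrite ler_norml; lra.
lra.
Qed.

Lemma in_sq w r z : normc (z - w) <= r -> in_rect (sq w r) z.
Proof.
move=> h; have := le_trans (normc_ReB _ _) h; have := le_trans (normc_ImB _ _) h.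
rewrite !ler_norml /in_rect /= => /andP[a b] /andP[c d].
by apply/andP; split; apply/andP; split; lra.
Qed.

Lemma in_open_sq w r : 0 < r -> in_open (sq w r) w.
Proof. by move=> r0; rewrite /in_open /=; apply/andP; split; apply/andP; split; lra. Qed.

(** The four lines through the sides of [q'] cut off four outer rectangles that avoid the interior
    of [q']; Goursat's theorem kills each of them. *)
Lemma rint_deform F (q q' : rect R) : wf q' ->
  q.1.1 <= q'.1.1 /\ q'.1.2 <= q.1.2 -> q.2.1 <= q'.2.1 /\ q'.2.2 <= q.2.2 ->
  (forall z, in_rect q z -> ~~ in_open q' z -> differentiable F z) ->
  rint F q = rint F q'.
Proof.
case: q q' => [[x0 x1] [y0 y1]] [[a b] [c d]] [/= ab cd] [xa bx] [yc dy] dF.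
have ax : a <= x1 by exact: le_trans bx.
have cy : c <= y1 by exact: le_trans dy.
have dF' x2 x3 y2 y3 z : x0 <= x2 -> x3 <= x1 -> y0 <= y2 -> y3 <= y1 ->
    in_rect ((x2, x3), (y2, y3)) z -> ~~ in_open ((a, b), (c, d)) z ->
    differentiable F z.
  move=> h1 h2 h3 h4 /andP[/andP[e f] /andP[g h]] /=; apply: dF.
  by rewrite /in_rect /= (le_trans h1)//= (le_trans f)//= (le_trans h3)//= (le_trans h).
have cb x2 x3 y2 y3 : x0 <= x2 -> x3 <= x1 -> y0 <= y2 -> y3 <= y1 ->
    (forall z, on_bd ((x2, x3), (y2, y3)) z -> ~~ in_open ((a, b), (c, d)) z) ->
    bd_continuous F ((x2, x3), (y2, y3)).
  move=> h1 h2 h3 h4 no z zb; apply: df_continuous; apply: (dF' x2 x3 y2 y3) => //.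
    by case/andP: zb.
  exact: no.
have g0 x2 x3 y2 y3 : x0 <= x2 -> x3 <= x1 -> y0 <= y2 -> y3 <= y1 ->
    x2 <= x3 -> y2 <= y3 ->
    (forall z, in_rect ((x2, x3), (y2, y3)) z -> ~~ in_open ((a, b), (c, d)) z) ->
    rint F ((x2, x3), (y2, y3)) = 0.
  move=> h1 h2 h3 h4 h5 h6 no; apply: goursat => // z zi.
  by apply: (dF' x2 x3 y2 y3) => //; apply: no.
have nl x3 y2 y3 z : x3 <= a -> in_rect ((x0, x3), (y2, y3)) z -> ~~ in_open ((a, b), (c, d)) z.
  move=> xa3 /andP[/andP[_ /= z3] _]; rewrite /in_open /= negb_and negb_and -leNgt.
  by rewrite (le_trans z3).
have nr x2 x3 y2 y3 z : b <= x2 -> in_rect ((x2, x3), (y2, y3)) z -> ~~ in_open ((a, b), (c, d)) z.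
  move=> xa3 /andP[/andP[/= z3 _] _]; rewrite /in_open /= negb_and negb_and -!leNgt.
  by rewrite (le_trans xa3) ?orbT.
have nd x2 x3 y2 y3 z : y3 <= c -> in_rect ((x2, x3), (y2, y3)) z -> ~~ in_open ((a, b), (c, d)) z.
  move=> xa3 /andP[_ /andP[_ /= z3]]; rewrite /in_open /= !negb_and -!leNgt.
  by rewrite (le_trans z3) ?orbT.
have nu x2 x3 y2 y3 z : d <= y2 -> in_rect ((x2, x3), (y2, y3)) z -> ~~ in_open ((a, b), (c, d)) z.
  move=> xa3 /andP[_ /andP[/= z3 _]]; rewrite /in_open /= !negb_and -!leNgt.
  by rewrite (le_trans xa3) ?orbT.
have onbd x2 x3 y2 y3 : x2 <= a -> b <= x3 -> y2 <= c -> d <= y3 ->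
   forall z, on_bd ((x2, x3), (y2, y3)) z -> ~~ in_open ((a, b), (c, d)) z.
  move=> h1 h2 h3 h4 z /andP[_ /= zb]; rewrite /in_open /= !negb_and -!leNgt; case/or4P: zb => /eqP ->.
  - by rewrite h1.
  - by rewrite h2 orbT.
  - by rewrite h3 orbT.
  - by rewrite h4 !orbT.
have y01 : y0 <= y1 by apply: le_trans yc _.
have xb : x0 <= b := le_trans xa ab.
have yd : y0 <= d := le_trans yc cd.
rewrite (@rint_splitx _ F x0 a x1) //; last 2 first.
- by apply: cb => // z /andP[zi _]; apply: nl zi.
- by apply: cb => //; apply: onbd.
rewrite (@g0 x0 a) //; last by move=> z; exact: nl.
rewrite add0r (@rint_splitx _ F a b x1) //; last 2 first.
- by apply: cb => //; apply: onbd.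
- by apply: cb => // z /andP[zi _]; apply: nr zi.
rewrite (@g0 b x1) //; last by move=> z; exact: nr.
rewrite addr0 (@rint_splity _ F a b y0 c y1) //; last 2 first.
- by apply: cb => // z /andP[zi _]; apply: nd zi.
- by apply: cb => //; apply: onbd.
rewrite (@g0 a b y0 c) //; last by move=> z; exact: nd.
rewrite add0r (@rint_splity _ F a b c d y1) //; last 2 first.
- by apply: cb => //; apply: onbd.
- by apply: cb => // z /andP[zi _]; apply: nu zi.
by rewrite (@g0 a b d y1) ?addr0 //; move=> z; exact: nu.
Qed.

Lemma df_kernel (w z : C) : z != w -> differentiable (fun z : C => (z - w)^-1 : C) z.
Proof.
move=> zw; apply: dfC_V; last by rewrite subr_eq0.
by apply: dfC_B; [exact: df_id|exact: dfC_cst].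
Qed.

Lemma on_bd_sq_neq w r z : 0 < r -> on_bd (sq w r) z -> z != w.
Proof.
move=> r0 /(on_bd_sq_ge (ltW r0)) h; apply/eqP => zw; move: h.
by rewrite zw subrr normc0 leNgt r0.
Qed.

Lemma bd_df F q : (forall z, on_bd q z -> differentiable F z) -> @bd_continuous R F q.
Proof. by move=> dF z /dF /df_continuous. Qed.

Lemma seg_continuousB a b (f g : R -> C) : seg_continuous a b f ->
  seg_continuous a b g -> seg_continuous a b (fun x => f x - g x).
Proof.
move=> cf cg x xab e e0.
have e20 : 0 < e / 2 by rewrite divr_gt0.
have [d1 d10 g1] := cf x xab _ e20; have [d2 d20 g2] := cg x xab _ e20.
exists (Num.min d1 d2); first by rewrite lt_min d10.
move=> y yab; rewrite lt_min => /andP[y1 y2].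
have -> : f y - g y - (f x - g x) = (f y - f x) - (g y - g x) by ring.
apply: le_lt_trans (normcB _ _) _.
by rewrite (_ : e = e / 2 + e / 2); [apply: ltrD; [apply: g1|apply: g2]|field].
Qed.

Lemma seg_continuousZ a b (c : C) (f : R -> C) : seg_continuous a b f ->
  seg_continuous a b (fun x => c * f x).
Proof.
move=> cf x xab e e0; have c0 := normc_ge0 c.
have c1 : 0 < normc c + 1 by rewrite ltr_wpDl.
have [d d0 g] := cf x xab _ (divr_gt0 e0 c1); exists d => // y yab yx.
rewrite -mulrBr normcM; have := g y yab yx; rewrite ltr_pdivlMr // => h.
have := normc_ge0 (f y - f x); nra.
Qed.

Lemma cintB a b (f g : R -> C) : seg_continuous a b f -> seg_continuous a b g ->
  cint a b (fun x => f x - g x) = cint a b f - cint a b g.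
Proof.
move=> cf cg.
have cg' := seg_continuousZ (-1) cg.
rewrite (@cint_eq _ _ _ _ (fun x => f x + -1 * g x)); last by move=> x _; rewrite mulN1r.
by rewrite cintD // cintZ // mulN1r.
Qed.

(** Pairing opposite sides yields the positive integrand [2 * r / ((x - c) ^+ 2 + r ^+ 2)], at least
    [r^-1] on a side of length [2 * r]. Each pair thus contributes at least 2, with the same
    phase. *)
Lemma winding_sq_ge (w : C) (r : R) : 0 < r ->
  4 <= normc (rint (fun z => (z - w)^-1) (sq w r)).
Proof.
move=> r0.
have [h1 h2 h3 h4] := bd_continuous_sides (wf_sq w (ltW r0))
  (bd_df (fun z zb => df_kernel (on_bd_sq_neq r0 zb))).
rewrite /rint -cintB // -(cintB h3 h4).
pose P (c : R) x : C := (2 * r / ((x - c) ^+ 2 + r ^+ 2))%:C.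
have den c x : 0 < (x - c) ^+ 2 + r ^+ 2 by rewrite ltr_wpDl ?sqr_ge0 // exprn_gt0.
have e1 : (fun x => (x +i* (sq w r).2.1 - w)^-1 - (x +i* (sq w r).2.2 - w)^-1 : C) =
    (fun x => 'i * P (complex.Re w) x).
  apply/funext => x; case: w {h1 h2 h3 h4} => u v; rewrite /P /=.
  have h := den u x.
  rewrite -[(_ - _)^-1 - _]/(_ +i* _) -[RHS]/((_ - _) +i* (_ + _)).
  have -> : v - r - v = - r by ring.
  have -> : v + r - v = r by ring.
  by congr (_ +i* _); field; rewrite ?sqrrN gt_eqF.
have e2 : (fun y => ((sq w r).1.2 +i* y - w)^-1 - ((sq w r).1.1 +i* y - w)^-1 : C) =
    (fun y => P (complex.Im w) y).
  apply/funext => x; case: w {h1 h2 h3 h4 e1} => u v; rewrite /P /=.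
  have h := den v x.
  rewrite -[(_ - _)^-1 - _]/(_ +i* _) -[RHS]/(_ +i* _).
  have -> : u - r - u = - r by ring.
  have -> : u + r - u = r by ring.
  by rewrite sqrrN [r ^+ 2 + _]addrC; congr (_ +i* _); field; rewrite gt_eqF.
have cP1 : seg_continuous (complex.Re w - r) (complex.Re w + r) (P (complex.Re w)).
  have hi : (fun x => - 'i * ((x +i* (sq w r).2.1 - w)^-1 - (x +i* (sq w r).2.2 - w)^-1) : C) = P (complex.Re w).
    apply/funext => x; have /= -> := congr1 (fun f => f x) e1.
    by rewrite mulrA mulNr -expr2 sqr_i opprK mul1r.
  by rewrite -hi; apply: seg_continuousZ; exact: seg_continuousB h1 h2.
have cP2 : seg_continuous (complex.Im w - r) (complex.Im w + r) (P (complex.Im w)).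
  by rewrite -[P _]/(fun y => P _ y) -e2; exact: seg_continuousB h3 h4.
rewrite e1 e2 cintZ // -mulrDr normcM normci mul1r.
apply: le_trans (normc_Re _); apply: le_trans (ler_norm _).
have lo c x : c - r <= x <= c + r -> r^-1 <= complex.Re (P c x).
  move=> /andP[x1 x2] /=; have h := den c x.
  rewrite -(ler_pM2r h) divfK ?gt_eqF // -(ler_pM2l r0) mulrA mulfV ?gt_eqF // mul1r.
  have : 0 <= (r - (x - c)) * (r + (x - c)) by apply: mulr_ge0; lra.
  nra.
have le2 (c : R) : c - r <= c + r by lra.
have b1 := cint_Re_ge (le2 _) cP1 (lo (complex.Re w)).
have b2 := cint_Re_ge (le2 _) cP2 (lo (complex.Im w)).
have rr c : r^-1 * (c + r - (c - r)) = 2 by field; rewrite gt_eqF.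
move: b1 b2; rewrite !rr.
rewrite ReD /sq /= => c1 c2.
have -> : 4 = 2 + 2 :> R by rewrite -natrD.
exact: lerD.
Qed.

(** The difference quotient is integrated over a square of half-side [s] shrinking to [w]: it is at
    most a small constant over [s] there, while the perimeter is proportional to [s]. Asking only
    for continuity at [w] makes removable singularities available later. *)
Lemma cauchy_formula (f : C -> C) (w : C) (r : R) q : 0 < r ->
  q.1.1 <= (sq w r).1.1 /\ (sq w r).1.2 <= q.1.2 ->
  q.2.1 <= (sq w r).2.1 /\ (sq w r).2.2 <= q.2.2 ->
  (forall z, in_rect q z -> z != w -> differentiable f z) ->
  {for w, continuous f} ->
  rint (fun z => f z / (z - w)) q = f w * rint (fun z => (z - w)^-1) q.
Proof.
move=> r0 qx qy df cf.
pose G (z : C) := (f z - f w) / (z - w) : C.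
have wq : wf q.
  by case: qx qy => a b [c d]; move: a b c d; rewrite /sq /= => a b c d; split; lra.
have bdw z : on_bd q z -> z != w.
  move=> /andP[_ zb]; apply/eqP => zw; move: zb; rewrite zw.
  case: qx qy => a b [c d]; move: a b c d; rewrite /sq /= => a b c d.
  by case/or4P => /eqP h; move: a b c d; rewrite -h; lra.
have dG z : in_rect q z -> z != w -> differentiable G z.
  move=> zq zw; apply: dfC_M; last exact: df_kernel.
  by apply: dfC_B; [exact: df|exact: dfC_cst].
have dK z : on_bd q z -> differentiable (fun z : C => (z - w)^-1 : C) z.
  by move=> /bdw; exact: df_kernel.
suff G0 : rint G q = 0.
  rewrite (@rint_eq _ _ (fun z => G z + f w * (z - w)^-1) _ wq); last first.
    by move=> z _; rewrite /G; ring.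
  rewrite (@rintD _ G (fun z => f w * (z - w)^-1) _ wq).
  - rewrite G0 add0r; apply: (@rintZ _ (f w) (fun z => (z - w)^-1) _ wq).
    exact: bd_df.
  - by apply: bd_df => z zb; apply: dG; [case/andP: zb|exact: bdw].
  - by apply: bd_df => z zb; apply: dfC_M; [exact: dfC_cst|exact: dK].
apply: (@eq0_normc R); apply/eqP; rewrite eq_le normc_ge0 andbT.
apply/ler_addgt0Pr => e e0; rewrite add0r.
have e16 : 0 < e / 16 by rewrite divr_gt0.
have /continuous_rn/(_ _ e16)[d d0 dP] := cf.
pose s := Num.min r (d / 3).
have s0 : 0 < s by rewrite lt_min r0 divr_gt0.
have sr : s <= r by rewrite ge_min lexx.
have sd : s <= d / 3 by rewrite ge_min lexx orbT.
rewrite (@rint_deform G q (sq w s)); first last.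
- move=> z zq zo; apply: dG => //; apply: contra zo => /eqP ->; exact: in_open_sq.
- by case: qy; rewrite /sq /=; lra.
- by case: qx; rewrite /sq /=; lra.
- exact: wf_sq (ltW s0).
have inq z : in_rect (sq w s) z -> in_rect q z.
  move=> /andP[/andP[a b] /andP[c d']]; move: a b c d' qx qy; rewrite /sq /in_rect /= => *.
  by apply/andP; split; apply/andP; split; lra.
have -> : e = 4 * (e / 16 / s) * (((sq w s).1.2 - (sq w s).1.1) + ((sq w s).2.2 - (sq w s).2.1)).
  by rewrite /sq /=; field; rewrite gt_eqF.
apply: rint_bound; first exact: wf_sq (ltW s0).
  by apply: bd_df => z zb; apply: dG; [apply: inq; case/andP: zb|exact: on_bd_sq_neq s0 zb].
move=> z zb; rewrite /G normcM normcV.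
have z1 := on_bd_sq_ge (ltW s0) zb.
have z2 : normc (z - w) <= 2 * s by apply: in_sq_le; case/andP: zb.
apply: ler_pM; rewrite ?invr_ge0 ?normc_ge0 //.
  by apply: ltW; rewrite -rnC; apply: dP; rewrite rnC; lra.
by rewrite lef_pV2 // posrE //; apply: lt_le_trans z1.
Qed.

(** The Cauchy integral is at most [16 * M] and the winding integral at least 4. Applied to
    reciprocals, this bound takes the place of the argument principle. *)
Lemma center_bound (f : C -> C) (w : C) (r M : R) : 0 < r ->
  (forall z, in_rect (sq w r) z -> z != w -> differentiable f z) ->
  {for w, continuous f} ->
  (forall z, on_bd (sq w r) z -> normc (f z) <= M) -> normc (f w) <= 4 * M.
Proof.
move=> r0 df cf fM.
have e := cauchy_formula r0 (conj (lexx _) (lexx _)) (conj (lexx _) (lexx _)) df cf.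
have wq := wf_sq w (ltW r0).
have : normc (rint (fun z => f z / (z - w)) (sq w r)) <=
    4 * (M / r) * (((sq w r).1.2 - (sq w r).1.1) + ((sq w r).2.2 - (sq w r).2.1)).
  apply: rint_bound; first exact: wq.
    apply: bd_df => z zb; apply: dfC_M; last by apply: df_kernel; exact: on_bd_sq_neq zb.
    by apply: df; [case/andP: zb|exact: on_bd_sq_neq zb].
  move=> z zb; rewrite normcM normcV; have z1 := on_bd_sq_ge (ltW r0) zb.
  apply: ler_pM; rewrite ?invr_ge0 ?normc_ge0 //; first exact: fM.
  by rewrite lef_pV2 // posrE //; apply: lt_le_trans z1.
rewrite e normcM.
have -> : 4 * (M / r) * (((sq w r).1.2 - (sq w r).1.1) + ((sq w r).2.2 - (sq w r).2.1)) = 16 * M.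
  by rewrite /sq /=; field; rewrite gt_eqF.
have := winding_sq_ge w r0; have := normc_ge0 (f w).
set W := normc (rint _ _); nra.
Qed.

End Cauchy.

Section Taylor.
Variable R : realType.
Local Notation C := (R[i]^o).

(** The Taylor coefficients are divided by a winding integral that must not depend on [w]. The two
    kernels differ by [w] times a function of quadratic decay, whose integral is the same over
    arbitrarily large squares and hence vanishes. *)
Lemma winding_const (w : C) : normc w <= 2^-1 ->
  rint (fun z => (z - w)^-1) (sq 0 1) = rint (fun z => (z - 0)^-1) (sq 0 1).
Proof.
move=> w12.
have wq : wf (sq (0 : C) (1 : R)) by apply: wf_sq.
have far (L : R) z : 1 <= L -> in_rect (sq 0 L) z -> ~~ in_open (sq 0 1) z ->
    z != 0 /\ z != w.
  move=> _ _ no; split; apply: contra no => /eqP ->; rewrite /in_open /= !sub0r !add0r.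
    by rewrite !ltrN10 !ltr01.
  have := le_trans (normc_Re w) w12; have := le_trans (normc_Im w) w12.
  by rewrite !ler_norml => ? ?; apply/andP; split; apply/andP; split; lra.
pose G (z : C) := (z - 0)^-1 * (z - w)^-1 : C.
have dG z : z != 0 -> z != w -> differentiable G z.
  by move=> z0 zw; apply: dfC_M; apply: df_kernel.
have bd (z : C) : on_bd (sq 0 1) z -> z != 0 /\ z != w.
  move=> zb; have := on_bd_sq_ge (ltr01 R) zb => h || have h := on_bd_sq_ge (@ler01 R) zb.
  split; apply/eqP => e; move: h; rewrite e ?subr0 ?normc0; first by rewrite leNgt ltr01.
  by move=> h; have := le_trans h w12; lra.
suff G0 : rint G (sq 0 1) = 0.
  rewrite (@rint_eq _ _ (fun z => (z - 0)^-1 + w * G z) _ wq).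
    rewrite (@rintD _ (fun z => (z - 0)^-1) (fun z => w * G z) _ wq).
    - rewrite (@rintZ _ w G _ wq); first by rewrite G0 mulr0 addr0.
      by apply: bd_df => z /bd[z0 zw]; apply: dG.
    - by apply: bd_df => z /bd[z0 zw]; apply: df_kernel.
    - by apply: bd_df => z /bd[z0 zw]; apply: dfC_M; [exact: dfC_cst|exact: dG].
  move=> z /bd[z0 zw]; rewrite /G subr0; field.
  by rewrite z0 subr_eq0 zw.
apply: (@eq0_normc R); apply/eqP; rewrite eq_le normc_ge0 andbT.
apply/ler_addgt0Pr => e e0; rewrite add0r.
(* On the square of half-side [L] the boundary estimate is [32 / L]. *)
pose L := 1 + 32 / e.
have L1 : 1 <= L by rewrite /L lerDl divr_ge0 // ltW.
have L0 : 0 < L by apply: lt_le_trans L1.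
have Le : 32 / L <= e.
  rewrite ler_pdivrMr // /L mulrDr mulr1 mulrC -mulrA mulVf ?gt_eqF // mulr1.
  by rewrite lerDr ltW.
rewrite -(@rint_deform _ G (sq 0 L) (sq 0 1) wq); last 3 first.
- by rewrite /sq /=; lra.
- by rewrite /sq /=; lra.
- by move=> z zL no; have [z0 zw] := far L z L1 zL no; apply: dG.
have wL : wf (sq (0 : C) L) by apply: wf_sq; exact: ltW.
have bdL (z : C) : on_bd (sq 0 L) z -> [/\ z != 0, z != w, L <= normc z & L / 2 <= normc (z - w)].
  move=> zb; have h := on_bd_sq_ge (ltW L0) zb; rewrite subr0 in h.
  have h2 : L / 2 <= normc (z - w).
    have := normcD (z - w) w; rewrite subrK; lra.
  split => //.
    by apply/eqP => e1; move: h; rewrite e1 normc0 leNgt L0.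
  by apply/eqP => e1; move: h2; rewrite e1 subrr normc0 leNgt divr_gt0.
apply: le_trans Le.
have -> : 32 / L = 4 * (L^-1 * (L / 2)^-1) *
    (((sq (0:C) L).1.2 - (sq (0:C) L).1.1) + ((sq (0:C) L).2.2 - (sq (0:C) L).2.1)).
  by rewrite /sq /=; field; rewrite gt_eqF.
apply: rint_bound; first exact: wL.
  by apply: bd_df => z /bdL[z0 zw _ _]; apply: dG.
move=> z /bdL[z0 zw h1 h2]; rewrite /G subr0 normcM !normcV.
apply: ler_pM; rewrite ?invr_ge0 ?normc_ge0 // lef_pV2 // posrE.
- by apply: lt_le_trans h1.
- by apply: lt_le_trans h2; rewrite divr_gt0.
- by rewrite divr_gt0.
Qed.

(** Iterating 1/(z - w) = 1/z + w/(z (z - w)) in the Cauchy formula keeps the remainder as an exact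
    integral, so no series has to converge. Dividing by [c], of modulus at least 4, turns the bounds
    [16 * M] and [32 * M] into [4 * M] and [8 * M]. *)
Lemma taylor_sq (f : C -> C) (M : R) :
  (forall z, in_rect (sq 0 1) z -> differentiable f z) ->
  (forall z, on_bd (sq 0 1) z -> normc (f z) <= M) ->
  exists a : nat -> C, (forall j, normc (a j) <= 4 * M) /\
    forall (w : C) k, normc w <= 2^-1 ->
      normc (f w - \sum_(j < k) a j * w ^+ j) <= 8 * M * normc w ^+ k.
Proof.
move=> df fM.
have wq : wf (sq (0 : C) (1 : R)) by apply: wf_sq.
pose c := rint (fun z : C => (z - 0)^-1) (sq 0 1).
have c4 : 4 <= normc c by apply: winding_sq_ge.
have c0 : c != 0 by rewrite -normc_gt0; apply: lt_le_trans c4.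
pose b j := rint (fun z => f z * (z^-1) ^+ j.+1) (sq 0 1).
pose T (w : C) k := rint (fun z => f z * (z^-1) ^+ k * (z - w)^-1) (sq 0 1).
have bd (z : C) : on_bd (sq 0 1) z -> [/\ differentiable f z, z != 0 & 1 <= normc z].
  move=> zb; have h := on_bd_sq_ge (@ler01 R) zb; rewrite subr0 in h.
  split => //; first by apply: df; case/andP: zb.
  by rewrite -normc_gt0; apply: lt_le_trans h.
have bdw (w z : C) : normc w <= 2^-1 -> on_bd (sq 0 1) z -> z != w /\ 2^-1 <= normc (z - w).
  move=> w12 /bd[_ _ h]; have h2 : 2^-1 <= normc (z - w).
    have := normcD (z - w) w; rewrite subrK; lra.
  split => //; apply/eqP => e1; move: h2; rewrite e1 subrr normc0 leNgt.
  by rewrite invr_gt0 ltr0n.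
have dP j (z : C) : z != 0 -> differentiable (fun z : C => (z^-1) ^+ j : C) z.
  by move=> z0; apply: dfC_X; apply: dfC_V => //; exact: df_id.
have dT (w : C) k (z : C) : normc w <= 2^-1 -> on_bd (sq 0 1) z ->
    differentiable (fun z => f z * (z^-1) ^+ k * (z - w)^-1 : C) z.
  move=> w12 zb; have [dfz z0 _] := bd z zb; have [zw _] := bdw w z w12 zb.
  by apply: dfC_M; [apply: dfC_M; [|exact: dP]|exact: df_kernel].
have db j (z : C) : on_bd (sq 0 1) z -> differentiable (fun z => f z * (z^-1) ^+ j.+1 : C) z.
  by move=> zb; have [dfz z0 _] := bd z zb; apply: dfC_M => //; exact: dP.
have T0 (w : C) : normc w <= 2^-1 -> T w 0%N = f w * c.
  move=> w12; rewrite /c -(winding_const w12).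
  rewrite -(@cauchy_formula _ f w 2^-1).
  - by apply: (rint_eq wq) => z _; rewrite expr0 mulr1.
  - by rewrite invr_gt0 ltr0n.
  - have := le_trans (normc_Re w) w12; rewrite /sq /= ler_norml => /andP[? ?].
    by split; lra.
  - have := le_trans (normc_Im w) w12; rewrite /sq /= ler_norml => /andP[? ?].
    by split; lra.
  - by move=> z zq _; apply: df.
  - apply: df_continuous; apply: df.
    by apply: in_sq; rewrite subr0; lra.
have TS (w : C) k : normc w <= 2^-1 -> T w k = b k + w * T w k.+1.
  move=> w12.
  rewrite /T (@rint_eq _ _ (fun z => f z * (z^-1) ^+ k.+1
     + w * (f z * (z^-1) ^+ k.+1 * (z - w)^-1)) _ wq); last first.
    move=> z zb; have [_ z0 _] := bd z zb; have [zw _] := bdw w z w12 zb.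
    rewrite exprS; have zw' : z - w != 0 by rewrite subr_eq0.
    set p := _ ^+ k; by field; rewrite z0 zw'.
  rewrite (@rintD _ (fun z => f z * (z^-1) ^+ k.+1)
    (fun z => w * (f z * (z^-1) ^+ k.+1 * (z - w)^-1)) _ wq); last 2 first.
  - by apply: bd_df => z zb; apply: db.
  - by apply: bd_df => z zb; apply: dfC_M; [exact: dfC_cst|exact: dT].
  congr (_ + _).
  apply: (@rintZ _ w (fun z => f z * (z^-1) ^+ k.+1 * (z - w)^-1) _ wq).
  by apply: bd_df => z zb; exact: dT.
have Tk (w : C) k : normc w <= 2^-1 -> f w * c = \sum_(j < k) b j * w ^+ j + w ^+ k * T w k.
  move=> w12; elim: k => [|k IH]; first by rewrite big_ord0 add0r mul1r T0.
  by rewrite IH (TS w k w12) big_ord_recr /= exprS; ring.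
have side : ((sq (0:C) 1).1.2 - (sq (0:C) 1).1.1) + ((sq (0:C) 1).2.2 - (sq (0:C) 1).2.1) = 4 :> R.
  by rewrite /sq /=; ring.
have M0 : 0 <= M.
  have hb : on_bd (sq (0 : C) (1 : R)) (1 : C).
    by rewrite /on_bd /in_rect /sq /= !sub0r !add0r !lexx eqxx ler01 lerN10 !andbT orbT ge0_cp.
  exact: le_trans (normc_ge0 _) (fM _ hb).
have pw (z : C) j : on_bd (sq 0 1) z -> normc ((z^-1) ^+ j) <= 1.
  move=> /bd[_ z0 z1]; rewrite normcX normcV exprn_ile1 // ?invr_ge0 ?normc_ge0 //.
  by rewrite invf_le1 // normc_gt0.
have bb j : normc (b j) <= 16 * M.
  rewrite (_ : 16 * M = 4 * M * 4); last by ring.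
  rewrite -{2}side; apply: rint_bound; first exact: wq.
    by apply: bd_df => z zb; apply: db.
  move=> z zb; rewrite normcM -[M]mulr1; apply: ler_pM; rewrite ?normc_ge0 //; first exact: fM.
  exact: pw.
have Tb (w : C) k : normc w <= 2^-1 -> normc (T w k) <= 32 * M.
  move=> w12; rewrite (_ : 32 * M = 4 * (M * 2) * 4); last by ring.
  rewrite -{2}side; apply: rint_bound; first exact: wq.
    by apply: bd_df => z zb; apply: dT.
  move=> z zb; rewrite normcM; apply: ler_pM; rewrite ?normc_ge0 //.
    rewrite normcM -[M]mulr1; apply: ler_pM; rewrite ?normc_ge0 //; first exact: fM.
    exact: pw.
  have [zw h] := bdw w z w12 zb.
  by rewrite normcV invf_ple ?posrE // normc_gt0 subr_eq0.
exists (fun j => b j / c); split.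
  move=> j; rewrite normcM normcV ler_pdivrMr; last by apply: lt_le_trans c4.
  apply: le_trans (bb j) _; rewrite (_ : 16 * M = 4 * M * 4); last by ring.
  by rewrite ler_wpM2l // mulr_ge0.
move=> w k w12.
have -> : f w - \sum_(j < k) b j / c * w ^+ j = w ^+ k * T w k / c.
  have -> : f w = f w * c / c by rewrite mulfK.
  rewrite (Tk w k w12) mulrDl -addrA addrC -addrA [X in _ + X](_ : _ = 0) ?addr0 //.
  by rewrite mulr_suml addrC -sumrB big1 // => j _; ring.
rewrite !normcM normcV normcX ler_pdivrMr; last by apply: lt_le_trans c4.
rewrite mulrC.
have h1 := Tb w k w12; have h2 : 0 <= normc w ^+ k by rewrite exprn_ge0 // normc_ge0.
apply: le_trans (ler_wpM2r h2 h1) _.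
rewrite (_ : 32 * M * _ = 8 * M * normc w ^+ k * 4); last by ring.
by rewrite ler_wpM2l // !mulr_ge0.
Qed.

(** The unit square lies in the disc of radius 2, so scaling by [r / 4] keeps it inside the disc of
    radius [r]; the condition [normc w <= 2^-1] becomes [normc h <= r / 8]. *)
Lemma taylor_disc (f : C -> C) (c : C) (r M : R) : 0 < r ->
  (forall z, normc (z - c) < r -> differentiable f z /\ normc (f z) <= M) ->
  exists a : nat -> C, (forall j, normc (a j) <= 4 * M * (4 / r) ^+ j) /\
    forall (h : C) k, normc h <= r / 8 ->
      normc (f (c + h) - \sum_(j < k) a j * h ^+ j) <= 8 * M * (4 / r * normc h) ^+ k.
Proof.
move=> r0 fP.
have r4 : (r / 4)%:C != 0 :> C by rewrite -normc_gt0 normc_real normr_gt0 mulf_neq0 ?gt_eqF.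
pose g (t : C) := f (c + t * (r / 4)%:C) : C.
have n4 (t : C) : normc (t * (r / 4)%:C) = normc t * (r / 4).
  by rewrite normcM normc_real ger0_norm // divr_ge0 // ltW.
have inb t : in_rect (sq 0 1) t -> normc (c + t * (r / 4)%:C - c) < r.
  move=> /in_sq_le; rewrite subr0 mulr1 addrAC subrr add0r n4; nra.
have dg z : in_rect (sq 0 1) z -> differentiable g z.
  move=> zq; have [dfz _] := fP _ (inb z zq).
  apply: (@df_comp _ _ _ _ (fun t : C => c + t * (r / 4)%:C) f _ _ dfz).
  exact: df_line.
have gM z : on_bd (sq 0 1) z -> normc (g z) <= M.
  by case/andP => zq _; have [] := fP _ (inb z zq).
have [a [aM aP]] := taylor_sq dg gM.
have iv : normc (((r / 4)%:C)^-1 : C) = 4 / r.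
  by rewrite normcV normc_real ger0_norm ?invf_div // divr_ge0 // ltW.
exists (fun j => a j / (r / 4)%:C ^+ j); split.
  by move=> j; rewrite normcM -exprVn normcX iv ler_wpM2r // exprn_ge0 // divr_ge0 // ltW.
move=> h k hr.
have hh : normc (h / (r / 4)%:C) = 4 / r * normc h by rewrite normcM iv mulrC.
have := aP (h / (r / 4)%:C) k; rewrite hh /g divfK // => H.
have -> : \sum_(j < k) a j / (r / 4)%:C ^+ j * h ^+ j = \sum_(j < k) a j * (h / (r / 4)%:C) ^+ j.
  by apply: eq_bigr => j _; rewrite expr_div_n; ring.
apply: H; rewrite mulrAC ler_pdivrMr //; move: hr; lra.
Qed.

End Taylor.

(** * Several complex variables *)

Section SeveralVariables.
Variable R : realType.
Local Notation C := (R[i]^o).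

(** The radius and the bound are carried along because the Cauchy estimates that follow depend on
    [f] only through them. *)
Definition bounded_holo (V : normedModType R[i]) (f : V -> C) (z : V) (r M : R) :=
  0 < r /\ forall y, rn (y - z) < r -> differentiable f y /\ normc (f y) <= M.

Section Lines.
Variable V : normedModType R[i].
Implicit Types (f g : V -> C) (z h : V).

Lemma bounded_holo_ex f z r : 0 < r ->
  (forall y, rn (y - z) < r -> differentiable f y) ->
  exists r' M, r' <= r /\ bounded_holo f z r' M.
Proof.
move=> r0 df.
have : {for z, continuous f} by apply/df_continuous/df; rewrite subrr rn0.
move=> /continuous_rn/(_ 1 ltr01)[d d0 dP].
exists (Num.min r d), (normc (f z) + 1); split; first by rewrite ge_min lexx.
split; first by rewrite lt_min r0.
move=> y; rewrite lt_min => /andP[yr yd]; split; first exact: df.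
have := dP y yd; rewrite rnC => h.
have := normcD (f y - f z) (f z); rewrite subrK; lra.
Qed.

Lemma bounded_holo_ge0 f z r M : bounded_holo f z r M -> 0 <= M.
Proof.
move=> [r0 fP]; have [_ h] : differentiable f z /\ normc (f z) <= M.
  by apply: fP; rewrite subrr rn0.
exact: le_trans (normc_ge0 _) h.
Qed.

Lemma bounded_holo_sub f z r M y r' : bounded_holo f z r M -> 0 < r' ->
  rn (y - z) + r' <= r -> bounded_holo f y r' M.
Proof.
move=> [r0 fP] r'0 yr; split => // x xy; apply: fP.
by apply: le_lt_trans (rn_dist y _ _) _; lra.
Qed.

(** This is the one-variable expansion on the complex line through [z] in direction [h]. The first
    coefficient is identified with the differential by comparing the second-order remainder with
    differentiability at one small real parameter. *)
Lemma line_taylor f z r M h : bounded_holo f z r M ->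
  exists a : nat -> C, [/\ forall j, normc (a j) <= 4 * M * (4 * rn h / r) ^+ j,
    a 0%N = f z, a 1%N = 'd f z h &
    forall (t : C) k, normc t * rn h <= r / 8 ->
      normc (f (z + t *: h) - \sum_(j < k) a j * t ^+ j)
        <= 8 * M * (4 * (normc t * rn h) / r) ^+ k].
Proof.
move=> B; have M0 := bounded_holo_ge0 B; case: B => r0 fP.
have [dfz fzM] : differentiable f z /\ normc (f z) <= M by apply: fP; rewrite subrr rn0.
have [h0|h0] := eqVneq h 0.
  exists (fun j => if j is 0%N then f z else 0); rewrite h0 linear0; split => //.
    case=> [|j]; first by rewrite expr0 mulr1; lra.
    by rewrite normc0 !mulr_ge0 // exprn_ge0 // divr_ge0 ?mulr_ge0 ?rn_ge0 // ltW.
  move=> t [|k] _; first by rewrite big_ord0 subr0 scaler0 addr0 expr0 mulr1; lra.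
  rewrite scaler0 addr0 big_ord_recl big1 => [|j _]; last by rewrite /= mul0r.
  by rewrite expr0 mulr1 addr0 subrr normc0 rn0 !mulr0 mul0r exprS mul0r mulr0.
have h1 := rn_gt0 h0.
pose g (t : C) := f (z + t *: h) : C.
have gP t : normc (t - 0) < r / rn h -> differentiable g t /\ normc (g t) <= M.
  rewrite subr0 ltr_pdivlMr // => tr.
  have [dft fM] : differentiable f (z + t *: h) /\ normc (f (z + t *: h)) <= M.
    by apply: fP; rewrite addrAC subrr add0r rnZ.
  split => //; apply: (@df_comp _ _ _ _ (fun t : C => z + t *: h) f) => //; exact: df_line.
have [a [aM aP]] := taylor_disc (divr_gt0 r0 h1) gP.
have hne : rn h != 0 by rewrite gt_eqF.
have rne : r != 0 by rewrite gt_eqF.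
have aP' (t : C) k : normc t * rn h <= r / 8 -> normc (f (z + t *: h) - \sum_(j < k) a j * t ^+ j)
        <= 8 * M * (4 * (normc t * rn h) / r) ^+ k.
  move=> tr; have := aP t k; rewrite add0r /g => H.
  have -> : 4 * (normc t * rn h) / r = 4 / (r / rn h) * normc t by field; rewrite rne hne.
  by apply: H; rewrite mulrAC ler_pdivlMr.
have a0 : a 0%N = f z.
  have := aP' 0 1%N; rewrite normc0 mul0r scale0r addr0 big_ord1 expr0 mulr1 mulr0 mul0r expr1 mulr0.
  move=> /(_ (divr_ge0 (ltW r0) (ler0n _ _))) H.
  apply/esym/eqP; rewrite -subr_eq0; apply/eqP; apply: (@eq0_normc R); apply/eqP.
  by rewrite eq_le H normc_ge0.
exists a; split => //.
  by move=> j; have := aM j; have -> : 4 / (r / rn h) = 4 * rn h / r by field; rewrite rne hne.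
apply/eqP; rewrite -subr_eq0; apply/eqP; apply: (@eq0_normc R); apply/eqP.
rewrite eq_le normc_ge0 andbT; apply/ler_addgt0Pr => e e0; rewrite add0r.
pose B := 8 * M * (4 * rn h / r) ^+ 2.
have B0 : 0 <= B by apply: mulr_ge0; [exact: mulr_ge0|exact: sqr_ge0].
have e2 : 0 < e / (2 * rn h) by rewrite divr_gt0 // mulr_gt0.
have [d d0 dP] := differentiable_rn dfz e2.
(* Three constraints: the radius of differentiability, a remainder below [e / 2] after division by
   [s], and the range of the Taylor bound. *)
pose s := Num.min (d / (2 * rn h)) (Num.min (e / (2 * (B + 1))) (r / (8 * rn h))).
have B1 : 0 < B + 1 by rewrite ltr_wpDl.
have s0 : 0 < s by rewrite !lt_min !divr_gt0 // mulr_gt0.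
have sd : s * rn h < d.
  have : s <= d / (2 * rn h) by rewrite ge_min lexx.
  rewrite ler_pdivlMr ?mulr_gt0 // => k1; nra.
have sB : s * B <= e / 2.
  have : s <= e / (2 * (B + 1)) by rewrite !ge_min lexx orbT.
  rewrite ler_pdivlMr ?mulr_gt0 // => k1; nra.
have sr : s * rn h <= r / 8.
  have : s <= r / (8 * rn h) by rewrite !ge_min lexx !orbT.
  by rewrite ler_pdivlMr ?mulr_gt0 // => k1; lra.
have ns : normc (s%:C : C) = s by rewrite normc_real gtr0_norm.
have rs : rn ((s%:C : C) *: h) = s * rn h by rewrite rnZ ns.
have k1 := dP ((s%:C : C) *: h); rewrite rs in k1; have {}k1 := k1 sd.
have k2 := aP' (s%:C) 2%N; rewrite ns in k2; have {}k2 := k2 sr.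
move: k1 k2; rewrite rnC linearZ /= !big_ord_recl big_ord0 /= expr0 mulr1 a0 addr0 expr1.
rewrite /bump /= => k1 k2.
have k3 : normc ((a 1%N - 'd f z h) * s%:C) <= e / 2 * s + B * s ^+ 2.
  have -> : (a 1%N - 'd f z h) * s%:C = (f (z + (s%:C : C) *: h) - f z - s%:C * 'd f z h)
     - (f (z + (s%:C : C) *: h) - (f z + a 1%N * s%:C)) by ring.
  apply: le_trans (normcB _ _) _; apply: lerD.
    by apply: le_trans k1 _; rewrite le_eqVlt; apply/orP; left; apply/eqP; field; rewrite hne.
  by apply: le_trans k2 _; rewrite le_eqVlt; apply/orP; left; apply/eqP; rewrite /B; field; rewrite rne.
move: k3; rewrite normcM ns.
have -> : e / 2 * s + B * s ^+ 2 = (e / 2 + s * B) * s by ring.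
rewrite ler_pM2r // => k3; apply: le_trans k3 _.
move: sB; clear; lra.
Qed.

Lemma cauchy1 f z r M h : bounded_holo f z r M ->
  normc ('d f z h) <= 16 * M * (rn h / r).
Proof.
move=> B; have [a [aM _ <- _]] := line_taylor h B.
by apply: le_trans (aM 1%N) _; rewrite expr1 le_eqVlt; apply/orP; left; apply/eqP; ring.
Qed.

Lemma cauchy2 f z r M h : bounded_holo f z r M -> rn h <= r / 8 ->
  normc (f (z + h) - f z - 'd f z h) <= 128 * M * (rn h / r) ^+ 2.
Proof.
move=> B hr; have [a [aM a0 a1 aP]] := line_taylor h B.
have := aP 1 2%N; rewrite normc1 mul1r scale1r !big_ord_recl big_ord0 /= expr0 !mulr1.
rewrite /bump /= a0 a1 addr0 opprD addrA => /(_ hr) H.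
by apply: le_trans H _; rewrite le_eqVlt; apply/orP; left; apply/eqP; ring.
Qed.

Lemma holo_lipschitz f z r M y : bounded_holo f z r M -> rn (y - z) <= r / 8 ->
  normc (f y - f z) <= 32 * M * (rn (y - z) / r).
Proof.
move=> B hr; have M0 := bounded_holo_ge0 B; have := cauchy2 B hr; rewrite [z + _]addrC subrK.
have := cauchy1 (y - z) B; case: B => r0 _.
have := normcD (f y - f z - 'd f z (y - z)) ('d f z (y - z)); rewrite subrK.
have : rn (y - z) / r <= 8^-1 by rewrite ler_pdivrMr //; lra.
have : 0 <= rn (y - z) / r by rewrite divr_ge0 ?rn_ge0 // ltW.
set s := rn _ / r => s0 s8 t1 t2 t3.
have : M * s * s <= M * s * 8^-1 by rewrite ler_wpM2l // mulr_ge0.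
move: t1 t2 t3; have -> : 128 * M * s ^+ 2 = 128 * (M * s * s) by ring.
have -> : 16 * M * s = 16 * (M * s) by ring.
have -> : 32 * M * s = 32 * (M * s) by ring.
lra.
Qed.

End Lines.

Section RowVectors.
Variable n : nat.
Local Notation V := 'rV[R[i]]_n.

Lemma rn_coord (v : V) j : normc (v 0 j) <= rn v.
Proof.
apply/ler_addgt0Pr => e e0; apply: ltW.
have : ball (0 : V) ((rn v + e)%:C) v.
  rewrite mx_norm_ball /ball_ /= sub0r normrN rnE ltcR; lra.
move=> [_ /(_ 0 j)]; rewrite mxE => h.
have : `|0 - (v 0 j : C)| < (rn v + e)%:C by exact: h.
by rewrite sub0r normrN normcE_C ltcR.
Qed.

Lemma rn_rV_lt (v : V) M : 0 < M -> (forall j, normc (v 0 j) < M) -> rn v < M.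
Proof.
move=> M0 vM.
have : ball (0 : V) (M%:C) v.
  split; first by rewrite ltcR.
  move=> i j; rewrite ord1 mxE.
  have : `|0 - (v 0 j : C)| < M%:C by rewrite sub0r normrN normcE_C ltcR; exact: vM.
  exact.
by rewrite mx_norm_ball /ball_ /= sub0r normrN rnE ltcR.
Qed.

Lemma rn_rV_le (v : V) M : 0 <= M -> (forall j, normc (v 0 j) <= M) -> rn v <= M.
Proof.
move=> M0 vM; apply/ler_addgt0Pr => e e0; apply: ltW; apply: rn_rV_lt.
  by rewrite ltr_wpDl.
by move=> j; apply: le_lt_trans (vM j) _; rewrite ltrDl.
Qed.

Definition lform (l : 'I_n -> C) (h : V) : C := \sum_j h 0 j * l j.

Lemma lform_linear l : linear (lform l).
Proof.
move=> a x y; rewrite /lform scaler_sumr -big_split /=; apply: eq_bigr => j _.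
by rewrite !mxE mulrDl -mulrA.
Qed.

HB.instance Definition _ l := GRing.isLinear.Build R[i] V C _ (lform l) (lform_linear l).

Lemma lform_bound l (K : R) h : (forall j, normc (l j) <= K) ->
  normc (lform l h) <= n%:R * K * rn h.
Proof.
move=> lK; rewrite /lform -mulrA.
have sumle (I : Type) (s : seq I) (F : I -> C) : normc (\sum_(i <- s) F i) <= \sum_(i <- s) normc (F i).
  elim/big_ind2 : _ => //; first by rewrite normc0.
  by move=> x1 x2 y1 y2 h1 h2; apply: le_trans (normcD _ _) (lerD h1 h2).
apply: le_trans (sumle _ _ _) _.
rewrite -[n in n%:R]card_ord mulr_natl -sumr_const; apply: ler_sum => j _.
by rewrite normcM mulrC; apply: ler_pM; rewrite ?normc_ge0 // rn_coord.
Qed.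

Lemma lform_continuous l : continuous (lform l).
Proof.
have [K K0 lK] : exists2 K : R, 0 <= K & forall j, normc (l j) <= K.
  exists (\sum_j normc (l j)); first by apply: sumr_ge0 => j _; exact: normc_ge0.
  by move=> j; rewrite (bigD1 j) //= lerDl; apply: sumr_ge0 => i _; exact: normc_ge0.
move=> x; apply/continuous_rn => e e0.
have n1 : 0 < n%:R * K + 1 by rewrite ltr_wpDl // mulr_ge0.
exists (e / (n%:R * K + 1)); first by rewrite divr_gt0.
move=> y; rewrite ltr_pdivlMr // => yx; rewrite rnC -linearB.
apply: le_lt_trans (lform_bound (y - x) lK) _; have := rn_ge0 (y - x); nra.
Qed.

Lemma rV_linear (L : {linear V -> C}) h : L h = lform (fun j => L (delta_mx 0 j)) h.
Proof.
rewrite {1}[h]row_sum_delta linear_sum; apply: eq_bigr => j _.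
by rewrite linearZ.
Qed.

Lemma rn_delta (j : 'I_n) : rn (delta_mx 0 j : V) <= 1.
Proof.
apply: rn_rV_le => // i; rewrite mxE /=.
by case: (i == j); rewrite ?normc1 ?normc0.
Qed.

(** [cauchy1] on consecutive differences makes the differentials at [z] converge geometrically. The
    quadratic estimate [cauchy2] holds for all [F k] with the same radius and bound, so it survives
    in the limit and gives differentiability of [f]. *)
Lemma weierstrass (f : V -> C) (F : nat -> V -> C) z (r K M : R) : 0 < r ->
  (forall k y, rn (y - z) < r -> differentiable (F k) y) ->
  (forall k y, rn (y - z) < r -> normc (F k y - f y) <= K / 2 ^+ k) ->
  (forall y, rn (y - z) < r -> normc (f y) <= M) ->
  differentiable f z.
Proof.
move=> r0 dF Ff fM.
have zz : rn (z - z) < r by rewrite subrr rn0.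
have M0 : 0 <= M := le_trans (normc_ge0 _) (fM z zz).
have p2 k : 0 < (2 ^+ k : R) by rewrite exprn_gt0.
have K0 : 0 <= K.
  by have := Ff 0%N z zz; rewrite expr0 divr1; apply: le_trans; exact: normc_ge0.
have K2 k : K / 2 ^+ k <= K.
  by rewrite ler_pdivrMr // ler_peMr // exprn_ege1 // ler1n.
have BF k : bounded_holo (F k) z r (M + K).
  split; first exact: r0.
  move=> y yz; split; first exact: dF.
  have := normcD (F k y - f y) (f y); rewrite subrK.
  have := Ff k y yz; have := fM y yz; have := K2 k; lra.
have BG k : bounded_holo (fun y => F k.+1 y - F k y) z r (2 * K / 2 ^+ k).
  split; first exact: r0.
  move=> y yz; split; first by apply: dfC_B; apply: dF.
  have -> : F k.+1 y - F k y = (F k.+1 y - f y) - (F k y - f y) by ring.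
  apply: le_trans (normcB _ _) _.
  have -> : 2 * K / 2 ^+ k = K / 2 ^+ k + K / 2 ^+ k by ring.
  apply: lerD; last exact: Ff.
  apply: le_trans (Ff k.+1 y yz) _; rewrite ler_wpM2l // lef_pV2 ?posrE //.
  by rewrite ler_weXn2l // ler1n.
have dlim j : exists l : C, forall k,
    normc ('d (F k) z (delta_mx 0 j) - l) <= 2 * (32 * K / r) / 2 ^+ k.
  apply: geometric_limit => k.
  have -> : 'd (F k.+1) z (delta_mx 0 j) - 'd (F k) z (delta_mx 0 j)
     = 'd (fun y => F k.+1 y - F k y) z (delta_mx 0 j).
    exact: (esym (dC_B (delta_mx 0 j) (dF k.+1 z zz) (dF k z zz))).
  apply: le_trans (cauchy1 _ (BG k)) _.
  have : rn (delta_mx 0 j : V) / r <= r^-1.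
    by rewrite -[leRHS]mul1r ler_wpM2r ?invr_ge0 ?rn_delta // ltW.
  have : 0 <= K / 2 ^+ k by rewrite divr_ge0 // ltW.
  have -> : 2 * K / 2 ^+ k = 2 * (K / 2 ^+ k) by rewrite mulrA.
  have -> : 32 * K / r / 2 ^+ k = 32 * (K / 2 ^+ k) * r^-1 by ring.
  set A := K / _; set B := _ / r; move=> A0 Br.
  have : A * B <= A * r^-1 by rewrite ler_wpM2l.
  lra.
have /choice [l lP] := dlim.
have [] // := @rn_differentiable _ _ _ f z (lform l) (@lform_continuous l).
have Lk k h : normc ('d (F k) z h - lform l h) <= n%:R * (64 * K / r) * rn h / 2 ^+ k.
  rewrite rV_linear.
  have -> : lform (fun j => 'd (F k) z (delta_mx 0 j)) h - lform l h
     = lform (fun j => 'd (F k) z (delta_mx 0 j) - l j) h.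
    by rewrite /lform -sumrB; apply: eq_bigr => j _; rewrite mulrBr.
  apply: le_trans (@lform_bound _ (2 * (32 * K / r) / 2 ^+ k) h _) _; first by move=> j; exact: lP.
  by rewrite le_eqVlt; apply/orP; left; apply/eqP; ring.
have main h : rn h <= r / 8 ->
    normc (f (z + h) - f z - lform l h) <= 128 * (M + K) * (rn h / r) ^+ 2.
  move=> hr; apply/ler_addgt0Pr => e e0.
  have hz : rn (z + h - z) < r by rewrite addrAC subrr add0r; lra.
  pose D := 2 * K + n%:R * (64 * K / r) * rn h.
  have D0 : 0 <= D by rewrite /D addr_ge0 ?mulr_ge0 ?rn_ge0 ?invr_ge0 // ltW.
  have [k /(_ k (leqnn _)) kD] := exp2_small D0 e0.
  have -> : f (z + h) - f z - lform l h =
     (F k (z + h) - F k z - 'd (F k) z h) +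
     (('d (F k) z h - lform l h) - (F k (z + h) - f (z + h)) + (F k z - f z)) by ring.
  apply: le_trans (normcD _ _) _; apply: lerD; first exact: cauchy2 (BF k) hr.
  apply: le_trans (normcD _ _) _; apply: le_trans (lerD (normcB _ _) (lexx _)) _.
  apply: le_trans _ (ltW kD).
  have -> : D / 2 ^+ k = n%:R * (64 * K / r) * rn h / 2 ^+ k + K / 2 ^+ k + K / 2 ^+ k.
    by rewrite /D; ring.
  by apply: lerD; [apply: lerD|]; [exact: Lk|exact: Ff|exact: Ff].
move=> e e0.
pose B := 128 * (M + K) / r ^+ 2.
have B0 : 0 <= B by rewrite /B divr_ge0 ?sqr_ge0 // mulr_ge0 // addr_ge0.
have B1 : 0 < B + 1 by rewrite ltr_wpDl.
exists (Num.min (r / 8) (e / (B + 1))); first by rewrite lt_min !divr_gt0.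
move=> h; rewrite lt_min => /andP[h1]; rewrite ltr_pdivlMr // => h2.
rewrite !rnC; apply: le_trans (main h (ltW h1)) _.
have -> : 128 * (M + K) * (rn h / r) ^+ 2 = B * rn h * rn h by rewrite /B; field; rewrite gt_eqF.
have := rn_ge0 h; nra.
Qed.

End RowVectors.
End SeveralVariables.

(** * Holomorphy of directional derivatives and strict differentiability *)

Section Derivatives.
Variables (R : realType) (n : nat).
Local Notation C := (R[i]^o).
Local Notation V := 'rV[R[i]]_n.

(** By [cauchy2] the difference quotients with steps [s / 2 ^+ k] converge at a geometric rate,
    uniformly near each point, so the Weierstrass theorem applies. Iteration gives derivatives of
    all orders. *)
Lemma bounded_holo_deriv (f : V -> C) z r M v : bounded_holo f z r M ->
  bounded_holo (fun y => 'd f y v) z (r / 2) (32 * M * (rn v / r)).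
Proof.
move=> B; have M0 := bounded_holo_ge0 B; have r0 : 0 < r by case: B.
have rne : r != 0 by rewrite gt_eqF.
split; first by rewrite divr_gt0.
move=> y yz.
have bd x : rn (x - z) < r / 2 -> bounded_holo f x (r / 2) M.
  by move=> xz; apply: bounded_holo_sub B _ _; lra.
have bnd x : rn (x - z) < r / 2 -> normc ('d f x v) <= 32 * M * (rn v / r).
  move=> /bd/cauchy1 h; apply: le_trans (h v) _.
  by rewrite le_eqVlt; apply/orP; left; apply/eqP; field.
split; last exact: bnd.
have v0 := rn_ge0 v.
(* The [+ 1] allows [v = 0]; the choice keeps all translations [t k *: v] within [r / 32]. *)
pose s := r / (32 * (rn v + 1)).
have v1 : 0 < rn v + 1 by rewrite ltr_wpDl.
have s0 : 0 < s by rewrite divr_gt0 // mulr_gt0.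
have sv : s * rn v <= r / 32.
  have : s * (32 * (rn v + 1)) = r by rewrite /s divfK // gt_eqF // mulr_gt0.
  nra.
pose t k : C := (s / 2 ^+ k)%:C.
have p2 k : 0 < (2 ^+ k : R) by rewrite exprn_gt0.
have nt k : normc (t k) = s / 2 ^+ k.
  by rewrite normc_real ger0_norm // divr_ge0 // ltW.
have tv k : rn (t k *: v) <= r / 32.
  rewrite rnZ nt; apply: le_trans sv; rewrite ler_wpM2r //.
  by rewrite ler_pdivrMr // ler_peMr // ?exprn_ege1 ?ler1n // ltW.
have t0 k : t k != 0 by rewrite -normc_gt0 nt divr_gt0.
pose rho := r / 2 - rn (y - z).
have rho0 : 0 < rho by rewrite /rho; lra.
have yx x : rn (x - y) < rho -> rn (x - z) < r / 2.
  by move=> xy; apply: le_lt_trans (rn_dist y _ _) _; rewrite /rho in xy; lra.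
apply: (@weierstrass _ _ _ (fun k x => (f (x + t k *: v) - f x) / t k) y rho
   (128 * M * s * (rn v / (r / 2)) ^+ 2) (32 * M * (rn v / r))).
- by [].
- move=> k x /yx xz; apply: dfC_M; last exact: dfC_cst.
  apply: dfC_B; last by have [_ h] := B; apply: (h x _).1; lra.
  apply: (@df_comp _ _ _ _ (fun x => x + t k *: v) f).
    by apply: df_D; [exact: df_id|exact: df_cst].
  have [_ h] := B; apply: (h _ _).1; rewrite addrAC.
  by apply: le_lt_trans (rnD _ _) _; have := tv k; lra.
- move=> k x /yx xz.
  have h8 : rn (t k *: v) <= r / 2 / 8 by have := tv k; lra.
  have H := cauchy2 (bd x xz) h8.
  have -> : (f (x + t k *: v) - f x) / t k - 'd f x v =
      (f (x + t k *: v) - f x - 'd f x (t k *: v)) / t k.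
    have -> : 'd f x (t k *: v) = t k * 'd f x v by rewrite linearZ.
    have aux (a b D u : C) : u != 0 -> (a - b) / u - D = (a - b - u * D) / u.
      by move=> u0; field.
    exact: aux.
  rewrite normcM normcV ler_pdivrMr ?normc_gt0 //; apply: le_trans H _.
  rewrite rnZ nt le_eqVlt; apply/orP; left; apply/eqP; field.
  by rewrite rne gt_eqF.
- by move=> x /yx; exact: bnd.
Qed.

(** [cauchy2] at [y'] compares the increment with the differential at [y']; the Lipschitz bound for
    the derivative in direction [y - y'] then moves the base point to [z]. *)
Lemma strict_diff (f : V -> C) z r : 0 < r ->
  (forall y, rn (y - z) < r -> differentiable f y) ->
  exists K d : R, [/\ 0 <= K, 0 < d & forall y y', rn (y - z) < d -> rn (y' - z) < d ->
    normc (f y - f y' - 'd f z (y - y')) <= K * (rn (y - z) + rn (y' - z)) * rn (y - y')].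
Proof.
move=> r0 df; have [r' [M [_ B]]] := bounded_holo_ex r0 df.
have M0 := bounded_holo_ge0 B; have r'0 : 0 < r' by case: B.
have rne : r' != 0 by rewrite gt_eqF.
exists (M / r' ^+ 2 * (64 * 64)), (r' / 64); split.
- by apply: mulr_ge0; [rewrite divr_ge0 ?sqr_ge0|exact: mulr_ge0].
- by rewrite divr_gt0.
move=> y y' yz y'z.
have yy' : rn (y - y') <= rn (y - z) + rn (y' - z).
  by rewrite (rnBC y' z); exact: rn_dist.
have B' : bounded_holo f y' (r' / 2) M by apply: bounded_holo_sub B _ _; lra.
have h1 : rn (y - y') <= r' / 2 / 8 by lra.
have e1 : y' + (y - y') = y by rewrite addrC; exact: subrK.
have H1 := cauchy2 B' h1; rewrite e1 in H1.
have BD := bounded_holo_deriv (y - y') B.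
have h2 : rn (y' - z) <= r' / 2 / 8 by lra.
have H2 := holo_lipschitz BD h2.
apply: le_trans (normc_dist ('d f y' (y - y')) _ _) _.
apply: le_trans (lerD H1 H2) _.
have -> : 128 * M * (rn (y - y') / (r' / 2)) ^+ 2 +
   32 * (32 * M * (rn (y - y') / r')) * (rn (y' - z) / (r' / 2))
   = M / r' ^+ 2 * (16 * 32 * rn (y - y') + 64 * 32 * rn (y' - z)) * rn (y - y').
  by field.
apply: ler_wpM2r; first exact: rn_ge0.
rewrite -[leRHS]mulrA.
apply: ler_wpM2l; first by rewrite divr_ge0 ?sqr_ge0.
move: yy' (rn_ge0 (y - z)) (rn_ge0 (y' - z)).
by move: (rn (y - y')) (rn (y - z)) (rn (y' - z)) => a b c; clear; lra.
Qed.

End Derivatives.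

Section VectorValued.
Variables (R : realType) (n m : nat).
Local Notation C := (R[i]^o).
Local Notation V := 'rV[R[i]]_n.
Local Notation W := 'rV[R[i]]_m.

Lemma mulmx_bound (J : 'M[R[i]]_(n, m)) :
  exists2 c : R, 0 < c & forall h : V, rn (h *m J) <= c * rn h.
Proof.
pose K := \sum_i \sum_j normc (J i j : C).
have K0 : 0 <= K by apply: sumr_ge0 => i _; apply: sumr_ge0 => j _; exact: normc_ge0.
have JK i j : normc (J i j : C) <= K.
  rewrite /K (bigD1 i) //= (bigD1 j) //= -addrA lerDl addr_ge0 //.
    by apply: sumr_ge0 => ? _; exact: normc_ge0.
  by apply: sumr_ge0 => ? _; apply: sumr_ge0 => ? _; exact: normc_ge0.
exists (n%:R * K + 1); first by rewrite ltr_wpDl // mulr_ge0.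
move=> h; have h0 := rn_ge0 h; apply: rn_rV_le.
  by rewrite mulr_ge0 // addr_ge0 // mulr_ge0.
move=> j; rewrite mxE.
apply: le_trans (@lform_bound _ _ (fun i => J i j) K h _) _; first by move=> i; exact: JK.
by rewrite ler_wpM2r // lerDl.
Qed.

Lemma mulmxr_continuous (J : 'M[R[i]]_(n, m)) : continuous (fun h : V => h *m J).
Proof.
have [c c0 cP] := mulmx_bound J; move=> x; apply/continuous_rn => e e0.
exists (e / c); first by rewrite divr_gt0.
move=> y; rewrite ltr_pdivlMr // => yx; rewrite -mulmxBl.
by apply: le_lt_trans (cP _) _; rewrite mulrC.
Qed.

Lemma df_coord (f : V -> W) (z : V) j : differentiable f z ->
  differentiable (fun y => f y 0 j : C) z /\
  forall h, 'd (fun y => f y 0 j : C) z h = 'd f z h 0 j.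
Proof.
move=> df.
pose l i : C := 'd f z (delta_mx 0 i) 0 j.
have lE h : lform l h = 'd f z h 0 j.
  rewrite {2}[h]row_sum_delta linear_sum summxE; apply: eq_bigr => i _.
  by rewrite linearZ mxE.
have [] := @rn_differentiable _ _ _ (fun y => f y 0 j : C) z (lform l) (@lform_continuous _ _ l).
  move=> e e0; have [d d0 dP] := differentiable_rn df e0; exists d => // h hd.
  apply: le_trans (dP h hd); rewrite rnC [X in normc (_ - X)](lE h).
  by apply: le_trans (rn_coord _ j); rewrite !mxE.
by move=> d1 d2; split => // h; rewrite -lE; exact: (congr1 (fun g => g h) d2).
Qed.

Lemma df_rV_mx (f : V -> W) (z : V) (J : 'M[R[i]]_(n, m)) :
  (forall e : R, 0 < e -> exists2 d : R, 0 < d &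
    forall h, rn h < d -> rn (f (z + h) - f z - h *m J) <= e * rn h) ->
  differentiable f z /\ forall h, 'd f z h = h *m J.
Proof.
move=> H; have [] := @rn_differentiable _ _ _ f z (mulmxr J) (@mulmxr_continuous J) H.
by move=> d1 d2; split => // h; exact: (congr1 (fun g => g h) d2).
Qed.

Lemma df_rV (f : V -> W) (z : V) :
  (forall j, differentiable (fun y => f y 0 j : C) z) -> differentiable f z.
Proof.
move=> df; pose J := \matrix_(i, j) ('d (fun y => f y 0 j : C) z (delta_mx 0 i)).
apply: (@df_rV_mx _ _ J _).1 => e e0.
have /choice[d dP] : forall j, exists d : R, 0 < d /\ forall h, rn h < d ->
    normc (f (z + h) 0 j - f z 0 j - (h *m J) 0 j) <= e * rn h.
  move=> j; have [d d0 dP] := differentiable_rn (df j) e0; exists d; split => // h hd.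
  have := dP h hd; rewrite rnC rV_linear mxE.
  suff -> : lform (fun j0 => 'd (fun y => f y 0 j : C) z (delta_mx 0 j0)) h = \sum_j0 h 0 j0 * J j0 j.
    by [].
  by apply: eq_bigr => i _; rewrite mxE.
pose D := \big[Num.min/1]_j d j.
have D0 : 0 < D.
  apply: (big_ind (fun x => 0 < x)) => // [x y x0 y0|j _]; first by rewrite lt_min x0.
  by have [] := dP j.
have Dj j : D <= d j by rewrite /D (bigD1 j) //= ge_min lexx.
exists D => // h hD; apply: rn_rV_le; first by rewrite mulr_ge0 ?rn_ge0 // ltW.
move=> j; have [_ H] := dP j; rewrite !mxE -[X in _ - X]/(_ : C) .
have := H h (lt_le_trans hD (Dj j)); by rewrite mxE.
Qed.

Lemma strict_diff_rV (f : V -> W) z r : 0 < r ->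
  (forall y, rn (y - z) < r -> differentiable f y) ->
  forall e : R, 0 < e -> exists2 d : R, 0 < d &
    forall y y', rn (y - z) < d -> rn (y' - z) < d ->
      rn (f y - f y' - 'd f z (y - y')) <= e * rn (y - y').
Proof.
move=> r0 df e e0.
have dfz : differentiable f z by apply: df; rewrite subrr rn0.
have /choice[d dP] : forall j, exists d : R, 0 < d /\
    forall y y', rn (y - z) < d -> rn (y' - z) < d ->
      normc (f y 0 j - f y' 0 j - 'd f z (y - y') 0 j) <= e * rn (y - y').
  move=> j.
  have [K [d [K0 d0 H]]] := @strict_diff _ _ (fun y => f y 0 j : C) z r r0
    (fun y yz => (df_coord j (df y yz)).1).
  have K1 : 0 < K + 1 by rewrite ltr_wpDl.
  exists (Num.min d (e / (2 * (K + 1)))); split; first by rewrite lt_min d0 divr_gt0 // mulr_gt0.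
  move=> y y'; rewrite !lt_min => /andP[y1 y2] /andP[y'1 y'2].
  have := H y y' y1 y'1; rewrite (df_coord j dfz).2 => H1.
  apply: le_trans H1 _; apply: ler_wpM2r; first exact: rn_ge0.
  move: y2 y'2; rewrite !ltr_pdivlMr ?mulr_gt0 //.
  move: (rn_ge0 (y - z)) (rn_ge0 (y' - z)) K0 e0.
  by move: (rn (y - z)) (rn (y' - z)) => a b; clear; nra.
pose D := \big[Num.min/1]_j d j.
have D0 : 0 < D.
  apply: (big_ind (fun x => 0 < x)) => // [x y x0 y0|j _]; first by rewrite lt_min x0.
  by have [] := dP j.
have Dj j : D <= d j by rewrite /D (bigD1 j) //= ge_min lexx.
exists D => // y y' yD y'D; apply: rn_rV_le; first by rewrite mulr_ge0 ?rn_ge0 // ltW.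
move=> j; have [_ H] := dP j.
by rewrite !mxE; apply: H; [exact: lt_le_trans yD (Dj j)|exact: lt_le_trans y'D (Dj j)].
Qed.

Lemma d_jacobian (f : V -> W) (z h : V) : 'd f z h = h *m lin1_mx ('d f z).
Proof. by move: ('d f z) => L; rewrite mul_rV_lin1. Qed.

End VectorValued.

(** * The holomorphic inverse function theorem *)

Section InverseFunction.
Variables (R : realType) (n : nat).
Local Notation C := (R[i]^o).
Local Notation V := 'rV[R[i]]_n.

Lemma geometric_limit_rV (u : nat -> V) (K : R) :
  (forall k, rn (u k.+1 - u k) <= K / 2 ^+ k) ->
  exists l : V, forall k, rn (u k - l) <= 2 * K / 2 ^+ k.
Proof.
move=> uK.
have K0 : 0 <= K by have := uK 0%N; rewrite expr0 divr1; apply: le_trans; exact: rn_ge0.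
have /choice[l lP] : forall j, exists l : C, forall k, normc ((u k 0 j : C) - l) <= 2 * K / 2 ^+ k.
  move=> j; apply: geometric_limit => k; apply: le_trans (uK k).
  by apply: le_trans (rn_coord _ j); rewrite !mxE.
exists (\row_j l j) => k; apply: rn_rV_le => [|j].
  by rewrite !mulr_ge0 // invr_ge0 exprn_ge0.
by rewrite !mxE; exact: lP.
Qed.

(** Newton iteration with the inverse [L] of the derivative frozen at [a]. Strict differentiability
    with constant [(2 * c)^-1], where [c] bounds [L], gives a contraction of factor 1/2, and the
    same inequality [half] makes [f] bi-Lipschitz near [a], which yields differentiability of the
    inverse. *)
Theorem inverse_function (f : V -> V) (a : V) (r rho : R) : 0 < r -> 0 < rho ->
  (forall y, rn (y - a) < r -> differentiable f y) ->
  lin1_mx ('d f a) \in unitmx ->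
  exists e (g : V -> V), [/\ 0 < e, g (f a) = a & forall w, rn (w - f a) < e ->
    [/\ f (g w) = w, rn (g w - a) < rho & differentiable g w]].
Proof.
move=> r0 rho0 df; set J := lin1_mx _ => Ju.
have dJ h : 'd f a h = h *m J by exact: d_jacobian.
pose L := invmx J.
have [c c0 cP] := mulmx_bound L; have [cJ cJ0 cJP] := mulmx_bound J.
have [d1 d10 d1P] := strict_diff_rV r0 df (ltac:(by rewrite invr_gt0 mulr_gt0) : 0 < (2 * c)^-1).
pose d := Num.min d1 (Num.min r rho).
have d0 : 0 < d by rewrite !lt_min d10 r0.
have dd1 : d <= d1 by rewrite ge_min lexx.
have dr : d <= r by rewrite !ge_min lexx orbT.
have drho : d <= rho by rewrite !ge_min lexx !orbT.
have half y y' : rn (y - a) < d -> rn (y' - a) < d ->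
    rn ((f y - f y') *m L - (y - y')) <= 2^-1 * rn (y - y').
  move=> ya y'a; have H := d1P y y' (lt_le_trans ya dd1) (lt_le_trans y'a dd1).
  rewrite dJ in H; have -> : (f y - f y') *m L - (y - y') = (f y - f y' - (y - y') *m J) *m L.
    by rewrite [RHS]mulmxBl mulmxK.
  apply: le_trans (cP _) _; rewrite -(ler_pM2l c0) in H; apply: le_trans H _.
  by rewrite invfM mulrA mulrCA divff ?mulr1 // gt_eqF.
have lip y y' : rn (y - a) < d -> rn (y' - a) < d ->
    rn (y - y') <= 2 * c * rn (f y - f y').
  move=> ya y'a; have := half y y' ya y'a; have := cP (f y - f y').
  have := rnB ((f y - f y') *m L) ((f y - f y') *m L - (y - y')).
  rewrite opprB addrCA subrr addr0; lra.
have lip' y y' : rn (y - a) < d -> rn (y' - a) < d ->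
    rn (f y - f y') <= 2 * cJ * rn (y - y').
  move=> ya y'a; have h3 := half y y' ya y'a.
  have -> : f y - f y' = ((f y - f y') *m L) *m J by rewrite mulmxKV.
  have := cJP ((f y - f y') *m L); have := rnD ((f y - f y') *m L - (y - y')) (y - y').
  rewrite subrK => h1 h2; apply: le_trans h2 _.
  rewrite [2 * cJ]mulrC -mulrA ler_pM2l //.
  by move: h1 h3; have := rn_ge0 (y - y'); lra.
have solve w : rn (w - f a) < d / (4 * c) ->
    exists x, f x = w /\ rn (x - a) <= 2 * c * rn (w - f a).
  move=> wa; pose s := c * rn (w - f a).
  have s0 : 0 <= s by rewrite mulr_ge0 ?rn_ge0 // ltW.
  have sd : s < d / 4 by move: wa; rewrite ltr_pdivlMr ?mulr_gt0 // /s; lra.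
  pose T x := x - (f x - w) *m L; pose u k := iter k T a.
  have TB y y' : T y - T y' = - ((f y - f y') *m L - (y - y')).
    rewrite /T !mulmxBl; move: (f y *m L) (f y' *m L) (w *m L) => A B D.
    by apply/rowP => j; rewrite !mxE; ring.
  have p2 k : 0 < (2 ^+ k : R) by rewrite exprn_gt0.
  have uP k : rn (u k - a) <= 2 * s - 2 * s / 2 ^+ k /\ rn (u k.+1 - u k) <= s / 2 ^+ k.
    elim: k => [|k [IH1 IH2]].
      split; first by rewrite /u /= subrr rn0 expr0 divr1 subrr.
      rewrite /u /= /T addrAC subrr add0r rnN expr0 divr1.
      by apply: le_trans (cP _) _; rewrite rnBC.
    have s2 : 2 * s / 2 ^+ k.+1 = s / 2 ^+ k by rewrite exprS; field; rewrite gt_eqF.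
    have A1 : rn (u k.+1 - a) <= 2 * s - 2 * s / 2 ^+ k.+1.
      apply: le_trans (rn_dist (u k) _ _) _; rewrite s2.
      by move: IH1 IH2; have -> : 2 * s / 2 ^+ k = s / 2 ^+ k + s / 2 ^+ k; [ring|lra].
    split => //.
    have P1 : 0 <= 2 * s / 2 ^+ k by apply: divr_ge0; [exact: mulr_ge0|exact: ltW].
    have P2 : 0 <= 2 * s / 2 ^+ k.+1 by apply: divr_ge0; [exact: mulr_ge0|exact: ltW].
    have B1 : rn (u k - a) < d by lra.
    have B2 : rn (u k.+1 - a) < d by lra.
    have -> : u k.+2 - u k.+1 = - ((f (u k.+1) - f (u k)) *m L - (u k.+1 - u k)).
      rewrite [u k.+2]/(T (u k.+1)) [X in _ - X = _]/(T (u k)); exact: TB.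
    rewrite rnN; apply: le_trans (half _ _ B2 B1) _.
    by rewrite exprS invfM mulrCA ler_pM2l // invr_gt0.
  have [x xP] := geometric_limit_rV (fun k => (uP k).2).
  have ud k : rn (u k - a) < d.
    have := (uP k).1; have : 0 <= 2 * s / 2 ^+ k by apply: divr_ge0; [exact: mulr_ge0|exact: ltW].
    lra.
  have xa : rn (x - a) <= 2 * s.
    have := xP 0%N; rewrite /u /= expr0 divr1 rnBC; lra.
  have xd : rn (x - a) < d by lra.
  exists x; split; last by rewrite -mulrA.
  apply/eqP; rewrite -subr_eq0; apply/eqP; apply: rn_eq0.
  apply/eqP; rewrite eq_le rn_ge0 andbT; apply/ler_addgt0Pr => e e0; rewrite add0r.
  pose D := 4 * cJ * s + cJ * s.
  have cJ1 := ltW cJ0; have D0 : 0 <= D by apply: addr_ge0; apply: mulr_ge0 => //; exact: mulr_ge0.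
  have [k /(_ k (leqnn _)) kD] := exp2_small D0 e0.
  apply: le_trans _ (ltW kD).
  apply: le_trans (rn_dist (f (u k)) _ _) _.
  have -> : D / 2 ^+ k = 2 * cJ * (2 * s / 2 ^+ k) + cJ * (s / 2 ^+ k) by rewrite /D; ring.
  apply: lerD.
    apply: le_trans (lip' _ _ xd (ud k)) _; rewrite ler_pM2l ?mulr_gt0 // rnBC; exact: xP.
  have -> : f (u k) - w = ((f (u k) - w) *m L) *m J by rewrite mulmxKV.
  apply: le_trans (cJP _) _; rewrite ler_pM2l //.
  have := (uP k).2; rewrite [u k.+1]/(T (u k)) /T addrAC subrr add0r rnN; exact: id.
have e0 : 0 < d / (4 * c) by rewrite divr_gt0 // mulr_gt0.
have /choice[g gP] : forall w, exists x, rn (w - f a) < d / (4 * c) ->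
    f x = w /\ rn (x - a) <= 2 * c * rn (w - f a).
  move=> w; have [wa|nwa] := pselect (rn (w - f a) < d / (4 * c)).
    by have [x xP] := solve w wa; exists x.
  by exists 0.
have gd w : rn (w - f a) < d / (4 * c) -> rn (g w - a) < d.
  move=> wa; have [_ h] := gP w wa; move: wa; rewrite ltr_pdivlMr ?mulr_gt0 //; lra.
(* The preimage bound [2 * c * rn (w - f a)] is zero at [w = f a], so even a preimage picked by
   choice must be [a]. *)
have gfa : g (f a) = a.
  have [_] := gP (f a) (ltac:(by rewrite subrr rn0)); rewrite subrr rn0 mulr0 => h.
  apply/eqP; rewrite -subr_eq0; apply/eqP; apply: rn_eq0.
  by apply/eqP; rewrite eq_le rn_ge0 h.
exists (d / (4 * c)), g; split => // w0 w0a; have [fg _] := gP w0 w0a.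
split => //; first exact: lt_le_trans (gd w0 w0a) drho.
set x0 := g w0 in fg *; have x0d : rn (x0 - a) < d := gd w0 w0a.
have dfx : differentiable f x0 by apply: df; exact: lt_le_trans dr.
pose J0 := lin1_mx ('d f x0).
have dJ0 h : 'd f x0 h = h *m J0 by exact: d_jacobian.
(* Along a small kernel vector [k] the increment of [f] would be at most [rn k / (4 * c)], whereas
   [half] forces at least [rn k / (2 * c)]. *)
have J0u : J0 \in unitmx.
  rewrite -row_free_unit; apply/row_freeP; exists (pinvmx J0); apply: mulmxVp.
  rewrite -kermx_eq0; apply/eqP/row_matrixP => i; rewrite row0.
  set h := row i _; have hJ : h *m J0 = 0.
    by apply/eqP; rewrite -sub_kermx row_sub.
  apply: rn_eq0; apply/eqP; rewrite eq_le rn_ge0 andbT; rewrite leNgt; apply/negP => h0.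
  have c4 : 0 < (4 * c)^-1 by rewrite invr_gt0 mulr_gt0.
  have [d2 d20 d2P] := differentiable_rn dfx c4.
  clear d1P.
  pose t := Num.min (d2 / (2 * rn h)) ((d - rn (x0 - a)) / (2 * rn h)).
  have t0 : 0 < t by rewrite lt_min !divr_gt0 ?mulr_gt0 // subr_gt0.
  have th1 : t * rn h < d2.
    have : t <= d2 / (2 * rn h) by rewrite ge_min lexx.
    rewrite ler_pdivlMr ?mulr_gt0 //; lra.
  have th2 : t * rn h < d - rn (x0 - a).
    have : t <= (d - rn (x0 - a)) / (2 * rn h) by rewrite ge_min lexx orbT.
    rewrite ler_pdivlMr ?mulr_gt0 //; lra.
  pose k := (t%:C : C) *: h.
  have nk : rn k = t * rn h by rewrite rnZ normc_real gtr0_norm.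
  have H1 := d2P k (ltac:(by rewrite nk)).
  have kd : rn (x0 + k - a) < d.
    rewrite addrAC; apply: le_lt_trans (rnD _ _) _; rewrite nk; lra.
  have H2 := half _ _ kd x0d.
  move: H1 H2; rewrite dJ0.
  have -> : k *m J0 = 0 by rewrite /k -scalemxAl hJ scaler0.
  rewrite subr0; have -> : x0 + k - x0 = k by rewrite addrAC subrr add0r.
  move=> H1 H2; have H3 := cP (f (x0 + k) - f x0).
  have := rnB ((f (x0 + k) - f x0) *m L) ((f (x0 + k) - f x0) *m L - k).
  rewrite opprB addrCA subrr addr0 => H4.
  have H5 : c * rn (f (x0 + k) - f x0) <= 4^-1 * rn k.
    rewrite -(ler_pM2l c0) in H1; apply: le_trans H1 _.
    by rewrite invfM mulrA mulrCA divff ?mulr1 // gt_eqF.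
  have k0 : 0 < rn k by rewrite nk mulr_gt0.
  by move: H2 H3 H4 H5 k0; clear; lra.
have [c1 c10 c1P] := mulmx_bound (invmx J0).
apply: (@df_rV_mx _ _ _ g w0 (invmx J0) _).1 => e e'0.
have eta0 : 0 < e / (c1 * (2 * c)) by rewrite divr_gt0 // !mulr_gt0.
have [d2 d20 d2P] := differentiable_rn dfx eta0.
pose e1 := Num.min (d / (4 * c) - rn (w0 - f a)) (d2 / (4 * c)).
exists e1; first by rewrite lt_min subr_gt0 w0a divr_gt0 // mulr_gt0.
move=> h; rewrite lt_min => /andP[h1 h2].
have wh : rn (w0 + h - f a) < d / (4 * c).
  by rewrite addrAC; apply: le_lt_trans (rnD _ _) _; lra.
have [fgh _] := gP _ wh; have ghd := gd _ wh.
set x := g (w0 + h) in fgh ghd *.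
have xx : rn (x - x0) <= 2 * c * rn h.
  by have := lip _ _ ghd x0d; rewrite fgh fg addrAC subrr add0r.
have xd2 : rn (x - x0) < d2.
  by move: h2; rewrite ltr_pdivlMr ?mulr_gt0 //; have := rn_ge0 h; have := c0; lra.
have ex : x0 + (x - x0) = x by rewrite addrC; exact: subrK.
have eh : w0 + h - w0 = h by rewrite addrAC subrr add0r.
have H := d2P _ xd2; rewrite dJ0 ex fgh fg eh in H.
have -> : x - x0 - h *m invmx J0 = - ((h - (x - x0) *m J0) *m invmx J0).
  by rewrite mulmxBl mulmxK // opprB.
rewrite rnN; apply: le_trans (c1P _) _.
rewrite -(ler_pM2l c10) in H; apply: le_trans H _.
have -> : c1 * (e / (c1 * (2 * c)) * rn (x - x0)) = e / (2 * c) * rn (x - x0).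
  by field; rewrite !gt_eqF.
apply: le_trans (ler_wpM2l _ xx) _; first by apply: ltW; rewrite divr_gt0 // mulr_gt0.
by rewrite le_eqVlt; apply/orP; left; apply/eqP; field; rewrite gt_eqF.
Qed.

End InverseFunction.

(** * Osgood's theorem on injective holomorphic maps *)

Section Zeros.
Variable R : realType.
Local Notation C := (R[i]^o).

(** A mean value inequality that needs no integration: over [2 ^ k] equal steps the linear terms add
    up to [B * s], while the quadratic errors add up to [K * s ^+ 2 / 2 ^+ k]. *)
Lemma subdivision_bound (W : normedModType R[i]) (u : R -> W) (s B K : R) : 0 <= s ->
  (forall x y, 0 <= x -> x <= y -> y <= s ->
    rn (u y - u x) <= B * (y - x) + K * (y - x) ^+ 2) ->
  rn (u s - u 0) <= B * s.
Proof.
move=> s0 H; apply/ler_addgt0Pr => e e0.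
pose D := `|K| * s ^+ 2.
have D0 : 0 <= D by rewrite mulr_ge0 // sqr_ge0.
have [k /(_ k (leqnn _)) kD] := exp2_small D0 e0.
pose N := (2 ^ k)%N.
have N0 : 0 < (N%:R : R) by rewrite ltr0n expn_gt0.
have NE : N%:R = 2 ^+ k :> R by rewrite natrX.
pose d := s / N%:R.
have d0 : 0 <= d by rewrite divr_ge0 // ltW.
have dN : d * N%:R = s by rewrite divfK // gt_eqF.
have st j : (j <= N)%N -> rn (u (d * j%:R) - u 0) <= j%:R * (B * d + K * d ^+ 2).
  elim: j => [|j IH] jN; first by rewrite mulr0 subrr rn0 mul0r.
  apply: le_trans (rn_dist (u (d * j%:R)) _ _) _.
  have le1 : d * j%:R <= d * j.+1%:R by rewrite ler_wpM2l // ler_nat.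
  have le2 : d * j.+1%:R <= s by rewrite -dN ler_wpM2l // ler_nat.
  have le0 : 0 <= d * j%:R by rewrite mulr_ge0.
  have := H _ _ le0 le1 le2; have -> : d * j.+1%:R - d * j%:R = d by rewrite -natr1; ring.
  move=> h1; have h2 := IH (ltnW jN); apply: le_trans (lerD h1 h2) _.
  by rewrite -[j.+1%:R]natr1 mulrDl mul1r addrC.
have := st N (leqnn _); rewrite dN => h; apply: le_trans h _.
have -> : N%:R * (B * d + K * d ^+ 2) = B * s + K * s ^+ 2 / 2 ^+ k.
  by rewrite -NE /d; field; rewrite gt_eqF.
rewrite lerD2l; apply: le_trans _ (ltW kD); rewrite ler_wpM2r // ?invr_ge0 ?exprn_ge0 //.
by rewrite ler_wpM2r ?sqr_ge0 // ler_norm.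
Qed.

Lemma normc_rev (z w : C) : `|normc z - normc w| <= normc (z - w).
Proof.
rewrite ler_norml; have := normcD (z - w) w; have := normcD (w - z) z.
by rewrite !subrK (normcBC w) => h1 h2; apply/andP; split; lra.
Qed.

Lemma seg_lower a b (f : R -> C) : a <= b -> seg_continuous a b f ->
  (forall x, a <= x <= b -> f x != 0) ->
  exists2 m : R, 0 < m & forall x, a <= x <= b -> m <= normc (f x).
Proof.
move=> ab cf f0.
have [] := @EVT_min R (fun x => normc (f x)) a b ab.
  apply/subspace_continuousP => x /=; rewrite in_itv /= => xab.
  apply/cvgrPdist_lt => e e0; have [d d0 df] := cf x xab e e0.
  rewrite near_withinE; near=> y => yab; rewrite distrC.
  have h : normc (f y - f x) < e.
    apply: df; first by move: yab; rewrite /= in_itv.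
    by rewrite distrC; near: y; exact: cvgr_dist_lt.
  exact: le_lt_trans (normc_rev _ _) h.
move=> c; rewrite in_itv /= => cab cP; exists (normc (f c)).
  by rewrite normc_gt0; apply: f0.
by move=> x xab; apply: cP; rewrite in_itv.
Unshelve. all: by end_near. Qed.

Lemma bd_lower (F : C -> C) q : wf q -> bd_continuous F q ->
  (forall z, on_bd q z -> F z != 0) ->
  exists2 m : R, 0 < m & forall z, on_bd q z -> m <= normc (F z).
Proof.
move=> w cF F0; have [h1 h2 h3 h4] := bd_continuous_sides w cF.
case: (w) => w1 w2.
have [m1 m10 P1] : exists2 m : R, 0 < m & forall x, q.1.1 <= x <= q.1.2 -> m <= normc (F (x +i* q.2.1)).
  apply: (seg_lower w1 h1) => x xab; apply: F0.
  by rewrite /on_bd /in_rect /= xab w2 lexx eqxx !orbT.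
have [m2 m20 P2] : exists2 m : R, 0 < m & forall x, q.1.1 <= x <= q.1.2 -> m <= normc (F (x +i* q.2.2)).
  apply: (seg_lower w1 h2) => x xab; apply: F0.
  by rewrite /on_bd /in_rect /= xab w2 lexx eqxx !orbT.
have [m3 m30 P3] : exists2 m : R, 0 < m & forall y, q.2.1 <= y <= q.2.2 -> m <= normc (F (q.1.2 +i* y)).
  apply: (seg_lower w2 h3) => x xab; apply: F0.
  by rewrite /on_bd /in_rect /= xab w1 lexx eqxx !orbT.
have [m4 m40 P4] : exists2 m : R, 0 < m & forall y, q.2.1 <= y <= q.2.2 -> m <= normc (F (q.1.1 +i* y)).
  apply: (seg_lower w2 h4) => x xab; apply: F0.
  by rewrite /on_bd /in_rect /= xab w1 lexx eqxx.
exists (Num.min (Num.min m1 m2) (Num.min m3 m4)); first by rewrite !lt_min m10 m20 m30.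
move=> [x y] /andP[/andP[/= hx hy]] /or4P[] /eqP e; subst.
- by apply: le_trans (P4 y hy); rewrite !ge_min lexx !orbT.
- by apply: le_trans (P3 y hy); rewrite !ge_min lexx !orbT.
- by apply: le_trans (P1 x hx); rewrite !ge_min lexx.
- by apply: le_trans (P2 x hx); rewrite !ge_min lexx !orbT.
Qed.

(** If the translated slice had no zero, [center_bound] for its reciprocal, at most [2 / m] on the
    boundary, would give [normc (h z) >= m / 8]; but [h p = 0] and the Lipschitz estimate give at
    most [m / 16] for [z] near [p]. *)
Lemma hurwitz (V : normedModType R[i]) (h : V -> C) (p v : V) (r M rho : R) :
  bounded_holo h p r M -> 0 < rho -> 2 * rho * rn v <= r / 2 -> h p = 0 ->
  (forall t, on_bd (sq 0 rho) t -> h (p + t *: v) != 0) ->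
  exists2 d : R, 0 < d & forall z, rn (z - p) < d ->
    exists t : C, in_rect (sq 0 rho) t /\ h (z + t *: v) = 0.
Proof.
move=> B rho0 rhor hp h0; have M0 := bounded_holo_ge0 B; have r0 : 0 < r by case: B.
have tv (t : C) : in_rect (sq 0 rho) t -> rn (t *: v) <= r / 2.
  move=> /in_sq_le; rewrite subr0 => t2; rewrite rnZ; apply: le_trans rhor.
  by rewrite ler_wpM2r ?rn_ge0.
have dh z (t : C) : rn (z - p) < r / 2 -> in_rect (sq 0 rho) t ->
    differentiable (fun t : C => h (z + t *: v) : C) t.
  move=> zp /tv tr; apply: (@df_comp _ _ _ _ (fun t : C => z + t *: v) h); first exact: df_line.
  have [_ H] := B; apply: (H _ _).1; rewrite addrAC.
  by apply: le_lt_trans (rnD _ _) _; lra.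
have pp : rn (p - p) < r / 2 by rewrite subrr rn0 divr_gt0.
have wq := wf_sq (0 : C) (ltW rho0).
have [m m0 mP] : exists2 m : R, 0 < m & forall t, on_bd (sq 0 rho) t -> m <= normc (h (p + t *: v)).
  apply: (bd_lower wq) => //; apply: bd_df => t /andP[tq _]; exact: dh.
pose D := 64 * M / r.
have D0 : 0 <= D by rewrite divr_ge0 // ?mulr_ge0 // ltW.
have D1 : 0 < D + 1 by rewrite ltr_wpDl.
exists (Num.min (r / 16) (m / (16 * (D + 1)))); first by rewrite lt_min !divr_gt0 ?mulr_gt0.
move=> z; rewrite lt_min => /andP[z1]; rewrite ltr_pdivlMr ?mulr_gt0 // => z2.
have lip (t : C) : in_rect (sq 0 rho) t -> normc (h (z + t *: v) - h (p + t *: v)) <= m / 16.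
  move=> tq; have Bt : bounded_holo h (p + t *: v) (r / 2) M.
    apply: bounded_holo_sub B _ _; first by rewrite divr_gt0.
    by rewrite addrAC subrr add0r; have := tv t tq; lra.
  have e : z + t *: v - (p + t *: v) = z - p by rewrite opprD addrACA subrr addr0.
  have := holo_lipschitz (y := z + t *: v) Bt; rewrite e => H.
  apply: le_trans (H _) _; first by lra.
  have -> : 32 * M * (rn (z - p) / (r / 2)) = D * rn (z - p) by rewrite /D; field; rewrite gt_eqF.
  by move: z2 (rn_ge0 (z - p)) D0; move: (rn (z - p)) (D) => a b; clear; lra.
apply: contrapT => no.
have hz (t : C) : in_rect (sq 0 rho) t -> h (z + t *: v) != 0.
  by move=> tq; apply/eqP => e; apply: no; exists t.
have zr : rn (z - p) < r / 2 by lra.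
have in0 : in_rect (sq 0 rho) (0 : C) by apply: in_sq; rewrite subrr normc0 ltW.
have dq (t : C) : in_rect (sq 0 rho) t -> differentiable (fun t : C => (h (z + t *: v))^-1 : C) t.
  by move=> tq; apply: dfC_V; [exact: dh|exact: hz].
have := @center_bound _ (fun t : C => (h (z + t *: v))^-1) 0 rho (2 / m) rho0
  (fun t tq _ => dq t tq) (df_continuous (dq 0 in0)).
rewrite scale0r addr0 => H.
have : normc (h z)^-1 <= 4 * (2 / m).
  apply: H => t tb; have tq : in_rect (sq 0 rho) t by case/andP: tb.
  rewrite normcV -[2 / m]invf_div lef_pV2 ?posrE ?divr_gt0 ?normc_gt0 ?hz //.
  have := mP t tb; have := lip t tq; rewrite normcBC.
  have := normcD (h (p + t *: v) - h (z + t *: v)) (h (z + t *: v)); rewrite subrK.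
  by move: m0; clear; lra.
have := lip 0 in0; rewrite scale0r !addr0 hp subr0 => h1 h2.
have hz0 : 0 < normc (h z) by have := hz 0 in0; rewrite scale0r addr0 normc_gt0.
have m42 : 0 < 4 * (2 / m) by rewrite mulr_gt0 // divr_gt0.
move: h2; rewrite normcV invf_ple ?posrE // => h2.
move: h2; have -> : (4 * (2 / m))^-1 = m / 8 by field; rewrite gt_eqF.
by move: m0 h1; clear; lra.
Qed.

Section DerivativeClosed.
Variable n : nat.
Local Notation V := 'rV[R[i]]_n.

(** Closure of [G] under directional derivatives encodes vanishing to infinite order at [p] without
    iterated differentials. All Taylor coefficients along every ray then vanish, and the Taylor
    remainder gives [h = 0] on a ball. *)
Lemma all_derivatives_zero (G : set (V -> C)) (p : V) (r : R) : 0 < r ->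
  (forall g, G g -> [/\ forall y, rn (y - p) < r -> differentiable g y,
    g p = 0 & forall v, G (fun y => 'd g y v)]) ->
  forall h, G h -> exists2 d : R, 0 < d & forall y, rn (y - p) < d -> h y = 0.
Proof.
move=> r0 GP h Gh.
(* The induction treats all members of [G] at once: the derivative along [w] is again in [G], decays
   like t^k, and the mean value inequality gains one power. *)
have small k w : forall g, G g -> exists K d : R, [/\ 0 <= K, 0 < d &
    forall t, 0 <= t -> t <= d -> normc (g (p + (t%:C : C) *: w)) <= K * t ^+ k].
  elim: k => [|k IH] g Gg; have [dg g0 Gd] := GP g Gg;
    have [r' [M [_ B]]] := bounded_holo_ex r0 dg;
    have M0 := bounded_holo_ge0 B; have r'0 : 0 < r' by case: B.
    have w1 : 0 < rn w + 1 by rewrite ltr_wpDl // rn_ge0.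
    exists M, (r' / (2 * (rn w + 1))); split => //; first by rewrite divr_gt0 // mulr_gt0.
    move=> t t0; rewrite ler_pdivlMr ?mulr_gt0 // => tr.
    rewrite expr0 mulr1; have [_ H] := B; apply: (H _ _).2.
    rewrite addrAC subrr add0r rnZ normc_real ger0_norm //.
    by move: tr t0 (rn_ge0 w) r'0; clear; nra.
  have [K [d [K0 d0 KP]]] := IH _ (Gd w).
  have w1 : 0 < rn w + 1 by rewrite ltr_wpDl // rn_ge0.
  exists K, (Num.min d (r' / (16 * (rn w + 1)))); split => //.
    by rewrite lt_min d0 divr_gt0 // mulr_gt0.
  move=> t t0; rewrite le_min => /andP[td]; rewrite ler_pdivlMr ?mulr_gt0 // => tr.
  pose u s := g (p + (s%:C : C) *: w).
  have u0 : u 0 = 0 by rewrite /u scale0r addr0.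
  have -> : K * t ^+ k.+1 = K * t ^+ k * t by rewrite exprSr mulrA.
  have -> : normc (g (p + (t%:C : C) *: w)) = rn (u t - u 0) by rewrite rnC u0 subr0.
  apply: (@subdivision_bound C u t (K * t ^+ k) (128 * M * (rn w / (r' / 2)) ^+ 2) t0).
  move=> x y x0 xy yt.
  have xt : x <= t by apply: le_trans yt.
  have Bx : bounded_holo g (p + (x%:C : C) *: w) (r' / 2) M.
    apply: bounded_holo_sub B _ _; first by rewrite divr_gt0.
    rewrite addrAC subrr add0r rnZ normc_real ger0_norm //.
    by move: tr xt x0 (rn_ge0 w) r'0; clear; nra.
  have yx : 0 <= y - x by rewrite subr_ge0.
  have nyx : rn ((y - x)%:C *: w) = (y - x) * rn w by rewrite rnZ normc_real ger0_norm.
  have := cauchy2 (h := (y - x)%:C *: w) Bx; rewrite nyx.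
  have -> : p + x%:C *: w + (y - x)%:C *: w = p + y%:C *: w.
    by rewrite -addrA -scalerDl -rmorphD /= [x + _]addrC subrK.
  move=> H; have {}H := H (ltac:(move: tr yt x0 xy (rn_ge0 w) r'0; clear; nra)).
  have D1 : normc ('d g (p + x%:C *: w) ((y - x)%:C *: w)) <= K * t ^+ k * (y - x).
    rewrite linearZ normcM normc_real ger0_norm // mulrC ler_wpM2r //.
    apply: le_trans (KP x x0 (le_trans xt td)) _.
    by rewrite ler_wpM2l // lerXn2r // nnegrE.
  rewrite rnC.
  set A := g (p + y%:C *: w) in H *; set A' := g (p + x%:C *: w) in H *.
  set D := 'd g _ _ in H D1.
  have := normcD (A - A' - D) D; rewrite subrK => T.
  apply: le_trans T _; rewrite addrC; apply: lerD; first exact: D1.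
  apply: le_trans H _; rewrite le_eqVlt; apply/orP; left; apply/eqP.
  by rewrite mulrAC exprMn; ring.
have [dh h0 _] := GP h Gh.
have [r' [M [_ B]]] := bounded_holo_ex r0 dh.
have M0 := bounded_holo_ge0 B; have r'0 : 0 < r' by case: B.
exists (r' / 8); first by rewrite divr_gt0.
move=> y yp; set w := y - p.
have [a [aM _ _ aP]] := line_taylor w B.
(* Once the lower coefficients vanish, decay of order [j.+1] forces [normc (a j) <= D * t] for all
   small [t > 0]. *)
have a0 j : a j = 0.
  have [k] := ubnP j; elim: k j => // k IHk j jk.
  have aj i : (i < j)%N -> a i = 0 by move=> ij; apply: IHk; apply: leq_trans ij _.
  have [K [d [K0 d0 KP]]] := small j.+1 w h Gh.
  pose D := K + 8 * M * (4 * rn w / r') ^+ j.+1.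
  have D0 : 0 <= D.
    rewrite /D addr_ge0 // mulr_ge0 // ?mulr_ge0 // exprn_ge0 // divr_ge0 ?mulr_ge0 ?rn_ge0 //.
    exact: ltW.
  have bound t : 0 < t -> t <= d -> t <= 1 -> normc (a j) <= D * t.
    move=> t0 td t1; have nt : normc (t%:C : C) = t by rewrite normc_real gtr0_norm.
    have := aP t%:C j.+1; rewrite nt => H.
    have {}H := H (ltac:(move: t0 t1 (rn_ge0 w) yp; rewrite -/w; clear; nra)).
    have := KP t (ltW t0) td => H2.
    move: H; rewrite big_ord_recr /= big1 ?add0r => [H|i _]; last by rewrite aj ?mul0r.
    have := normcB (h (p + (t%:C : C) *: w)) (h (p + (t%:C : C) *: w) - a j * t%:C ^+ j).
    rewrite opprB addrCA subrr addr0 normcM normcX nt => H3.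
    have tj : 0 < t ^+ j by rewrite exprn_gt0.
    rewrite -(ler_pM2r tj); apply: le_trans H3 _; apply: le_trans (lerD H2 H) _.
    rewrite le_eqVlt; apply/orP; left; apply/eqP; rewrite /D.
    have -> : 4 * (t * rn w) / r' = (4 * rn w / r') * t by ring.
    by move: (4 * rn w / r') => q; rewrite exprMn [t ^+ j.+1]exprS; move: (q ^+ _) => q'; ring.
  apply: (@eq0_normc R); apply/eqP; rewrite eq_le normc_ge0 andbT.
  apply/ler_addgt0Pr => e e0; rewrite add0r.
  have D1 : 0 < D + 1 by rewrite ltr_wpDl.
  pose t := Num.min (Num.min d 1) (e / (D + 1)).
  have t0 : 0 < t by rewrite !lt_min d0 ltr01 divr_gt0.
  have h1 : t <= d by rewrite !ge_min lexx.
  have h2 : t <= 1 by rewrite !ge_min lexx !orbT.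
  have h3 : t <= e / (D + 1) by rewrite !ge_min lexx !orbT.
  apply: le_trans (bound t t0 h1 h2) _; move: h3; rewrite ler_pdivlMr //.
  by move: (ltW t0); clear; lra.
have yE : p + (1 : C) *: w = y by rewrite scale1r addrC subrK.
apply: (@eq0_normc R); apply/eqP; rewrite eq_le normc_ge0 andbT.
apply/ler_addgt0Pr => e e0; rewrite add0r.
have M8 : 0 <= 8 * M by rewrite mulr_ge0.
have [k /(_ k (leqnn _)) kD] := exp2_small M8 e0.
apply: le_trans _ (ltW kD).
have := aP 1 k; rewrite yE normc1 mul1r big1 => [|i _]; last by rewrite a0 mul0r.
rewrite subr0 => H; apply: le_trans (H _) _; first exact: ltW.
rewrite ler_wpM2l // -exprVn lerXn2r // ?nnegrE ?invr_ge0 //.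
  by rewrite divr_ge0 ?mulr_ge0 ?rn_ge0 // ltW.
by rewrite ler_pdivrMr //; move: yp; rewrite -/w; clear; lra.
Qed.

End DerivativeClosed.
End Zeros.

(** * Injective holomorphic functions of one variable *)

Section OneVariable.
Variable R : realType.
Local Notation C := (R[i]^o).
Local Notation V := 'rV[R[i]]_1.

Lemma continuous_inv (V : normedModType R[i]) (k : V -> C) (x : V) :
  {for x, continuous k} -> k x != 0 -> {for x, continuous (fun t => (k t)^-1 : C)}.
Proof.
move=> /continuous_rn ck k0; have n0 : 0 < normc (k x) by rewrite normc_gt0.
apply/continuous_rn => e e0.
pose c := Num.min (normc (k x) / 2) (e * normc (k x) ^+ 2 / 2).
have c0 : 0 < c by rewrite lt_min !divr_gt0 // mulr_gt0 // exprn_gt0.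
have [d d0 dP] := ck c c0; exists d => // y /dP; rewrite !rnC lt_min => /andP[h1 h2].
have h3 : normc (k x) / 2 < normc (k y).
  have := normcD (k x - k y) (k y); rewrite subrK normcBC.
  by move: h1; clear; lra.
have ky : k y != 0 by rewrite -normc_gt0; apply: lt_trans h3; rewrite divr_gt0.
have -> : (k y)^-1 - (k x)^-1 = - (k y - k x) / (k y * k x).
  by field; rewrite ky k0.
rewrite normcM normcN normcV normcM ltr_pdivrMr ?mulr_gt0 ?normc_gt0 //.
apply: lt_le_trans h2 _; rewrite -mulrA ler_pM2l // expr2 mulrAC ler_pM2r //.
exact: ltW.
Qed.

(** For [b] near [a], injectivity leaves [t = 0] as the only zero of g(b + te) - g(b - te). Dividing
    by 2t gives a function with value g'(b) at the centre and no zero if g'(b) is nonzero, and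
    [center_bound] for its reciprocal yields a lower bound on |g'(b)| independent of [b]. If g'(a) =
    0, continuity of g' violates it. *)
Lemma injective_deriv_neq0 (g : V -> C) (a : V) (r : R) : 0 < r ->
  (forall y, rn (y - a) < r -> differentiable g y) ->
  (forall y y', rn (y - a) < r -> rn (y' - a) < r -> g y = g y' -> y = y') ->
  'd g a (const_mx 1) != 0.
Proof.
set e : V := const_mx 1.
move=> r0 dg ginj; apply/eqP => Da0.
have e0 : e != 0 by apply/eqP => /rowP/(_ 0); rewrite !mxE => /eqP; rewrite oner_eq0.
have re : rn e <= 1 by apply: rn_rV_le => // j; rewrite mxE normc1.
have re0 : 0 <= rn e := rn_ge0 e.
have [r' [M [r'r B]]] := bounded_holo_ex r0 dg.
have M0 := bounded_holo_ge0 B; have r'0 : 0 < r' by case: B.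
have BD := bounded_holo_deriv e B.
pose rho := r' / 16; have rho0 : 0 < rho by rewrite divr_gt0.
have wq := wf_sq (0 : C) (ltW rho0).
have te (t : C) : in_rect (sq 0 rho) t -> rn (t *: e) <= r' / 8.
  move=> /in_sq_le; rewrite subr0 rnZ /rho => h; have := normc_ge0 t.
  by move: h re re0 r'0; clear; nra.
have inb b (t : C) : rn (b - a) < r' / 2 -> in_rect (sq 0 rho) t ->
    rn (b + t *: e - a) < r' /\ rn (b - t *: e - a) < r'.
  move=> ba /te h; split; rewrite addrAC.
    by apply: le_lt_trans (rnD _ _) _; move: h ba r'0; clear; lra.
  by apply: le_lt_trans (rnB _ _) _; move: h ba r'0; clear; lra.
pose F b (t : C) : C := g (b + t *: e) - g (b - t *: e).
have dF b (t : C) : rn (b - a) < r' / 2 -> in_rect (sq 0 rho) t -> differentiable (F b) t.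
  move=> ba tq; have [h1 h2] := inb b t ba tq; apply: dfC_B.
    apply: (@df_comp _ _ _ _ (fun t : C => b + t *: e) g); first exact: df_line.
    by apply: dg; apply: lt_le_trans r'r.
  have -> : (fun y : C => g (b - y *: e)) = (fun y : C => g (b + y *: (- e))).
    by apply/funext => y; rewrite scalerN.
  apply: (@df_comp _ _ _ _ (fun t : C => b + t *: (- e)) g); first exact: df_line.
  by apply: dg; rewrite scalerN; apply: lt_le_trans r'r.
have F0 b (t : C) : rn (b - a) < r' / 2 -> in_rect (sq 0 rho) t -> t != 0 -> F b t != 0.
  move=> ba tq t0; have [h1 h2] := inb b t ba tq; rewrite subr_eq0; apply/eqP => H.
  have := ginj _ _ (lt_le_trans h1 r'r) (lt_le_trans h2 r'r) H.
  move=> /addrI /eqP; rewrite -subr_eq0 opprK -scalerDl scaler_eq0 (negbTE e0) orbF.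
  by rewrite -mulr2n mulrn_eq0 (negbTE t0).
have aa : rn (a - a) < r' / 2 by rewrite subrr rn0 divr_gt0.
have bd0 t : on_bd (sq (0 : C) rho) t -> in_rect (sq 0 rho) t /\ t != 0.
  by move=> tb; split; [case/andP: tb|exact: on_bd_sq_neq tb].
have [m m0 mP] : exists2 m : R, 0 < m & forall t, on_bd (sq 0 rho) t -> m <= normc (F a t).
  apply: (bd_lower wq).
    by apply: bd_df => t /bd0[tq _]; exact: dF.
  by move=> t /bd0[tq t0]; exact: F0.
pose L := 64 * M / r'.
have L0 : 0 <= L by rewrite divr_ge0 ?mulr_ge0 // ltW.
have L1 : 0 < L + 1 by rewrite ltr_wpDl.
have lip x b : rn (x - a) <= r' / 8 -> rn (b - a) <= r' / 32 ->
    normc (g (b + (x - a)) - g x) <= L * rn (b - a).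
  move=> xa ba; have Bx : bounded_holo g x (r' / 2) M.
    by apply: bounded_holo_sub B _ _; move: xa r'0; clear; lra.
  have ex : b + (x - a) - x = b - a by apply/rowP => j; rewrite !mxE; ring.
  have := holo_lipschitz (y := b + (x - a)) Bx; rewrite ex => H.
  apply: le_trans (H _) _; first by move: ba r'0; clear; lra.
  by rewrite /L le_eqVlt; apply/orP; left; apply/eqP; field; rewrite gt_eqF.
(* This is the lower bound for g'(b) that [center_bound] will produce: the reciprocal of
   [4 * (8 * rho / m)]. *)
pose c := m / (32 * rho).
have c0 : 0 < c by rewrite divr_gt0 // mulr_gt0.
have /continuous_rn/(_ c c0)[d1 d10 d1P] : {for a, continuous (fun y => 'd g y e : C)}.
  by have [_ H] := BD; apply: df_continuous; apply: (H a aa).1.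
pose d := Num.min d1 (Num.min (r' / 32) (m / (4 * (L + 1)))).
have d0 : 0 < d by rewrite !lt_min d10 !divr_gt0 // mulr_gt0.
have dd1 : d <= d1 by rewrite ge_min lexx.
have dr : d <= r' / 32 by rewrite !ge_min lexx orbT.
have dm : d <= m / (4 * (L + 1)) by rewrite !ge_min lexx !orbT.
(* If the derivative vanished at all nearby points, [g] would be constant on a segment, against
   injectivity. *)
have [b [ba Db]] : exists b, rn (b - a) < d /\ 'd g b e != 0.
  apply: contrapT => no.
  have Z b : rn (b - a) < d -> 'd g b e = 0.
    by move=> ba; apply/eqP; apply/negPn/negP => h; apply: no; exists b.
  pose s := d / 2; have s0 : 0 < s by rewrite divr_gt0.
  pose u x := g (a + (x%:C : C) *: e).
  have sm x : 0 <= x -> x <= s -> rn (a + (x%:C : C) *: e - a) <= s.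
    move=> x0 xs; rewrite addrAC subrr add0r rnZ normc_real ger0_norm //.
    by move: x0 xs re re0; clear; nra.
  have := @subdivision_bound _ C u s 0 (128 * M * (rn e / (r' / 2)) ^+ 2) (ltW s0).
  rewrite mul0r => H; have {}H : rn (u s - u 0) <= 0.
    apply: H => x y x0 xy ys; rewrite mul0r add0r.
    have xs : x <= s by exact: le_trans ys.
    have sma := sm x x0 xs.
    have Bx : bounded_holo g (a + (x%:C : C) *: e) (r' / 2) M.
      apply: bounded_holo_sub B _ _; first by rewrite divr_gt0.
      by move: sma dr r'0; rewrite /s; clear; lra.
    have yx : 0 <= y - x by rewrite subr_ge0.
    have nyx : rn ((y - x)%:C *: e) = (y - x) * rn e by rewrite rnZ normc_real ger0_norm.
    have := cauchy2 (h := (y - x)%:C *: e) Bx; rewrite nyx.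
    have -> : a + x%:C *: e + (y - x)%:C *: e = a + y%:C *: e.
      by rewrite -addrA -scalerDl -rmorphD /= [x + _]addrC subrK.
    have -> : 'd g (a + x%:C *: e) ((y - x)%:C *: e) = 0.
      have Zx : 'd g (a + x%:C *: e) e = 0.
        by apply: Z; apply: le_lt_trans sma _; rewrite /s; move: d0; clear; lra.
      by rewrite linearZ Zx; exact: scaler0.
    rewrite subr0 rnC => H; apply: le_trans (H _) _.
      have : y - x <= s by move: ys x0; clear; lra.
      by rewrite /s; move: yx dr re re0 r'0; clear; nra.
    by rewrite le_eqVlt; apply/orP; left; apply/eqP; rewrite mulrAC exprMn; ring.
  have : u s - u 0 = 0 by apply: rn_eq0; apply/eqP; rewrite eq_le H rn_ge0.
  move=> /eqP; rewrite subr_eq0 /u scale0r addr0 => /eqP /ginj.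
  have sr : s < r by move: dr d0 r'r r'0; rewrite /s; clear; lra.
  rewrite subrr rn0 => /(_ (le_lt_trans (sm s (ltW s0) (lexx _)) sr) r0) /eqP.
  rewrite -subr_eq0 addrAC subrr add0r scaler_eq0 (negbTE e0) orbF.
  by rewrite -normc_gt0 || idtac; move=> /eqP[] /eqP; rewrite gt_eqF.
have br : rn (b - a) < r' / 2 by move: ba dr r'0; clear; lra.
have b32 : rn (b - a) <= r' / 32 by move: ba dr; clear; lra.
have Fb t : on_bd (sq 0 rho) t -> m / 2 <= normc (F b t).
  move=> tb; have [tq t0] := bd0 t tb; have h := te t tq.
  have h1 := lip (a + t *: e) b; have h2 := lip (a - t *: e) b.
  move: h1 h2; rewrite ![a + _ - a]addrAC !subrr !add0r rnN.
  move=> /(_ h b32) h1 /(_ h b32) h2; have h3 := mP t tb.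
  have h4 := normcD (F a t - F b t) (F b t); rewrite subrK in h4.
  have h5 : normc (F a t - F b t) <= 2 * (L * rn (b - a)).
    rewrite normcBC; have -> : F b t - F a t = (g (b + t *: e) - g (a + t *: e)) - (g (b - t *: e) - g (a - t *: e)).
      by rewrite /F; move: (g _) (g _) (g _) (g _) => A1 A2 A3 A4; ring.
    apply: le_trans (normcB _ _) _; rewrite mulr_natl mulr2n; exact: lerD.
  have h6 : L * rn (b - a) <= m / 4.
    move: dm ba; rewrite ler_pdivlMr ?mulr_gt0 //.
    by move: (rn_ge0 (b - a)) L0 d0; move: (rn (b - a)) (L) (d) => x y z; clear; nra.
  by move: h3 h4 h5 h6; clear; lra.
(* The singularity at 0 is removable, with value the derivative at [b]; only continuity is needed
   there, by the form of [center_bound]. *)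
pose k (t : C) : C := if t == 0 then 'd g b e else F b t / (2 * t).
have two0 : (2 : C) != 0 by rewrite pnatr_eq0.
have t20 (t : C) : t != 0 -> 2 * t != 0 by move=> t0; exact: mulf_neq0.
have k0 t : in_rect (sq 0 rho) t -> k t != 0.
  rewrite /k; case: (eqVneq t 0) => [_ _|t0 tq]; first exact: Db.
  by apply: mulf_neq0; [exact: F0|rewrite invr_eq0; exact: t20].
have dk t : in_rect (sq 0 rho) t -> t != 0 -> differentiable k t.
  move=> tq t0; apply: (@near_eq_df _ _ _ (fun t : C => F b t / (2 * t)) _ _ (normc t)).
  - by rewrite normc_gt0.
  - move=> y yt; rewrite /k; case: (eqVneq y 0) yt => // ->.
    by rewrite rnC sub0r normcN ltxx.
  - apply: dfC_M; first exact: dF.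
    by apply: dfC_V; [apply: dfC_M; [exact: dfC_cst|exact: df_id]|exact: t20].
have ck : {for 0, continuous k}.
  have Bb : bounded_holo g b (r' / 2) M.
    by apply: bounded_holo_sub B _ _; move: br r'0; clear; lra.
  pose K := 128 * M * (2 / r') ^+ 2.
  have K0 : 0 <= K by rewrite mulr_ge0 ?sqr_ge0 // mulr_ge0.
  have K1 : 0 < K + 1 by rewrite ltr_wpDl.
  apply/continuous_rn => x x0.
  exists (Num.min (r' / 16) (x / (K + 1))); first by rewrite lt_min !divr_gt0.
  move=> t; rewrite !rnC subr0 lt_min => /andP[t1]; rewrite ltr_pdivlMr // => t2.
  rewrite /k eqxx; case: (eqVneq t 0) => [_|t0]; first by rewrite subrr normc0.
  have nt : rn (t *: e) <= normc t by rewrite rnZ ler_piMr // normc_ge0.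
  have nt0 := normc_ge0 t.
  have h1 := cauchy2 (h := t *: e) Bb; have h2 := cauchy2 (h := - (t *: e)) Bb.
  move: h1 h2; rewrite rnN linearN /=.
  have le8 : rn (t *: e) <= r' / 2 / 8 by move: nt t1; clear; lra.
  move=> /(_ le8) h1 /(_ le8) h2.
  have bnd : 128 * M * (rn (t *: e) / (r' / 2)) ^+ 2 <= K * normc t ^+ 2.
    rewrite [leLHS](_ : _ = K * rn (t *: e) ^+ 2); last by rewrite /K; field; rewrite gt_eqF.
    by rewrite ler_wpM2l // lerXn2r // ?nnegrE ?rn_ge0.
  have -> : F b t / (2 * t) - 'd g b e = (F b t - 2 * 'd g b (t *: e)) / (2 * t).
    have -> : 'd g b (t *: e) = t * 'd g b e by rewrite linearZ.
    by move: ('d g b e) (F b t) => A1 A2; field; rewrite t0.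
  rewrite normcM normcV normcM normc_nat ltr_pdivrMr; last first.
    by rewrite mulr_gt0 // normc_gt0.
  have -> : F b t - 2 * 'd g b (t *: e) = (g (b + t *: e) - g b - 'd g b (t *: e))
     - (g (b - t *: e) - g b - - 'd g b (t *: e)).
    by rewrite /F; move: ('d g b (t *: e)) (g _) (g _) (g _) => A1 A2 A3 A4; ring.
  apply: le_lt_trans (normcB _ _) _.
  apply: le_lt_trans (lerD (le_trans h1 bnd) (le_trans h2 bnd)) _.
  have nt1 : 0 < normc t by rewrite normc_gt0.
  by move: t2 K0 nt1; move: (normc t) (K) => A1 A2; clear; nra.
have in0 : in_rect (sq 0 rho) (0 : C) by apply: in_sq; rewrite subrr normc0 ltW.
have := @center_bound _ (fun t => (k t)^-1) 0 rho (8 * rho / m) rho0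
  (fun t tq t0 => dfC_V (dk t tq t0) (k0 t tq)) (continuous_inv ck (k0 0 in0)) => H.
have {}H : normc (k 0)^-1 <= 4 * (8 * rho / m).
  apply: H => t tb; have [tq t0] := bd0 t tb; have := Fb t tb => h.
  have t2 := in_sq_le tq; rewrite subr0 in t2.
  rewrite /k (negbTE t0) invf_div normcM normcV normcM normc_nat.
  rewrite ler_pdivrMr ?normc_gt0 ?F0 //.
  have h' : 8 * rho / m * (m / 2) <= 8 * rho / m * normc (F b t).
    by rewrite ler_wpM2l // divr_ge0 ?mulr_ge0 // ltW.
  apply: le_trans h'; have -> : 8 * rho / m * (m / 2) = 4 * rho by field; rewrite gt_eqF.
  by move: t2; clear; lra.
have aux (x y : C) : y = 0 -> normc x <= rn (x - y) by move=> ->; rewrite rnC subr0.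
have Dc : normc ('d g b e) < c := le_lt_trans (aux _ _ Da0) (d1P b (lt_le_trans ba dd1)).
move: H; rewrite normcV /k eqxx invf_ple ?posrE ?normc_gt0 //; last first.
  by rewrite mulr_gt0 // divr_gt0 // mulr_gt0.
have -> : (4 * (8 * rho / m))^-1 = c by rewrite /c; field; rewrite !gt_eqF.
by rewrite leNgt Dc.
Qed.

End OneVariable.

(** * The Jacobian determinant and points of zero derivative *)

Section JacobianDet.
Variables (R : realType) (n : nat).
Local Notation C := (R[i]^o).
Local Notation V := 'rV[R[i]]_n.

Lemma df_deriv (g : V -> C) (a v : V) (r : R) : 0 < r ->
  (forall y, rn (y - a) < r -> differentiable g y) ->
  differentiable (fun y => 'd g y v : C) a.
Proof.
move=> r0 dg; have [r' [M [_ B]]] := bounded_holo_ex r0 dg.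
have [r'0 H] := bounded_holo_deriv v B.
by apply: (H a _).1; rewrite subrr rn0.
Qed.

Lemma df_det (f : V -> V) (a : V) (r : R) : 0 < r ->
  (forall y, rn (y - a) < r -> differentiable f y) ->
  differentiable (fun y => \det (lin1_mx ('d f y)) : C) a.
Proof.
move=> r0 df; rewrite /determinant.
apply: dfC_sum => s _; apply: dfC_M; first exact: dfC_cst.
apply: dfC_prod => i _.
have entry j : differentiable (fun y => lin1_mx ('d f y) i j : C) a; last exact: entry.
apply: (@near_eq_df R V C (fun y => 'd (fun x => f x 0 j : C) y (delta_mx 0 i) : C)
  (fun y => lin1_mx ('d f y) i j : C) a r r0).
  by move=> y yr; rewrite mxE; exact: (df_coord _ (df y yr)).2.
by apply: (df_deriv _ r0) => y yr; exact: (df_coord _ (df y yr)).1.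
Qed.

(** With no linear term at [y], [cauchy2] leaves a quadratic bound; its uniformity in [y] is what
    allows summation along a curve of such points. *)
Lemma flat_quadratic m (f : V -> 'rV[R[i]]_m) (p : V) (r : R) : 0 < r ->
  (forall y, rn (y - p) < r -> differentiable f y) ->
  exists K d : R, [/\ 0 <= K, 0 < d & forall y y', rn (y - p) < d -> rn (y' - p) < d ->
    (forall h, 'd f y h = 0) -> rn (f y' - f y) <= K * rn (y' - y) ^+ 2].
Proof.
move=> r0 df.
have /choice[F FP] : forall j, exists Kd : R * R, [/\ 0 <= Kd.1, 0 < Kd.2 &
    forall y y', rn (y - p) < Kd.2 -> rn (y' - p) < Kd.2 ->
    (forall h, 'd f y h = 0) -> normc (f y' 0 j - f y 0 j) <= Kd.1 * rn (y' - y) ^+ 2].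
  move=> j.
  have [r' [M [r'r B]]] := bounded_holo_ex r0 (fun y yr => (df_coord j (df y yr)).1).
  have M0 := bounded_holo_ge0 B; have r'0 : 0 < r' by case: B.
  exists (128 * M * (2 / r') ^+ 2, r' / 32); split => /=.
  - by apply: mulr_ge0; [exact: mulr_ge0|exact: sqr_ge0].
  - by rewrite divr_gt0.
  move=> y y' yp y'p d0.
  have By : bounded_holo (fun x => f x 0 j : C) y (r' / 2) M.
    by apply: bounded_holo_sub B _ _; move: yp r'0; clear; lra.
  have yr : rn (y - p) < r by move: yp r'r r'0; clear; lra.
  have h8 : rn (y' - y) <= r' / 2 / 8.
    by have := rn_dist p y' y; rewrite (rnBC p y); move: yp y'p r'0; clear; lra.
  have ey : y + (y' - y) = y' by rewrite addrC; exact: subrK.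
  have H := cauchy2 By h8; rewrite ey in H.
  have D0 : 'd (fun x => f x 0 j : C) y (y' - y) = 0.
    by apply: etrans ((df_coord j (df y yr)).2 _) _; rewrite d0 mxE.
  rewrite D0 subr0 in H; apply: le_trans H _.
  by rewrite le_eqVlt; apply/orP; left; apply/eqP; field; rewrite gt_eqF.
pose K := \sum_j (F j).1; pose D := \big[Num.min/1]_j (F j).2.
have K0 : 0 <= K by apply: sumr_ge0 => j _; have [] := FP j.
have D0 : 0 < D.
  apply: (big_ind (fun x => 0 < x)) => // [x y x0 y0|j _]; first by rewrite lt_min x0.
  by have [] := FP j.
have Dj j : D <= (F j).2 by rewrite /D (bigD1 j) //= ge_min lexx.
have Kj j : (F j).1 <= K.
  by rewrite /K (bigD1 j) //= lerDl; apply: sumr_ge0 => i _; have [] := FP i.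
exists K, D; split => // y y' yD y'D d0; apply: rn_rV_le.
  by rewrite mulr_ge0 // sqr_ge0.
move=> j; have [_ _ H] := FP j; rewrite !mxE.
apply: le_trans (H y y' (lt_le_trans yD (Dj j)) (lt_le_trans y'D (Dj j)) d0) _.
by rewrite ler_wpM2r ?sqr_ge0.
Qed.

Lemma line_not_flat m (f : V -> 'rV[R[i]]_m) (a e : V) (r : R) : 0 < r -> e != 0 ->
  (forall y, rn (y - a) < r -> differentiable f y) ->
  (forall y y', rn (y - a) < r -> rn (y' - a) < r -> f y = f y' -> y = y') ->
  (forall y, rn (y - a) < r -> forall h, 'd f y h = 0) -> False.
Proof.
move=> r0 e0 df finj d0; have re := rn_gt0 e0.
have [K [d [K0 d'0 H]]] := flat_quadratic r0 df.
pose s := Num.min d r / (2 * rn e).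
have dr : 0 < Num.min d r by rewrite lt_min d'0.
have s0 : 0 < s by rewrite divr_gt0 // mulr_gt0.
have sE : s * rn e = Num.min d r / 2 by rewrite /s; field; rewrite gt_eqF.
have sm x : 0 <= x -> x <= s -> rn (a + (x%:C : C) *: e - a) < Num.min d r.
  move=> x0 xs; rewrite addrAC subrr add0r rnZ normc_real ger0_norm //.
  by move: xs sE re dr; move: (Num.min d r) => q; clear; nra.
have smd x : 0 <= x -> x <= s -> rn (a + (x%:C : C) *: e - a) < d.
  by move=> x0 xs; have := sm x x0 xs; rewrite lt_min => /andP[].
have smr x : 0 <= x -> x <= s -> rn (a + (x%:C : C) *: e - a) < r.
  by move=> x0 xs; have := sm x x0 xs; rewrite lt_min => /andP[].
have := @subdivision_bound _ _ (fun x => f (a + (x%:C : C) *: e)) s 0 (K * rn e ^+ 2) (ltW s0).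
rewrite mul0r => S; have {}S : rn (f (a + (s%:C : C) *: e) - f (a + ((0 : R)%:C : C) *: e)) <= 0.
  apply: S => x y x0 xy ys; rewrite mul0r add0r.
  have xs := le_trans xy ys; have y0 := le_trans x0 xy.
  apply: le_trans (H _ _ (smd x x0 xs) (smd y y0 ys) (d0 _ (smr x x0 xs))) _.
  have -> : a + y%:C *: e - (a + x%:C *: e) = ((y - x)%:C : C) *: e.
    by rewrite opprD addrACA subrr add0r -scalerBl -rmorphB.
  rewrite rnZ normc_real ger0_norm ?subr_ge0 // exprMn.
  by rewrite le_eqVlt; apply/orP; left; apply/eqP; ring.
have : f (a + (s%:C : C) *: e) - f (a + ((0 : R)%:C : C) *: e) = 0.
  by apply: rn_eq0; apply/eqP; rewrite eq_le S rn_ge0.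
move=> /eqP; rewrite subr_eq0 => /eqP /finj.
move=> /(_ (smr s (ltW s0) (lexx _)) (smr 0 (lexx _) (ltW s0))) /addrI /eqP.
rewrite -subr_eq0 -scalerBl scaler_eq0 (negbTE e0) orbF subr_eq0 => /eqP /complexI h.
by move: s0; rewrite h ltxx.
Qed.

End JacobianDet.

Section OsgoodFlat.
Variables (R : realType) (m : nat).
Local Notation C := (R[i]^o).
Local Notation V := 'rV[R[i]]_(m.+2).

(** A second direction exists only in dimension at least two, hence the type with [m.+2] and the
    separate treatment of dimension one. *)
Lemma transversal (v : V) : v != 0 ->
  exists w : V, forall (s c : C), s *: w = c *: v -> s = 0.
Proof.
move=> v0; have /existsP[i vi] : [exists i, v 0 i != 0].
  apply: contraNT v0; rewrite negb_exists => /forallP h; apply/eqP/rowP => i.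
  by rewrite mxE; apply/eqP; move: (h i); rewrite negbK.
have [j ji] : exists j : 'I_m.+2, j != i.
  by case: (eqVneq i ord0) => [->|h]; [exists (lift ord0 ord0)|exists ord0; rewrite eq_sym].
exists (delta_mx 0 j) => s c /rowP E.
have := E i; rewrite !mxE eqxx eq_sym (negbTE ji) /= mulr0 => /esym/eqP.
rewrite mulf_eq0 (negbTE vi) orbF => /eqP c0.
by have := E j; rewrite !mxE !eqxx /= c0 mul0r mulr1.
Qed.

(** Since [g] vanishes on the singular set but has nonzero derivative along [v], the determinant has
    an isolated zero on the line through [p]. By [hurwitz] it has a zero z(s) on each parallel line
    displaced by s w. The points z(s) vary in a Lipschitz way and [f] has zero derivative at each of
    them, so f(z(s)) is constant, contradicting injectivity. *)
Lemma singular_set_no_curve (f : V -> V) (g : V -> C) (p v : V) (r : R) : 0 < r ->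
  (forall y, rn (y - p) < r -> differentiable f y) ->
  (forall y y', rn (y - p) < r -> rn (y' - p) < r -> f y = f y' -> y = y') ->
  (forall y, rn (y - p) < r -> \det (lin1_mx ('d f y)) = 0 -> forall h, 'd f y h = 0) ->
  \det (lin1_mx ('d f p)) = 0 ->
  (forall y, rn (y - p) < r -> differentiable g y) ->
  (forall y, rn (y - p) < r -> \det (lin1_mx ('d f y)) = 0 -> g y = 0) ->
  'd g p v != 0 -> False.
Proof.
move=> r0 df finj dfl hp dg gZ dgv.
pose h y : C := \det (lin1_mx ('d f y)).
have dh y : rn (y - p) < r -> differentiable h y.
  move=> yp; apply: (@df_det _ _ f y (r - rn (y - p))); first by rewrite subr_gt0.
  move=> x xy; apply: df; apply: le_lt_trans (rn_dist y _ _) _.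
  by move: xy; clear; lra.
have [r2 [M [r2r B]]] := bounded_holo_ex r0 dh; have r20 : 0 < r2 by case: B.
have [Kg [d_g [Kg0 dg0 gS]]] := strict_diff r0 dg.
have [Kf [d_f [Kf0 df0 fF]]] := flat_quadratic r0 df.
have v0 : v != 0 by apply: contraNneq dgv => ->; rewrite linear0.
have rv := rn_gt0 v0.
pose al := normc ('d g p v); have al0 : 0 < al by rewrite normc_gt0.
have [w wP] := transversal v0.
pose be := normc ('d g p w); have be0 : 0 <= be := normc_ge0 _.
have rw : 0 <= rn w := rn_ge0 w.
(* With this tolerance the error of linearising [g] along [v] is at most half of [al], the size of
   its derivative there. *)
pose eta := al / (2 * rn v); have eta0 : 0 < eta by rewrite divr_gt0 // mulr_gt0.
pose d3 := Num.min (Num.min (d_g / 2) (d_f / 2)) (Num.min (r2 / 2) (eta / (2 * (Kg + 1)))).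
have Kg1 : 0 < Kg + 1 by rewrite ltr_wpDl.
have d30 : 0 < d3 by rewrite !lt_min !divr_gt0 // mulr_gt0.
have d3g : d3 <= d_g / 2 by rewrite !ge_min lexx.
have d3f : d3 <= d_f / 2 by rewrite !ge_min lexx !orbT.
have d3r : d3 <= r2 / 2 by rewrite !ge_min lexx !orbT.
have d3e : 2 * (Kg + 1) * d3 <= eta.
  have : d3 <= eta / (2 * (Kg + 1)) by rewrite !ge_min lexx !orbT.
  by rewrite ler_pdivlMr ?mulr_gt0 // mulrC.
have gS' y y' : rn (y - p) <= d3 -> rn (y' - p) <= d3 ->
    normc (g y - g y' - 'd g p (y - y')) <= eta * rn (y - y').
  move=> yp y'p; apply: le_trans (gS y y' _ _) _.
  - by move: yp d3g dg0; clear; lra.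
  - by move: y'p d3g dg0; clear; lra.
  apply: ler_wpM2r; first exact: rn_ge0.
  move: yp y'p d3e Kg0 (rn_ge0 (y - p)) (rn_ge0 (y' - p)).
  by move: (rn (y - p)) (rn (y' - p)) => A1 A2; clear; nra.
have gp : g p = 0 by apply: gZ => //; rewrite subrr rn0.
pose rho := d3 / (4 * rn v); have rho0 : 0 < rho by rewrite divr_gt0 // mulr_gt0.
have rhoE : 2 * rho * rn v = d3 / 2 by rewrite /rho; field; rewrite gt_eqF.
have gv (t : C) : in_rect (sq 0 rho) t -> t != 0 -> g (p + t *: v) != 0.
  move=> /in_sq_le; rewrite subr0 => t2 t0; apply/eqP => gt.
  have nt : 0 < normc t by rewrite normc_gt0.
  have ntv : rn (p + t *: v - p) <= d3.
    rewrite addrAC subrr add0r rnZ.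
    by move: rhoE t2 rv d30; clear; nra.
  have pp : rn (p - p) <= d3 by rewrite subrr rn0 ltW.
  have := gS' _ _ ntv pp; rewrite gt gp subrr sub0r normcN.
  have -> : p + t *: v - p = t *: v by rewrite addrAC subrr add0r.
  have -> : normc ('d g p (t *: v)) = normc t * al by rewrite linearZ normcM.
  rewrite rnZ mulrCA ler_pM2l //.
  have -> : eta * rn v = al / 2 by rewrite /eta; field; rewrite gt_eqF.
  by move: al0; clear; lra.
have U2 (y : V) : rn (y - p) <= d3 -> rn (y - p) < r.
  by move: d3r r2r r20; clear; lra.
have [d_h dh0 hz] : exists2 d : R, 0 < d & forall z, rn (z - p) < d ->
    exists t : C, in_rect (sq 0 rho) t /\ h (z + t *: v) = 0.
  apply: (hurwitz B rho0) => //.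
    by rewrite rhoE; move: d3r d30; clear; lra.
  move=> t tb; apply/eqP => ht.
  have tq : in_rect (sq 0 rho) t by case/andP: tb.
  have t0 := on_bd_sq_neq rho0 tb.
  have := gv t tq t0; rewrite gZ ?eqxx //; apply: U2.
  move: (in_sq_le tq); rewrite subr0 addrAC subrr add0r rnZ => t2.
  by move: rhoE t2 rv d30; clear; nra.
have rw1 : 0 < rn w + 1 by rewrite ltr_wpDl.
pose s0 := Num.min (d_h / 2) (d3 / 2) / (rn w + 1).
have md : 0 < Num.min (d_h / 2) (d3 / 2) by rewrite lt_min !divr_gt0.
have s00 : 0 < s0 by rewrite divr_gt0.
have sw s : 0 <= s -> s <= s0 -> s * rn w <= Num.min (d_h / 2) (d3 / 2).
  move=> s1 s2; have : s0 * (rn w + 1) = Num.min (d_h / 2) (d3 / 2).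
    by rewrite /s0 divfK // gt_eqF.
  by move: s1 s2 rw s00; move: (Num.min _ _) => q; clear; nra.
(* The parameters are picked by choice, with no regularity; the Lipschitz estimate [zt] is recovered
   afterwards from [g (z s) = 0]. *)
have /choice[t tP] : forall s : R, exists t : C, 0 <= s -> s <= s0 ->
    in_rect (sq 0 rho) t /\ h (p + (s%:C : C) *: w + t *: v) = 0.
  move=> s; have [s1|] := boolP (0 <= s); last by exists 0.
  have [s2|] := boolP (s <= s0); last by exists 0.
  have [] := hz (p + (s%:C : C) *: w).
    rewrite addrAC subrr add0r rnZ normc_real ger0_norm //.
    have := sw s s1 s2; rewrite le_min => /andP[h1 _].
    by move: h1 dh0; clear; lra.
  by move=> t tP; exists t.
pose z s := p + (s%:C : C) *: w + t s *: v.
have zp s : 0 <= s -> s <= s0 -> rn (z s - p) <= d3.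
  move=> s1 s2; have -> : z s - p = (s%:C : C) *: w + t s *: v.
    by rewrite /z; apply/rowP => j; rewrite !mxE; ring.
  apply: le_trans (rnD _ _) _; rewrite !rnZ normc_real ger0_norm //.
  have := sw s s1 s2; rewrite le_min => /andP[_ h1].
  have [tq _] := tP s s1 s2; have := in_sq_le tq; rewrite subr0 => t2.
  by move: rhoE t2 h1 rv; clear; nra.
have zh s : 0 <= s -> s <= s0 -> h (z s) = 0.
  by move=> s1 s2; have [] := tP s s1 s2.
have zg s : 0 <= s -> s <= s0 -> g (z s) = 0.
  by move=> s1 s2; apply: gZ; [exact/U2/zp|exact: zh].
have zB x y : z y - z x = ((y - x)%:C : C) *: w + (t y - t x) *: v.
  by rewrite /z rmorphB /= !scalerBl; apply/rowP => j; rewrite !mxE; ring.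
pose Ct := 2 * (be + eta * rn w) / al.
have Ct0 : 0 <= Ct.
  apply: divr_ge0; last exact: ltW.
  by apply: mulr_ge0 => //; apply: addr_ge0 => //; apply: mulr_ge0 => //; exact: ltW.
(* Both points are zeros of [g], so the linear part of its increment is absorbed by the error: the
   derivative along [v] controls [t y - t x] by [y - x]. *)
have zt x y : 0 <= x -> x <= y -> y <= s0 -> normc (t y - t x) <= Ct * (y - x).
  move=> x0 xy ys; have xs := le_trans xy ys; have y0 := le_trans x0 xy.
  have yx : 0 <= y - x by rewrite subr_ge0.
  have := gS' _ _ (zp y y0 ys) (zp x x0 xs); rewrite zg // zg // subrr sub0r normcN zB.
  have n1 : normc ((y - x)%:C : C) = y - x by rewrite normc_real ger0_norm.
  have nw : normc ('d g p (((y - x)%:C : C) *: w)) = (y - x) * be by rewrite linearZ normcM n1.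
  have nv : normc ('d g p ((t y - t x) *: v)) = normc (t y - t x) * al by rewrite linearZ normcM.
  have H1 : normc ('d g p ((t y - t x) *: v)) <=
     normc ('d g p (((y - x)%:C : C) *: w + (t y - t x) *: v)) + normc ('d g p (((y - x)%:C : C) *: w)).
    rewrite linearD /=; set A1 := 'd g p _; set A2 := 'd g p _.
    by have := normcB (A2 + A1) A2; rewrite addrAC subrr add0r.
  rewrite nw nv in H1; move=> H2.
  have H3 := rnD (((y - x)%:C : C) *: w) ((t y - t x) *: v); rewrite !rnZ n1 in H3.
  have H4 : eta * rn (((y - x)%:C : C) *: w + (t y - t x) *: v) <=
     eta * ((y - x) * rn w + normc (t y - t x) * rn v) by rewrite ler_wpM2l // ltW.
  have ev : eta * rn v = al / 2 by rewrite /eta; field; rewrite gt_eqF.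
  have eT : eta * ((y - x) * rn w + normc (t y - t x) * rn v) =
      eta * rn w * (y - x) + al / 2 * normc (t y - t x) by rewrite -ev; ring.
  rewrite eT in H4.
  rewrite -(ler_pM2r al0); have -> : Ct * (y - x) * al = 2 * (be + eta * rn w) * (y - x).
    by rewrite /Ct; field; rewrite gt_eqF.
  move: H1 (le_trans H2 H4); move: (normc (t y - t x)) (normc _) => A1 A2; clear; lra.
pose Cz := rn w + Ct * rn v.
have zl x y : 0 <= x -> x <= y -> y <= s0 -> rn (z y - z x) <= Cz * (y - x).
  move=> x0 xy ys; have yx : 0 <= y - x by rewrite subr_ge0.
  rewrite zB; apply: le_trans (rnD _ _) _; rewrite !rnZ normc_real ger0_norm // /Cz.
  have := ler_wpM2r (rn_ge0 v) (zt x y x0 xy ys).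
  by move: (normc _) (rn w) (rn v) (Ct) => A1 A2 A3 A4; clear; lra.
(* Zero derivative at [z x] and Lipschitz [z] make increments of [f] along the curve quadratic in
   the parameter, so the mean value inequality has slope 0. *)
have S := @subdivision_bound _ _ (fun s => f (z s)) s0 0 (Kf * Cz ^+ 2) (ltW s00).
have {}S : rn (f (z s0) - f (z 0)) <= 0.
  rewrite mul0r in S; apply: S => x y x0 xy ys; rewrite mul0r add0r.
  have xs := le_trans xy ys; have y0 := le_trans x0 xy.
  have zpx := zp x x0 xs; have zpy := zp y y0 ys.
  apply: le_trans (fF (z x) (z y) _ _ _) _.
  - by move: zpx d3f df0; clear; lra.
  - by move: zpy d3f df0; clear; lra.
  - by apply: dfl; [exact: U2|exact: zh].
  rewrite -mulrA -exprMn ler_wpM2l // lerXn2r ?nnegrE ?rn_ge0 //; last exact: zl.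
  by apply: le_trans (zl x y x0 xy ys); exact: rn_ge0.
have : f (z s0) - f (z 0) = 0 by apply: rn_eq0; apply/eqP; rewrite eq_le S rn_ge0.
move=> /eqP; rewrite subr_eq0 => /eqP /finj.
have l0 : (0 : R) <= 0 by []; have ls : 0 <= s0 := ltW s00.
move=> /(_ (U2 _ (zp s0 ls (lexx _))) (U2 _ (zp 0 l0 ls))) /eqP.
rewrite -subr_eq0 zB subr0 addr_eq0 -scaleNr => /eqP /wP /complexI e0.
by move: s00; rewrite e0 ltxx.
Qed.

(** [G] consists of the holomorphic functions vanishing on the singular set. By
    [singular_set_no_curve] it is closed under derivatives, and it contains the determinant, which
    therefore vanishes near [a]; then so does the derivative, which [line_not_flat] excludes. *)
Lemma osgood_flat (f : V -> V) (a : V) (r : R) : 0 < r ->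
  (forall y, rn (y - a) < r -> differentiable f y) ->
  (forall y y', rn (y - a) < r -> rn (y' - a) < r -> f y = f y' -> y = y') ->
  (forall y, rn (y - a) < r -> \det (lin1_mx ('d f y)) = 0 -> forall h, 'd f y h = 0) ->
  \det (lin1_mx ('d f a)) != 0.
Proof.
move=> r0 df finj dfl; apply/eqP => ha.
pose h y : C := \det (lin1_mx ('d f y)).
pose G := [set g : V -> C | (forall y, rn (y - a) < r -> differentiable g y) /\
  (forall y, rn (y - a) < r -> h y = 0 -> g y = 0)].
have sub y : rn (y - a) < r -> 0 < r - rn (y - a) /\
    forall x, rn (x - y) < r - rn (y - a) -> rn (x - a) < r.
  move=> ya; split; first by rewrite subr_gt0.
  by move=> x xy; apply: le_lt_trans (rn_dist y _ _) _; move: xy; clear; lra.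
have GP g : G g -> [/\ forall y, rn (y - a) < r -> differentiable g y,
    g a = 0 & forall v, G (fun y => 'd g y v)].
  move=> [dg gZ]; split => //; first by apply: gZ => //; rewrite subrr rn0.
  move=> v; split.
    move=> y ya; have [r1 s1] := sub y ya.
    by apply: (df_deriv _ r1) => x xy; apply/dg/s1.
  move=> y ya hy; apply: contrapT => /eqP ne; have [r1 s1] := sub y ya.
  apply: (@singular_set_no_curve f g y v _ r1) => //.
  - by move=> x xy; apply/df/s1.
  - by move=> x x' xy x'y; apply: finj; apply: s1.
  - by move=> x xy; apply/dfl/s1.
  - by move=> x xy; apply/dg/s1.
  - by move=> x xy; apply/gZ/s1.
have Gh : G h.
  split=> // y ya; have [r1 s1] := sub y ya.
  by apply: (df_det r1) => x xy; apply/df/s1.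
have [d d0 dP] := all_derivatives_zero r0 GP Gh.
have md : 0 < Num.min r d by rewrite lt_min r0.
have e0 : (delta_mx 0 ord0 : V) != 0.
  by apply/eqP => /rowP/(_ ord0); rewrite !mxE !eqxx => /eqP; rewrite oner_eq0.
apply: (line_not_flat md e0 (f := f) (a := a)).
- by move=> y; rewrite lt_min => /andP[yr _]; apply: df.
- by move=> y y'; rewrite !lt_min => /andP[yr _] /andP[y'r _]; apply: finj.
- by move=> y; rewrite lt_min => /andP[yr yd]; exact: (dfl y yr (dP y yd)).
Qed.

End OsgoodFlat.

(** * Induction on the dimension in Osgood's theorem *)

Section OsgoodTheorem.
Variable R : realType.
Local Notation C := (R[i]^o).

Lemma d_comp (U V W : normedModType R[i]) (f : U -> V) (g : V -> W) x h :
  differentiable f x -> differentiable g (f x) ->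
  'd (fun y => g (f y)) x h = 'd g (f x) ('d f x h).
Proof. by move=> df dg; exact: (congr1 (fun k => k h) (diff_comp df dg)). Qed.

Lemma df_affine n m (c : 'rV[R[i]]_m) (A : 'M[R[i]]_(n, m)) (z : 'rV[R[i]]_n) :
  differentiable (fun u => c + u *m A) z /\
  forall h, 'd (fun u : 'rV[R[i]]_n => c + u *m A) z h = h *m A.
Proof.
apply: df_rV_mx => e e0; exists 1 => // h _.
have -> : c + (z + h) *m A - (c + z *m A) - h *m A = 0.
  rewrite mulmxDl; move: (z *m A) (h *m A) => u v.
  by apply/rowP => j; rewrite !mxE; ring.
by rewrite rn0 mulr_ge0 ?rn_ge0 // ltW.
Qed.

(* After a linear change of coordinates the derivative of f at y is pid_mx q
   with 0 < q <= m; straightening the first component of f and restricting to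
   its zero level gives an injective map in dimension m with singular
   derivative. *)
Lemma osgood_slice m (f : 'rV[R[i]]_(1 + m) -> 'rV[R[i]]_(1 + m)) y (r : R) :
  (forall (g : 'rV[R[i]]_m -> 'rV[R[i]]_m) a s, 0 < s ->
    (forall x, rn (x - a) < s -> differentiable g x) ->
    (forall x x', rn (x - a) < s -> rn (x' - a) < s -> g x = g x' -> x = x') ->
    lin1_mx ('d g a) \in unitmx) ->
  0 < r ->
  (forall x, rn (x - y) < r -> differentiable f x) ->
  (forall x x', rn (x - y) < r -> rn (x' - y) < r -> f x = f x' -> x = x') ->
  \det (lin1_mx ('d f y)) = 0 -> forall h, 'd f y h = 0.
Proof.
move=> IH r0 df finj; set J := lin1_mx _ => dJ h; rewrite d_jacobian -/J.
suff -> : J = 0 by rewrite mulmx0.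
apply: contrapT => /eqP J0.
pose P := col_ebase J; pose Q := row_ebase J; pose q := \rank J.
have Pu : P \in unitmx := col_ebase_unit J.
have Qu : Q \in unitmx := row_ebase_unit J.
have JE : J = P *m pid_mx q *m Q by rewrite mulmx_ebase.
have q0 : (0 < q)%N by rewrite lt0n mxrank_eq0.
have qm : (q <= m)%N.
  have : (q <= 1 + m)%N := rank_leq_row J.
  rewrite leq_eqVlt => /orP[/eqP qe|//].
  have : J \in unitmx by rewrite -row_free_unit /row_free -/q qe.
  by rewrite unitmxE dJ unitr0.
pose P' := invmx P; pose Q' := invmx Q.
have P'u : P' \in unitmx by rewrite unitmx_inv.
have Q'u : Q' \in unitmx by rewrite unitmx_inv.
(* The invertible factors of the rank decomposition of [J] are undone, so that [F 0 = 0] and the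
   derivative at 0 is [pid_mx q]. *)
pose F (u : 'rV[R[i]]_(1 + m)) := - (f y *m Q') + f (y + u *m P') *m Q'.
have [c c0 cP] := mulmx_bound P'.
pose r1 := r / c; have r10 : 0 < r1 by rewrite divr_gt0.
have inr (u : 'rV[R[i]]_(1 + m)) : rn (u - 0) < r1 -> rn (y + u *m P' - y) < r.
  rewrite subr0 addrAC subrr add0r ltr_pdivlMr // => h1.
  by apply: le_lt_trans (cP u) _; rewrite mulrC.
have dF u : rn (u - 0) < r1 -> differentiable F u.
  move=> /inr h1.
  have d2 := (df_affine (- (f y *m Q')) Q' (f (y + u *m P'))).1.
  apply: (df_comp _ d2).
  exact: (df_comp (df_affine y P' u).1 (df _ h1)).
have Finj u u' : rn (u - 0) < r1 -> rn (u' - 0) < r1 -> F u = F u' -> u = u'.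
  move=> h1 h2 /addrI /(congr1 (mulmx^~ Q)); rewrite !mulmxKV // => /finj.
  move=> /(_ (inr u h1) (inr u' h2)) /addrI /(congr1 (mulmx^~ P)).
  by rewrite !mulmxKV.
have F00 : F 0 = 0 by rewrite /F mul0mx addr0 addNr.
have r00 : rn (0 - 0 : 'rV[R[i]]_(1 + m)) < r1 by rewrite subrr rn0.
have dF0 k : 'd F 0 k = k *m pid_mx q.
  have fy : y + 0 *m P' = y by rewrite mul0mx addr0.
  have dfy : differentiable f y by apply: df; rewrite subrr rn0.
  have dfy' : differentiable f (y + 0 *m P') by rewrite fy.
  have [a1 a2] := df_affine y P' 0.
  have [b1 b2] := df_affine (- (f y *m Q')) Q' (f (y + 0 *m P')).
  have e1 := d_comp k a1 dfy'.
  have e2 := d_comp k (df_comp a1 dfy') b1.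
  apply: etrans e2 _; apply: etrans (b2 _) _.
  have -> : 'd (fun x : 'rV[R[i]]_(1 + m) => f (y + x *m P')) 0 k = k *m P' *m J.
    apply: etrans e1 _; apply: etrans (d_jacobian _ _ _) _.
    have -> : lin1_mx ('d f (y + 0 *m P')) = J by rewrite /J; congr (lin1_mx ('d f _)).
    by congr (_ *m _); exact: a2.
  by rewrite JE -!mulmxA mulmxV // mulmx1 mulKmx.
(* [T] takes the first component of [F] as a new coordinate. As [0 < q], its derivative at 0 is the
   identity, and its local inverse [G] straightens the zero level of that component. *)
pose T (u : 'rV[R[i]]_(1 + m)) := row_mx (lsubmx (F u)) (rsubmx u) : 'rV[R[i]]_(1 + m).
have T0 : T 0 = 0 by rewrite /T F00 !linear0 row_mx0.
have dTj u : rn (u - 0) < r1 -> differentiable T u.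
  move=> h1; apply: df_rV => j; case: (split_ordP j) => i ->.
    have -> : (fun x => T x 0 (lshift m i) : C) = (fun x => F x 0 (lshift m i) : C).
      by apply/funext => x; rewrite /T row_mxEl mxE.
    exact: (df_coord _ (dF u h1)).1.
  have -> : (fun x => T x 0 (rshift 1 i) : C) = (fun x => x 0 (rshift 1 i) : C).
    by apply/funext => x; rewrite /T row_mxEr mxE.
  exact: (df_coord _ (df_id u)).1.
have did k j : 'd (fun x : 'rV[R[i]]_(1 + m) => x 0 j : C) 0 k = k 0 j.
  apply: etrans ((df_coord j (df_id 0)).2 k) _.
  suff -> : 'd (fun x : 'rV[R[i]]_(1 + m) => x) 0 k = k by [].
  have [_] := df_affine (0 : 'rV[R[i]]_(1 + m)) 1%:M 0.
  have -> : (fun u : 'rV[R[i]]_(1 + m) => 0 + u *m 1%:M) = (fun u => u).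
    by apply/funext => u; rewrite add0r mulmx1.
  by move=> ->; rewrite mulmx1.
have dT0 k : 'd T 0 k = k.
  have dT := dTj 0 r00.
  apply/rowP => j; rewrite -[LHS]((df_coord j dT).2 k).
  case: (split_ordP j) => i ->.
    have -> : (fun x => T x 0 (lshift m i) : C) = (fun x => F x 0 (lshift m i) : C).
      by apply/funext => x; rewrite /T row_mxEl mxE.
    apply: etrans ((df_coord _ (dF 0 r00)).2 k) _; rewrite dF0 mxE (bigD1 (lshift m i)) //=.
    rewrite !mxE /= eqxx ord1 /= q0 mulr1 big1 ?addr0 // => l li.
    rewrite mxE (_ : (nat_of_ord l == nat_of_ord (lshift m (0 : 'I_1))) = false) ?mulr0 //.
    by apply: contraNF li => /eqP e; apply/eqP/val_inj.
  have -> : (fun x => T x 0 (rshift 1 i) : C) = (fun x => x 0 (rshift 1 i) : C).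
    by apply/funext => x; rewrite /T row_mxEr mxE.
  exact: did.
have Tu : lin1_mx ('d T 0) \in unitmx.
  have -> : lin1_mx ('d T 0) = 1%:M.
    by apply/row_matrixP => i; rewrite rowE -d_jacobian dT0 rowE mulmx1.
  exact: unitmx1.
have [e [G [e0 G0 GP]]] := inverse_function r10 r10 dTj Tu.
rewrite T0 in G0 GP.
pose S (x : 'rV[R[i]]_m) := row_mx 0 x : 'rV[R[i]]_(1 + m).
have SE x : S x = 0 + x *m row_mx 0 1%:M by rewrite add0r mul_mx_row mulmx0 mulmx1.
have rS x : rn (S x) <= rn x.
  apply: rn_rV_le; first exact: rn_ge0.
  move=> j; case: (split_ordP j) => i ->; rewrite ?row_mxEl ?row_mxEr; first by rewrite mxE normc0 rn_ge0.
  exact: rn_coord.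
have S0 : S 0 = 0 by rewrite /S row_mx0.
pose H x := rsubmx (F (G (S x))) : 'rV[R[i]]_m.
have GS x : rn (x - 0) < e -> [/\ lsubmx (F (G (S x))) = 0, rsubmx (G (S x)) = x,
    rn (G (S x) - 0) < r1 & differentiable G (S x)].
  rewrite subr0 => xe; have [] := GP (S x); first by rewrite subr0; exact: le_lt_trans (rS x) xe.
  by rewrite /T /S => /eq_row_mx[h1 h2] h3 h4; split.
have dS x : differentiable S x.
  have -> : S = (fun x => 0 + x *m row_mx 0 1%:M) by apply/funext => z; exact: SE.
  exact: (df_affine _ _ _).1.
have dFG x : rn (x - 0) < e -> differentiable (fun x => F (G (S x))) x.
  by move=> xe; have [_ _ h3 h4] := GS x xe; exact: (df_comp (df_comp (dS x) h4) (dF _ h3)).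
have dH x : rn (x - 0) < e -> differentiable H x.
  move=> xe; apply: df_rV => j.
  have -> : (fun x => H x 0 j : C) = (fun x => F (G (S x)) 0 (rshift 1 j) : C).
    by apply/funext => z; rewrite /H mxE.
  exact: (df_coord _ (dFG x xe)).1.
have Hinj x x' : rn (x - 0) < e -> rn (x' - 0) < e -> H x = H x' -> x = x'.
  move=> xe x'e HE; have [h1 h2 h3 _] := GS x xe; have [h1' h2' h3' _] := GS x' x'e.
  suff : G (S x) = G (S x') by move=> E; rewrite -h2 -h2' E.
  apply: (Finj _ _ h3 h3').
  have E (u u' : 'rV[R[i]]_(1 + m)) : lsubmx u = lsubmx u' -> rsubmx u = rsubmx u' -> u = u'.
    by move=> l1 l2; rewrite -(hsubmxK u) -(hsubmxK u') l1 l2.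
  exact: E (etrans h1 (esym h1')) HE.
have Hu := IH H 0 e e0 dH Hinj.
have m0 : (0 < m)%N by apply: leq_trans qm.
(* The last coordinate of the slice has index [m] in the full space; since [q <= m], [pid_mx q]
   annihilates it, giving a kernel vector for the derivative of [H]. *)
pose j0 : 'I_m := Ordinal (ltac:(by rewrite ltn_predL) : (m.-1 < m)%N).
have re0 : rn (0 - 0 : 'rV[R[i]]_m) < e by rewrite subrr rn0.
have [_ _ hG1 hG2] := GS 0 re0.
have gS0 : G (S 0) = 0 by rewrite S0 G0.
have dGid k : 'd G 0 k = k.
  have dG0 : differentiable G 0 by have [] := GP 0; rewrite ?subrr ?rn0.
  have dTG : differentiable T (G 0) by rewrite G0; exact: dTj.
  have E1 := d_comp k dG0 dTG.
  have E2 : 'd (fun x => T (G x)) 0 k = k.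
    suff [_ ->] : differentiable (fun x => T (G x)) 0 /\ forall h, 'd (fun x => T (G x)) 0 h = h *m 1%:M by rewrite mulmx1.
    apply: df_rV_mx => eps eps0; exists e => // z ze.
    have TGz : T (G z) = z by have [] := GP z; rewrite ?subr0.
    rewrite add0r TGz G0 T0 subr0 mulmx1 subrr rn0; apply: mulr_ge0; [exact: ltW|exact: rn_ge0].
  have dT0' x : x = 0 -> forall k, 'd T x k = k by move=> ->.
  have E3 := dT0' _ G0 ('d G 0 k).
  exact: etrans (esym E3) (etrans (esym E1) E2).
have dH0 : 'd H 0 (delta_mx 0 j0) = 0.
  apply/rowP => j; rewrite -[LHS]((df_coord j (dH 0 re0)).2 _) [RHS]mxE.
  have -> : (fun x => H x 0 j : C) = (fun x => F (G (S x)) 0 (rshift 1 j) : C).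
    by apply/funext => z; rewrite /H mxE.
  apply: etrans ((df_coord _ (dFG 0 re0)).2 _) _.
  have E1 := d_comp (delta_mx 0 j0) (df_comp (dS 0) hG2) (dF _ hG1).
  have E2 := d_comp (delta_mx 0 j0) (dS 0) hG2.
  have E3 : 'd S 0 (delta_mx 0 j0) = S (delta_mx 0 j0).
    have SF : S = (fun x => 0 + x *m row_mx 0 1%:M) by apply/funext => z; exact: SE.
    rewrite SF; apply: etrans ((df_affine _ _ _).2 _) _; by rewrite add0r.
  have E4 : 'd (fun x => G (S x)) 0 (delta_mx 0 j0) = S (delta_mx 0 j0).
    have dGid' x : x = 0 -> forall k, 'd G x k = k by move=> ->.
    exact: etrans E2 (etrans (dGid' _ S0 _) E3).
  suff -> : 'd (fun x => F (G (S x))) 0 (delta_mx 0 j0) = S (delta_mx 0 j0) *m pid_mx q.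
    rewrite mxE big1 // => l _; case: (split_ordP l) => i ->; rewrite ?row_mxEl ?row_mxEr !mxE ?mul0r //=.
    case: (eqVneq i j0) => [->|_]; last by rewrite mul0r.
    rewrite (_ : (1 + j0 < q)%N = false) ?andbF ?mulr0 //.
    by rewrite /= add1n prednK // ltnNge qm.
  have dF0' x : x = 0 -> forall k, 'd F x k = k *m pid_mx q by move=> ->.
  exact: etrans E1 (etrans (dF0' _ gS0 _) (congr1 (mulmx^~ _) E4)).
have := etrans (esym (d_jacobian H 0 (delta_mx 0 j0))) dH0.
move=> /(congr1 (mulmx^~ (invmx (lin1_mx ('d H 0))))); rewrite mulmxK // mul0mx.
by move=> /rowP/(_ j0); rewrite !mxE !eqxx => /eqP; rewrite oner_eq0.
Qed.

(** In dimension zero the empty determinant is 1. Otherwise the induction hypothesis makes every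
    singular point flat; dimension one ends with the one-variable result, higher dimensions with
    [osgood_flat]. *)
Theorem osgood n (f : 'rV[R[i]]_n -> 'rV[R[i]]_n) (a : 'rV[R[i]]_n) (r : R) : 0 < r ->
  (forall x, rn (x - a) < r -> differentiable f x) ->
  (forall x x', rn (x - a) < r -> rn (x' - a) < r -> f x = f x' -> x = x') ->
  lin1_mx ('d f a) \in unitmx.
Proof.
elim: n f a r => [|n IH] f a r r0 df finj; first by rewrite unitmxE det_mx00 unitr1.
have flat y : rn (y - a) < r -> \det (lin1_mx ('d f y)) = 0 -> forall h, 'd f y h = 0.
  move=> ya; have ry : 0 < r - rn (y - a) by rewrite subr_gt0.
  have sub x : rn (x - y) < r - rn (y - a) -> rn (x - a) < r.
    by move=> xy; apply: le_lt_trans (rn_dist y _ _) _; move: xy; clear; lra.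
  apply: (@osgood_slice n f y _ IH ry).
    by move=> x xy; apply/df/sub.
  by move=> x x' xy x'y; apply: finj; apply: sub.
rewrite unitmxE unitfE.
case: n f a df finj flat {IH} => [|n] f a df finj flat; last exact: (osgood_flat r0).
apply/eqP => d0.
have dfa : differentiable f a by apply: df; rewrite subrr rn0.
have := @injective_deriv_neq0 _ (fun x => f x 0 0 : C) a r r0
  (fun x xa => (df_coord 0 (df x xa)).1).
move=> /(_ (fun x x' xa x'a E => finj x x' xa x'a (ltac:(by apply/rowP => j; rewrite ord1)))) /eqP; apply.
apply: etrans ((df_coord 0 dfa).2 _) _.
by rewrite flat ?mxE // subrr rn0.
Qed.

End OsgoodTheorem.

(** * Complements of compact sets in the plane *)

Section Grid.
Local Open Scope nat_scope.

Definition vertex : Type := (nat * nat)%type.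

Inductive gstep : vertex -> vertex -> Prop :=
| gstepR i j : gstep (i, j) (i.+1, j)
| gstepU i j : gstep (i, j) (i, j.+1).

Inductive gpath (S : vertex -> Prop) (u : vertex) : vertex -> Prop :=
| gpath0 : S u -> gpath S u u
| gpathS v w : gpath S u v -> gstep v w \/ gstep w v -> S w -> gpath S u w.

Lemma gpath_start S u v : gpath S u v -> S u.
Proof. by elim. Qed.

Lemma gpath_end S u v : gpath S u v -> S v.
Proof. by case. Qed.

Lemma gpath_trans S u v w : gpath S u v -> gpath S v w -> gpath S u w.
Proof. by move=> uv; elim=> // x y _ ux xy Sy; exact: gpathS ux xy Sy. Qed.

Lemma gpath_sym S u v : gpath S u v -> gpath S v u.
Proof.
elim=> [Su|x y ux xu xy Sy]; first exact: gpath0.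
apply: gpath_trans xu; apply: (@gpathS S y y x); first exact: gpath0.
  by case: xy; [right|left].
exact: gpath_end ux.
Qed.

Lemma gpath_sub (S T : vertex -> Prop) u v :
  (forall x, S x -> T x) -> gpath S u v -> gpath T u v.
Proof.
move=> ST; elim=> [/ST|x y _ ux xy /ST]; first exact: gpath0.
exact: gpathS ux xy.
Qed.

Lemma gpath_row S i j n : (forall k, k <= n -> S (i + k, j)) -> gpath S (i, j) (i + n, j).
Proof.
elim: n => [|n IH] H; first by rewrite addn0; apply: gpath0; have := H 0 (leqnn _); rewrite addn0.
apply: (gpathS (IH _)); first by move=> k kn; apply: H; exact: leqW.
  by left; rewrite addnS; constructor.
exact: H.
Qed.

Lemma gpath_col S i j n : (forall k, k <= n -> S (i, j + k)) -> gpath S (i, j) (i, j + n).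
Proof.
elim: n => [|n IH] H; first by rewrite addn0; apply: gpath0; have := H 0 (leqnn _); rewrite addn0.
apply: (gpathS (IH _)); first by move=> k kn; apply: H; exact: leqW.
  by left; rewrite addnS; constructor.
exact: H.
Qed.

Lemma gpath_rowI S i i' j :
  (forall k, minn i i' <= k -> k <= maxn i i' -> S (k, j)) -> gpath S (i, j) (i', j).
Proof.
have main a b : a <= b -> (forall k, a <= k -> k <= b -> S (k, j)) -> gpath S (a, j) (b, j).
  move=> ab H; rewrite -(subnKC ab); apply: gpath_row => k kn; apply: H.
    exact: leq_addr.
  by rewrite -leq_subRL // addnC.
move=> H; have [ii'|i'i] := leqP i i'.
  by apply: main => // k k1 k2; apply: H; rewrite ?(minn_idPl ii') ?(maxn_idPr ii').
apply: gpath_sym; apply: main (ltnW i'i) _ => k k1 k2.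
by apply: H; rewrite ?(minn_idPr (ltnW i'i)) ?(maxn_idPl (ltnW i'i)).
Qed.

Lemma gpath_colI S i j j' :
  (forall k, minn j j' <= k -> k <= maxn j j' -> S (i, k)) -> gpath S (i, j) (i, j').
Proof.
have main a b : a <= b -> (forall k, a <= k -> k <= b -> S (i, k)) -> gpath S (i, a) (i, b).
  move=> ab H; rewrite -(subnKC ab); apply: gpath_col => k kn; apply: H.
    exact: leq_addr.
  by rewrite -leq_subRL // addnC.
move=> H; have [ii'|i'i] := leqP j j'.
  by apply: main => // k k1 k2; apply: H; rewrite ?(minn_idPl ii') ?(maxn_idPr ii').
apply: gpath_sym; apply: main (ltnW i'i) _ => k k1 k2.
by apply: H; rewrite ?(minn_idPr (ltnW i'i)) ?(maxn_idPl (ltnW i'i)).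
Qed.

(* A discrete Janiszewski theorem. The coboundary of the indicator of the set A
   of vertices reachable from a splits as c1 + c2 according to which obstacle
   blocks an edge; c1 is itself a cocycle, hence the coboundary of some psi,
   which is constant along the first path, while psi + A is constant along the
   second one. *)
Lemma gpath_avoid2 (bad1 bad2 : vertex -> bool) (a b : vertex) :
  (forall j, ~~ bad1 (0, j)) ->
  (forall i j x y, x \in [:: (i, j); (i.+1, j); (i, j.+1); (i.+1, j.+1)] ->
     y \in [:: (i, j); (i.+1, j); (i, j.+1); (i.+1, j.+1)] ->
     bad1 x -> bad2 y -> False) ->
  gpath (fun v => ~~ bad1 v) a b -> gpath (fun v => ~~ bad2 v) a b ->
  gpath (fun v => ~~ bad1 v /\ ~~ bad2 v) a b.
Proof.
move=> col0 sep p1 p2.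
pose S v := ~~ bad1 v /\ ~~ bad2 v.
pose A v : bool := `[<gpath S a v>].
have aS : S a by split; [exact: gpath_start p1|exact: gpath_start p2].
have Aa : A a by apply/asboolP; exact: gpath0.
have AS v : A v -> S v by move=> /asboolP; exact: gpath_end.
have step u v : gstep u v \/ gstep v u -> A u -> ~~ A v -> bad1 v || bad2 v.
  move=> uv /asboolP Au; apply: contraR; rewrite negb_or => /andP[b1 b2].
  by apply/asboolP; apply: gpathS Au uv _.
pose c u v := (A u (+) A v) && (bad1 u || bad1 v).
have cE u v : gstep u v -> ~~ bad2 u -> ~~ bad2 v -> c u v = A u (+) A v.
  move=> uv b2u b2v; rewrite /c; case Au : (A u); case Av : (A v) => //=.
    by have := step u v (or_introl uv) Au (negbT Av); rewrite (negbTE b2v) orbF => ->; rewrite orbT.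
  by have := step v u (or_intror uv) Av (negbT Au); rewrite (negbTE b2u) orbF => ->.
pose h i j := c (i, j) (i.+1, j); pose v i j := c (i, j) (i, j.+1).
(* If a corner is blocked by [bad1], none is blocked by [bad2], and [c] is the coboundary of [A] on
   this face; otherwise [c] vanishes on all four edges. *)
have face i j : h i j (+) v i.+1 j (+) h i j.+1 (+) v i j = false.
  pose F := [:: (i, j); (i.+1, j); (i, j.+1); (i.+1, j.+1)].
  case: (boolP (has bad1 F)) => [/hasP[x xF bx]|/hasPn nb].
    have nb y : y \in F -> ~~ bad2 y by move=> yF; apply/negP => by_; exact: (sep i j x y xF yF bx by_).
    have b1 := nb (i, j) (ltac:(by rewrite !inE eqxx)).
    have b2 := nb (i.+1, j) (ltac:(by rewrite !inE eqxx !orbT)).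
    have b3 := nb (i, j.+1) (ltac:(by rewrite !inE eqxx !orbT)).
    have b4 := nb (i.+1, j.+1) (ltac:(by rewrite !inE eqxx !orbT)).
    rewrite /h /v !cE //; try by constructor.
    by case: (A _) (A _) (A _) (A _) => [] [] [] [].
  have b1 := nb (i, j) (ltac:(by rewrite !inE eqxx)).
  have b2 := nb (i.+1, j) (ltac:(by rewrite !inE eqxx !orbT)).
  have b3 := nb (i, j.+1) (ltac:(by rewrite !inE eqxx !orbT)).
  have b4 := nb (i.+1, j.+1) (ltac:(by rewrite !inE eqxx !orbT)).
  by rewrite /h /v /c (negbTE b1) (negbTE b2) (negbTE b3) (negbTE b4) !andbF.
(* The primitive is summed along rows from the left column; the column being free of [bad1] makes
   [c] vanish on its edges, which starts the induction for vertical steps. *)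
pose psi (w : vertex) := \big[addb/false]_(k < w.1) h k w.2.
have psiR i j : psi (i.+1, j) = psi (i, j) (+) h i j by rewrite /psi /= big_ord_recr.
have psiU i j : psi (i, j.+1) = psi (i, j) (+) v i j.
  elim: i => [|i IH].
    by rewrite /psi /= !big_ord0 /v /c (negbTE (col0 j)) (negbTE (col0 j.+1)) andbF.
  rewrite !psiR IH; have := face i j.
  by case: (psi _) (h i j) (v i.+1 j) (h i j.+1) (v i j) => [] [] [] [] [].
have psiS x y : gstep x y -> psi y = psi x (+) c x y by case=> i j; [exact: psiR|exact: psiU].
have e1 w : gpath (fun v => ~~ bad1 v) a w -> psi w = psi a.
  elim=> // x y px IH xy by1; have bx1 := gpath_end px.
  have c0 u u' : ~~ bad1 u -> ~~ bad1 u' -> c u u' = false.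
    by move=> /negbTE b1 /negbTE b2; rewrite /c b1 b2 andbF.
  by rewrite -IH; case: xy => /psiS ->; rewrite c0 // addbF.
have e2 w : gpath (fun v => ~~ bad2 v) a w -> psi w (+) A w = psi a (+) A a.
  elim=> // x y px IH xy by2; have bx2 := gpath_end px; rewrite -IH.
  case: xy => xy; rewrite (psiS _ _ xy) cE //.
    by case: (psi x) (A x) (A y) => [] [] [].
  by case: (psi y) (A x) (A y) => [] [] [].
have := e2 b p2; rewrite (e1 b p1) Aa => H; apply/asboolP.
by move: H; rewrite -/(A b); case: (A b) => //; case: (psi a).
Qed.

End Grid.

(** * Compact sets in the plane and the maximum principle *)

Section CompactPlane.
Variable R : realType.
Local Notation C := (R[i]^o).

Lemma compact_normc_max (T : topologicalType) (f : T -> C) (K : set T) :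
  (forall x, K x -> {for x, continuous f}) -> K !=set0 -> compact K ->
  exists2 c, K c & forall x, K x -> normc (f x) <= normc (f c).
Proof.
move=> cf K0 cK.
have [] := @compact_EVT_max T R (fun x => normc (f x)) K K0 cK.
  apply/subspace_continuousP => x Kx; apply/cvgrPdist_lt => e e0.
  have H : nbhs x (f @^-1` [set y | rn (y - f x) < e]).
    by apply: (cf x Kx); apply/nbhs_rn; exists e.
  rewrite near_withinE; near=> y => Ky; rewrite distrC.
  apply: le_lt_trans (normc_rev _ _) _; rewrite -rnC.
  by have : (f @^-1` [set y | rn (y - f x) < e]) y by near: y; exact: H.
by move=> c /set_mem Kc cP; exists c => // x Kx; apply: cP; exact: mem_set.
Unshelve. all: by end_near. Qed.

Lemma compact_normc_min (T : topologicalType) (f : T -> C) (K : set T) :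
  (forall x, K x -> {for x, continuous f}) -> K !=set0 -> compact K ->
  exists2 c, K c & forall x, K x -> normc (f c) <= normc (f x).
Proof.
move=> cf K0 cK.
have [] := @compact_EVT_min T R (fun x => normc (f x)) K K0 cK.
  apply/subspace_continuousP => x Kx; apply/cvgrPdist_lt => e e0.
  have H : nbhs x (f @^-1` [set y | rn (y - f x) < e]).
    by apply: (cf x Kx); apply/nbhs_rn; exists e.
  rewrite near_withinE; near=> y => Ky; rewrite distrC.
  apply: le_lt_trans (normc_rev _ _) _; rewrite -rnC.
  by have : (f @^-1` [set y | rn (y - f x) < e]) y by near: y; exact: H.
by move=> c /set_mem Kc cP; exists c => // x Kx; apply: cP; exact: mem_set.
Unshelve. all: by end_near. Qed.

Lemma compact_normc_bound (T : topologicalType) (f : T -> C) (K : set T) :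
  (forall x, K x -> {for x, continuous f}) -> compact K ->
  exists2 B : R, 0 < B & forall x, K x -> normc (f x) <= B.
Proof.
move=> cf cK; have [/nonemptyPn K0|/contrapT K0] := pselect (~ (K !=set0)).
  by exists 1 => // x; rewrite K0.
have [c Kc cP] := compact_normc_max cf K0 cK.
exists (normc (f c) + 1); first by rewrite ltr_wpDl // normc_ge0.
by move=> x /cP h; apply: le_trans h _; rewrite lerDl.
Qed.

Lemma id_continuous_C (z : C) : {for z, continuous (fun w : C => w)}.
Proof. by apply: df_continuous; exact: df_id. Qed.

Lemma compact_dist (K : set C) (z : C) : compact K -> ~ K z ->
  exists2 d : R, 0 < d & forall w, K w -> d <= normc (w - z).
Proof.
move=> cK Kz; have [/nonemptyPn K0|/contrapT K0] := pselect (~ (K !=set0)).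
  by exists 1 => // x; rewrite K0.
have cf (x : C) : {for x, continuous (fun w : C => w - z : C)}.
  by apply: df_continuous; apply: dfC_B; [exact: df_id|exact: dfC_cst].
have [c Kc cP] := compact_normc_min (fun x _ => cf x) K0 cK.
exists (normc (c - z)) => //.
by rewrite normc_gt0 subr_eq0; apply/eqP => cz; apply: Kz; rewrite -cz.
Qed.

Lemma compact_rect (q : rect R) : compact [set z : C | in_rect q z].
Proof.
have -> : [set z : C | in_rect q z] =
    (fun p : R * R => (p.1 +i* p.2 : C)) @` (`[q.1.1, q.1.2] `*` `[q.2.1, q.2.2]).
  apply/seteqP; split => [[x y] /andP[/= hx hy]|_ [[x y] [/= hx hy] <-]].
    by exists (x, y) => //; split; rewrite /= in_itv.
  by move: hx hy; rewrite /= !in_itv /in_rect /= => -> ->.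
apply: continuous_compact; last by apply: compact_setX; exact: segment_compact.
apply: continuous_subspaceT => -[x y] A /nbhs_rn[e e0 eA].
have e2 : 0 < e / 2 by rewrite divr_gt0.
exists ([set x' | `|x - x'| < e / 2], [set y' | `|y - y'| < e / 2]).
  by split => /=; apply/nbhs_ballP; exists (e / 2).
move=> [x' y'] [/= hx hy]; apply: eA; rewrite rnC.
apply: le_lt_trans (normc_ReIm _) _ => /=.
rewrite distrC in hx; rewrite distrC in hy.
by rewrite (_ : e = e / 2 + e / 2); [exact: ltrD|field].
Qed.

Lemma closed_bounded_compact (K : set C) (B : R) :
  (forall z, (forall d, 0 < d -> exists2 y, K y & normc (y - z) < d) -> K z) ->
  (forall z, K z -> normc z <= B) -> compact K.
Proof.
move=> clK bK; apply: subclosed_compact (@compact_rect (sq 0 B)) _.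
  move=> z zK; apply: clK => d d0.
  have [y [Ky yz]] := zK [set y | rn (y - z) < d] (ltac:(by apply/nbhs_rn; exists d)).
  by exists y => //; rewrite -rnC.
by move=> z /bK zB /=; apply: in_sq; rewrite subr0.
Qed.

Lemma disjoint_dist (K L : set C) : compact K -> compact L ->
  (forall z, K z -> L z -> False) ->
  exists2 d : R, 0 < d & forall x y, K x -> L y -> d <= normc (x - y).
Proof.
move=> cK cL KL; have [/nonemptyPn K0|/contrapT K0] := pselect (~ (K !=set0)).
  by exists 1 => // x y; rewrite K0.
have [/nonemptyPn L0|/contrapT L0] := pselect (~ (L !=set0)).
  by exists 1 => // x y _; rewrite L0.
have cKL := compact_setX cK cL.
have KL0 : (K `*` L) !=set0 by case: K0 => k Kk; case: L0 => l Ll; exists (k, l).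
have cf (p : C * C) : {for p, continuous (fun p : C * C => p.1 - p.2 : C)}.
  by apply: cvgB; [exact: cvg_fst|exact: cvg_snd].
have [c [Kc Lc] cP] := compact_normc_min (fun x _ => cf x) KL0 cKL.
exists (normc (c.1 - c.2)).
  rewrite normc_gt0 subr_eq0; apply/eqP => e; apply: (KL _ Kc); by rewrite e.
by move=> x y Kx Ly; exact: (cP (x, y)).
Qed.

(** Parseval's identity over the fourth roots of unity: for degree at most two all cross terms
    cancel, and only the constant term is kept. *)
Lemma four_points (a0 a1 a2 : C) (s : R) :
  4 * normc a0 ^+ 2 <=
  normc (a0 + a1 * s%:C + a2 * s%:C ^+ 2) ^+ 2 +
  normc (a0 + a1 * ('i * s%:C) + a2 * ('i * s%:C) ^+ 2) ^+ 2 +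
  normc (a0 + a1 * (- s%:C) + a2 * (- s%:C) ^+ 2) ^+ 2 +
  normc (a0 + a1 * (- ('i * s%:C)) + a2 * (- ('i * s%:C)) ^+ 2) ^+ 2.
Proof.
rewrite !normc_sqr; case: a0 a1 a2 => [x0 y0] [x1 y1] [x2 y2].
rewrite !sqrrN !expr2 /=.
rewrite [leRHS](_ : _ = 4 * (x0 * x0 + y0 * y0) + 4 * ((x1 ^+ 2 + y1 ^+ 2) * s ^+ 2)
   + 4 * ((x2 ^+ 2 + y2 ^+ 2) * (s ^+ 2) ^+ 2)); last by ring.
have : 0 <= (x1 ^+ 2 + y1 ^+ 2) * s ^+ 2 by rewrite mulr_ge0 ?addr_ge0 ?sqr_ge0.
have : 0 <= (x2 ^+ 2 + y2 ^+ 2) * (s ^+ 2) ^+ 2 by rewrite mulr_ge0 ?addr_ge0 ?sqr_ge0.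
lra.
Qed.

Lemma four_points_id (c : C) (s : R) :
  normc (c + s%:C) ^+ 2 + normc (c + 'i * s%:C) ^+ 2 +
  normc (c + - s%:C) ^+ 2 + normc (c + - ('i * s%:C)) ^+ 2 =
  4 * normc c ^+ 2 + 4 * s ^+ 2.
Proof. by rewrite !normc_sqr; case: c => x y /=; ring. Qed.

(* The value of |f|^2 + eps |z|^2 at c is exceeded by its average over the four
   points c + i^k s for small s. *)
Lemma no_interior_max (f : C -> C) (c : C) (eps d : R) : entire f ->
  0 < eps -> 0 < d ->
  (forall z, normc (z - c) < d ->
    normc (f z) ^+ 2 + eps * normc z ^+ 2 <= normc (f c) ^+ 2 + eps * normc c ^+ 2) ->
  False.
Proof.
move=> ef eps0 d0 H.
have [r [M [_ B]]] := @bounded_holo_ex _ _ f c 1 ltr01 (fun y _ => ef y).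
have M0 := bounded_holo_ge0 B; have r0 : 0 < r by case: B.
have [_ BP] := B.
have [a [aM aP]] := @taylor_disc _ f c r M r0 (fun z zr => BP z (ltac:(by rewrite rnC))).
pose K := 8 * M * (4 / r) ^+ 3.
have K0 : 0 <= K.
  by apply: mulr_ge0; [exact: mulr_ge0|rewrite exprn_ge0 // divr_ge0 // ltW].
have fP h : normc h <= r / 8 -> normc (f (c + h) - (a 0%N + a 1%N * h + a 2%N * h ^+ 2)) <= K * normc h ^+ 3.
  move=> hr; have := aP h 3%N hr; rewrite !big_ord_recl big_ord0 /= /bump /= expr0 expr1 mulr1 addr0 !addrA.
  by rewrite exprMn (mulrA (8 * M)) => h'; exact: h'.
have a0 : a 0%N = f c.
  have := fP 0 (ltac:(by rewrite normc0 divr_ge0 // ltW)).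
  rewrite addr0 mulr0 expr0n mulr0 !addr0 normc0 expr0n mulr0 => h.
  apply/esym/eqP; rewrite -subr_eq0; apply/eqP; apply: (@eq0_normc R); apply/eqP.
  by rewrite eq_le h normc_ge0.
pose s := Num.min (Num.min (r / 16) (d / 2)) (Num.min 1 (eps / (4 * ((M + K) * K) + 1))).
pose K2 := 2 * ((M + K) * K).
have K20 : 0 <= K2 by apply: mulr_ge0 => //; apply: mulr_ge0 => //; exact: addr_ge0.
have den : 0 < 4 * ((M + K) * K) + 1 by rewrite ltr_wpDl // mulr_ge0 // mulr_ge0 // addr_ge0.
have s0 : 0 < s by rewrite !lt_min !divr_gt0 // ltr01.
have sr : s <= r / 16 by rewrite !ge_min lexx.
have sd : s <= d / 2 by rewrite !ge_min lexx !orbT.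
have s1 : s <= 1 by rewrite !ge_min lexx !orbT.
have se : s * (4 * ((M + K) * K) + 1) <= eps.
  by rewrite -ler_pdivlMr // !ge_min lexx !orbT.
have pt h : normc h = s -> normc (a 0%N + a 1%N * h + a 2%N * h ^+ 2) ^+ 2 - K2 * s ^+ 3 <= normc (f (c + h)) ^+ 2.
  move=> hs; set p := a 0%N + _ + _.
  have h1 := fP h (ltac:(rewrite hs; move: sr r0; clear; lra)); rewrite hs -/p in h1.
  have fM : normc (f (c + h)) <= M.
    by apply: (BP _ _).2; rewrite rnC addrAC subrr add0r hs; move: sr r0; clear; lra.
  have h2 := normcD (p - f (c + h)) (f (c + h)); rewrite subrK normcBC in h2.
  have s3 : 0 <= s ^+ 3 by rewrite exprn_ge0 // ltW.
  have s31 : s ^+ 3 <= 1 by rewrite exprn_ile1 // ltW.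
  have Ks : K * s ^+ 3 <= K by rewrite ler_piMr.
  have pn := normc_ge0 p; have fn := normc_ge0 (f (c + h)).
  rewrite /K2; move: h1 h2 fM Ks pn fn M0 K0 s3 s31.
  move: (normc p) (normc (f (c + h))) (normc _) (s ^+ 3) (K) => A1 A2 A3 A4 K'; clear.
  move=> h1 h2 h3 h4 h5 h6 h7 h8 h9 h10.
  have q1 : A1 <= A2 + K' * A4 by lra.
  have q2 : A1 ^+ 2 <= (A2 + K' * A4) ^+ 2 by rewrite lerXn2r // nnegrE // addr_ge0 // mulr_ge0.
  have q3 : A2 * (K' * A4) <= M * (K' * A4) by rewrite ler_wpM2r // mulr_ge0.
  have q4 : (K' * A4) * (K' * A4) <= K' * (K' * A4) by rewrite ler_wpM2r // mulr_ge0.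
  have q5 : 0 <= K' * (K' * A4) := mulr_ge0 h8 (mulr_ge0 h8 h9).
  have q6 : (A2 + K' * A4) ^+ 2 = A2 ^+ 2 + 2 * (A2 * (K' * A4)) + (K' * A4) * (K' * A4) by ring.
  have q7 : 2 * ((M + K') * K') * A4 = 2 * (M * (K' * A4)) + 2 * (K' * (K' * A4)) by ring.
  lra.
have n1 : normc (s%:C : C) = s by rewrite normc_real gtr0_norm.
have n2 : normc ('i * s%:C : C) = s by rewrite normcM normci mul1r.
have n3 : normc (- s%:C : C) = s by rewrite normcN.
have n4 : normc (- ('i * s%:C) : C) = s by rewrite normcN.
have Hs h : normc h = s -> normc (f (c + h)) ^+ 2 + eps * normc (c + h) ^+ 2 <= normc (f c) ^+ 2 + eps * normc c ^+ 2.
  by move=> hs; apply: H; rewrite addrAC subrr add0r hs; move: sd d0; clear; lra.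
have F := four_points (a 0%N) (a 1%N) (a 2%N) s; rewrite {1}a0 in F.
have I := four_points_id c s.
move: (Hs _ n1) (Hs _ n2) (Hs _ n3) (Hs _ n4) (pt _ n1) (pt _ n2) (pt _ n3) (pt _ n4) F I.
(* The term with [eps] gains [eps * s ^+ 2] on average by [four_points_id], against a Taylor error
   of [K2 * s ^+ 3] at each point. *)
have sK : K2 * s ^+ 3 < eps * s ^+ 2.
  rewrite exprS mulrA ltr_pM2r ?exprn_gt0 // /K2.
  have : 0 <= (M + K) * K by rewrite mulr_ge0 // addr_ge0.
  by move: se s0; move: ((M + K) * K) => q; clear; nra.
move: sK.
move: (normc (f (c + s%:C)) ^+ 2) (normc (f (c + 'i * s%:C)) ^+ 2)
  (normc (f (c + - s%:C)) ^+ 2) (normc (f (c + - ('i * s%:C))) ^+ 2) => f1 f2 f3 f4.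
move: (normc (c + s%:C) ^+ 2) (normc (c + 'i * s%:C) ^+ 2)
  (normc (c + - s%:C) ^+ 2) (normc (c + - ('i * s%:C)) ^+ 2) => g1 g2 g3 g4.
move: (normc (a 0%N + a 1%N * s%:C + _) ^+ 2) (normc (a 0%N + a 1%N * ('i * s%:C) + _) ^+ 2)
  (normc (a 0%N + a 1%N * (- s%:C) + _) ^+ 2) (normc (a 0%N + a 1%N * (- ('i * s%:C)) + _) ^+ 2)
   => p1 p2 p3 p4.
move: (normc (f c) ^+ 2) (normc c ^+ 2) (K2 * s ^+ 3) (s ^+ 2) => A B' D E; clear => h1 h2 h3 h4 h5 h6 h7 h8 h9 h10 h11.
have e1 : eps * (g1 + g2 + g3 + g4) = eps * (4 * B' + 4 * E) by rewrite h11.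
have e2 : eps * (g1 + g2 + g3 + g4) = eps * g1 + eps * g2 + eps * g3 + eps * g4 by ring.
have e3 : eps * (4 * B' + 4 * E) = 4 * (eps * B') + 4 * (eps * E) by ring.
lra.
Qed.

(** On the closure of [E] the perturbed function |f|^2 + eps |z|^2 has a maximum, which cannot lie
    in the open set [E], hence lies in [X]; then eps tends to 0. The boundary condition is stated
    pointwise because [E] will be a set of lattice-reachable points. *)
Lemma max_principle (f : C -> C) (E X : set C) (a : C) (L B : R) : entire f ->
  E a -> (forall z, E z -> normc z <= L) ->
  (forall z, E z -> exists2 d : R, 0 < d & forall y, normc (y - z) < d -> E y) ->
  (forall z, ~ E z -> ~ X z -> exists2 d : R, 0 < d & forall y, normc (y - z) < d -> ~ E y) ->
  (forall z, X z -> normc (f z) <= B) ->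
  normc (f a) <= B.
Proof.
move=> ef Ea EL Eo Ec fX.
pose K := [set z : C | forall d, 0 < d -> exists2 y, E y & normc (y - z) < d].
have EK z : E z -> K z by move=> Ez d d0; exists z => //; rewrite subrr normc0.
have KL z : K z -> normc z <= L.
  move=> Kz; apply/ler_addgt0Pr => e e0; have [y Ey yz] := Kz e e0.
  have := normcD (z - y) y; rewrite subrK normcBC; have := EL y Ey; move: yz; clear; lra.
have cK : compact K.
  apply: closed_bounded_compact KL => z Kz d d0.
  have d2 : 0 < d / 2 by rewrite divr_gt0.
  have [y Ky yz] := Kz _ d2; have [x Ex xy] := Ky _ d2; exists x => //.
  by apply: le_lt_trans (normc_dist y _ _) _; rewrite (_ : d = d / 2 + d / 2); [exact: ltrD|field].
have L0 : 0 <= L := le_trans (normc_ge0 a) (EL a Ea).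
have main eps : 0 < eps -> 0 <= B /\ normc (f a) ^+ 2 <= B ^+ 2 + eps * L ^+ 2.
  move=> eps0.
  pose u (z : C) : C := (normc (f z) ^+ 2 + eps * normc z ^+ 2)%:C.
  have u0 z : 0 <= normc (f z) ^+ 2 + eps * normc z ^+ 2.
    by rewrite addr_ge0 ?sqr_ge0 // mulr_ge0 ?sqr_ge0 // ltW.
  have nu z : normc (u z) = normc (f z) ^+ 2 + eps * normc z ^+ 2.
    by rewrite normc_real ger0_norm.
  have cu z : {for z, continuous u}.
    have sq_cont (g : C -> C) : {for z, continuous g} -> forall e : R, 0 < e -> exists2 d : R, 0 < d &
        forall y, normc (y - z) < d -> `|normc (g y) ^+ 2 - normc (g z) ^+ 2| < e.
      move=> cg e e0; pose m := 2 * normc (g z) + 1.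
      have m0 : 0 < m by rewrite ltr_wpDl // mulr_ge0 // normc_ge0.
      have [d d0 dP] := (continuous_rn g z).1 cg (Num.min 1 (e / m)) (ltac:(by rewrite lt_min ltr01 divr_gt0)).
      exists d => // y yz; have := dP y; rewrite !rnC => /(_ yz); rewrite lt_min => /andP[h1 h2].
      rewrite ltr_pdivlMr // in h2.
      have h3 := normc_rev (g y) (g z); rewrite subr_sqr normrM (ger0_norm (addr_ge0 (normc_ge0 (g y)) (normc_ge0 (g z)))).
      have h4 : normc (g y) + normc (g z) < m.
        by move: h1 (le_trans (ler_norm _) h3); rewrite /m; clear; lra.
      apply: le_lt_trans h2; apply: ler_pM => //; last exact: ltW.
      by rewrite addr_ge0 ?normc_ge0.
    apply/continuous_rn => e e0.
    have [d1 d10 P1] := sq_cont f (df_continuous (ef z)) (e / 2) (ltac:(by rewrite divr_gt0)).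
    have [d2 d20 P2] := sq_cont (fun w => w) (@id_continuous_C z) (e / (2 * eps)) (ltac:(by rewrite divr_gt0 // mulr_gt0)).
    exists (Num.min d1 d2); first by rewrite lt_min d10.
    move=> y; rewrite !rnC lt_min => /andP[/P1 h1 /P2 h2].
    rewrite /u -rmorphB /= normc_real.
    have -> : normc (f y) ^+ 2 + eps * normc y ^+ 2 - (normc (f z) ^+ 2 + eps * normc z ^+ 2) =
       (normc (f y) ^+ 2 - normc (f z) ^+ 2) + eps * (normc y ^+ 2 - normc z ^+ 2) by ring.
    apply: le_lt_trans (ler_normD _ _) _; rewrite normrM (gtr0_norm eps0).
    rewrite ltr_pdivlMr ?mulr_gt0 // in h2.
    by move: h1 h2; move: (`|_|) (`|_|) => A1 A2; clear; lra.
  have [c Kc cP] := compact_normc_max (fun z _ => cu z) (ex_intro _ a (EK a Ea)) cK.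
  have cP' z : K z -> normc (f z) ^+ 2 + eps * normc z ^+ 2 <= normc (f c) ^+ 2 + eps * normc c ^+ 2.
    by move=> /cP; rewrite !nu.
  have nE : ~ E c.
    move=> Ec'; have [d d0 dE] := Eo c Ec'.
    by apply: (@no_interior_max f c eps d ef eps0 d0) => z zc; apply/cP'/EK/dE.
  have Xc : X c.
    apply: contrapT => nX; have [d d0 dE] := Ec c nE nX.
    by have [y Ey yc] := Kc d d0; exact: (dE y yc).
  have fB := fX c Xc; have B0 : 0 <= B := le_trans (normc_ge0 _) fB; split => //.
  have h1 := cP' a (EK a Ea).
  have h2 : normc (f c) ^+ 2 <= B ^+ 2 by rewrite lerXn2r // nnegrE // normc_ge0.
  have h3 : eps * normc c ^+ 2 <= eps * L ^+ 2.
    by rewrite ler_pM2l // lerXn2r // ?nnegrE ?normc_ge0 //; exact: KL.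
  have h4 : 0 <= eps * normc a ^+ 2 by rewrite mulr_ge0 ?sqr_ge0 // ltW.
  by move: h1 h2 h3 h4; clear; lra.
have [B0 _] := main 1 ltr01.
rewrite -(@ler_pXn2r _ 2) ?nnegrE ?normc_ge0 //; apply/ler_addgt0Pr => e e0.
have L1 : 0 < L ^+ 2 + 1 by rewrite ltr_wpDl // sqr_ge0.
have [_ h] := main (e / (L ^+ 2 + 1)) (divr_gt0 e0 L1).
apply: le_trans h _; rewrite lerD2l mulrAC ler_pdivrMr // ler_pM2l // lerDl //.
Qed.

End CompactPlane.

(** * Escape to infinity along lattice paths *)

Section Reach.
Variable R : realType.
Local Notation C := (R[i]^o).

(** Polynomial convexity with an explicit bound in place of a supremum, so that the empty set needs
    no special treatment. *)
Definition pconvex (X : set C) := compact X /\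
  forall z, ~ X z -> exists f (B : R),
    [/\ entire f, forall w, X w -> normc (f w) <= B & B < normc (f z)].

Definition mesh k : R := (2 ^+ k)^-1.

Lemma mesh_gt0 k : 0 < mesh k.
Proof. by rewrite invr_gt0 exprn_gt0. Qed.

Lemma mesh_le1 k : mesh k <= 1.
Proof. by rewrite invf_le1 ?exprn_gt0 // exprn_ege1 // ler1n. Qed.

Lemma mesh_small (e : R) : 0 < e -> exists k0, forall k, (k0 <= k)%N -> mesh k <= e.
Proof.
move=> e0; have [k0 h] := @exp2_small R 1 e ler01 e0.
by exists k0 => k /h; rewrite mul1r => /ltW.
Qed.

Variables (a : C) (N : nat).

(* The lattice of mesh 2^-k in the quadrant with corner a - N(1 + i). *)
Definition pt k (v : vertex) : C :=
  (complex.Re a - N%:R + v.1%:R * mesh k) +i* (complex.Im a - N%:R + v.2%:R * mesh k).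

(** The margin of eight mesh widths absorbs the distance of at most two mesh widths to a nearby
    lattice point and still leaves the factor 4 required when a pole moves by one step. *)
Definition safe (X : set C) k (v : vertex) :=
  forall w, X w -> 8 * mesh k <= normc (w - pt k v).

Lemma pt_center k : pt k ((N * 2 ^ k)%N, (N * 2 ^ k)%N) = a.
Proof.
have e : (N * 2 ^ k)%:R * mesh k = N%:R :> R.
  by rewrite natrM natrX mulfK // expf_neq0 // pnatr_eq0.
by rewrite /pt /= e !subrK; case: a.
Qed.

Lemma floor_pt k (y : C) : complex.Re a - N%:R <= complex.Re y ->
  complex.Im a - N%:R <= complex.Im y ->
  exists v, normc (pt k v - y) <= 2 * mesh k.
Proof.
have fl (x : R) : 0 <= x -> exists i : nat, `|i%:R * mesh k - x| <= mesh k.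
  move=> x0; have m0 := mesh_gt0 k; exists (Num.truncn (x / mesh k)).
  have /andP[h1 h2] := Num.Theory.truncn_itv (divr_ge0 x0 (ltW m0)).
  rewrite ler_pdivlMr // in h1; rewrite ltr_pdivrMr // -natr1 mulrDl mul1r in h2.
  by rewrite ler_norml; apply/andP; split; move: h1 h2; clear; lra.
rewrite -subr_ge0 -[complex.Im a - _ <= _]subr_ge0 => /fl[i hi] /fl[j hj].
exists (i, j); apply: le_trans (normc_ReIm _) _; rewrite mulr2n mulrDl mul1r.
apply: lerD => /=.
  by apply: le_trans hi; rewrite /pt; case: (y) => x' y' /=; rewrite le_eqVlt; apply/orP; left; apply/eqP; congr `|_|; ring.
by apply: le_trans hj; rewrite /pt; case: (y) => x' y' /=; rewrite le_eqVlt; apply/orP; left; apply/eqP; congr `|_|; ring.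
Qed.

Lemma nat_between (m1 m2 m : nat) (x c r s : R) : 0 < s ->
  `|x + m1%:R * s - c| <= r -> `|x + m2%:R * s - c| <= r ->
  (minn m1 m2 <= m)%N -> (m <= maxn m1 m2)%N -> `|x + m%:R * s - c| <= r.
Proof.
move=> s0; rewrite !ler_norml => /andP[l1 u1] /andP[l2 u2].
have ms p q : (p <= q)%N -> p%:R * s <= q%:R * s.
  by move=> pq; rewrite ler_wpM2r ?ler_nat // ltW.
rewrite geq_min leq_max => h1 h2; apply/andP; split.
  by case/orP: h1 => /ms h'; [move: h' l1|move: h' l2]; clear; lra.
by case/orP: h2 => /ms h'; [move: h' u1|move: h' u2]; clear; lra.
Qed.

(** An L-shaped path stays within [d / 4] of [z] in each coordinate, so within [d / 2]; the
    remaining [d / 2] is at least eight mesh widths. *)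
Lemma local_path (X : set C) (z : C) (d : R) k (u v : vertex) :
  (forall w, X w -> d <= normc (w - z)) -> 16 * mesh k <= d ->
  normc (pt k u - z) <= d / 4 -> normc (pt k v - z) <= d / 4 ->
  gpath (safe X k) u v.
Proof.
case: u v => [i j] [i' j'] Xd kd hu hv; have m0 := mesh_gt0 k.
have hu1 : `|complex.Re a - N%:R + i%:R * mesh k - complex.Re z| <= d / 4 := le_trans (normc_ReB _ z) hu.
have hu2 : `|complex.Im a - N%:R + j%:R * mesh k - complex.Im z| <= d / 4 := le_trans (normc_ImB _ z) hu.
have hv1 : `|complex.Re a - N%:R + i'%:R * mesh k - complex.Re z| <= d / 4 := le_trans (normc_ReB _ z) hv.
have hv2 : `|complex.Im a - N%:R + j'%:R * mesh k - complex.Im z| <= d / 4 := le_trans (normc_ImB _ z) hv.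
have key m m' : `|complex.Re a - N%:R + m%:R * mesh k - complex.Re z| <= d / 4 ->
    `|complex.Im a - N%:R + m'%:R * mesh k - complex.Im z| <= d / 4 -> safe X k (m, m').
  move=> h1 h2 w /Xd hw.
  have h3 : normc (pt k (m, m') - z) <= d / 4 + d / 4.
    by apply: le_trans (normc_ReIm _) _; apply: lerD; rewrite /pt; case: (z) h1 h2 => ? ?.
  have := normc_dist (pt k (m, m')) w z; move: h3 hw kd; clear; lra.
apply: (@gpath_trans _ _ (i', j)).
  by apply: gpath_rowI => m h1 h2; apply: key => //; exact: (nat_between m0 hu1 hv1).
by apply: gpath_colI => m h1 h2; apply: key => //; exact: (nat_between m0 hu2 hv2).
Qed.

Lemma safe_far (X : set C) (B : R) k v : (forall w, X w -> normc (w - a) <= B) ->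
  B + 8 <= `|complex.Re (pt k v) - complex.Re a| \/ B + 8 <= `|complex.Im (pt k v) - complex.Im a| ->
  safe X k v.
Proof.
move=> XB h w /XB wB.
have h1 : B + 8 <= normc (pt k v - a).
  by case: h => h; apply: le_trans h _; [exact: normc_ReB|exact: normc_ImB].
have := normc_dist w (pt k v) a; rewrite (normcBC (pt k v) w).
by move: h1 wB (mesh_le1 k); clear; lra.
Qed.

Lemma reach_far (X : set C) (B : R) : pconvex X -> ~ X a -> 0 <= B ->
  (forall w, X w -> normc (w - a) <= B) -> 2 * B + 20 <= N%:R ->
  (exists k0, forall k, (k0 <= k)%N ->
    gpath (safe X k) ((N * 2 ^ k)%N, (N * 2 ^ k)%N) (0%N, 0%N)) /\
  (forall k j, safe X k (0%N, j)).
Proof.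
move=> [cX pX] Xa B0 XB NB.
have col0 k j : safe X k (0%N, j).
  apply: (safe_far XB); left; rewrite /pt /= mul0r addr0 addrAC subrr add0r normrN ger0_norm //.
  by move: NB B0; clear; lra.
have row0 k i : safe X k (i, 0%N).
  apply: (safe_far XB); right; rewrite /pt /= mul0r addr0 addrAC subrr add0r normrN ger0_norm //.
  by move: NB B0; clear; lra.
split=> //.
(* A lattice vertex within 2 of a point at distance more than [L] from [a] has one coordinate at
   least [B + 8] away, hence a safe row or column; [N >= L + 2] keeps the ball of radius [L + 1] in
   the quadrant. *)
pose L := 2 * B + 18.
pose va k := ((N * 2 ^ k)%N, (N * 2 ^ k)%N).
pose E := [set z : C | exists k0, forall k, (k0 <= k)%N -> exists2 v,
  normc (pt k v - z) <= 2 * mesh k & gpath (safe X k) (va k) v].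
have [z Ez zL] : exists2 z, E z & L < normc (z - a).
  apply: contrapT => nE.
  have EL z : E z -> normc (z - a) <= L.
    by move=> Ez; rewrite leNgt; apply/negP => h; apply: nE; exists z.
  have quad (y : C) : normc (y - a) <= L + 1 ->
      complex.Re a - N%:R <= complex.Re y /\ complex.Im a - N%:R <= complex.Im y.
    move=> h; have := le_trans (normc_ReB y a) h; have := le_trans (normc_ImB y a) h.
    rewrite !ler_norml /L => /andP[h1 _] /andP[h2 _].
    by split; move: h1 h2 NB; clear; lra.
  have EX z : E z -> ~ X z.
    move=> [k0 /(_ k0 (leqnn _))[v vz gv]] Xz; have := gpath_end gv z Xz.
    by rewrite normcBC; move: vz (mesh_gt0 k0); clear; lra.
  have loc (x y z : C) d : 0 < d -> (forall w, X w -> d <= normc (w - x)) ->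
     normc (y - x) <= d / 8 -> normc (z - x) <= d / 8 -> normc (z - a) <= L + 1 -> E y -> E z.
    move=> d0 Xd yx zx za [k0 Ey].
    have [k1 k1P] := mesh_small (e := d / 16) (ltac:(by rewrite divr_gt0)).
    exists (maxn k0 k1) => k; rewrite geq_max => /andP[/Ey[v vy gv] /k1P hk].
    have [q1 q2] := quad z za; have [u uz] := floor_pt k q1 q2; exists u => //.
    apply: gpath_trans gv _; apply: (local_path Xd).
    - by move: hk; clear; lra.
    - by have := normc_dist y (pt k v) x; move: vy hk yx; clear; lra.
    - by have := normc_dist z (pt k u) x; move: uz hk zx; clear; lra.
  have [f [Bf [ef fX fa]]] := pX a Xa.
  suff : normc (f a) <= Bf by rewrite leNgt fa.
  apply: (@max_principle R f E X a (L + normc a) Bf) => //.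
  - have [d d0 dP] := compact_dist cX Xa.
    have [k0 k0P] := mesh_small (e := d / 8) (ltac:(by rewrite divr_gt0)).
    exists k0 => k /k0P hk; exists (va k); first by rewrite pt_center subrr normc0 mulr_ge0 // ltW // mesh_gt0.
    apply: gpath0 => w Xw; rewrite pt_center.
    by apply: le_trans (dP w Xw); move: hk; clear; lra.
  - by move=> z /EL h; have := normcD (z - a) a; rewrite subrK; move: h; clear; lra.
  - move=> z Ez; have [d d0 dP] := compact_dist cX (EX z Ez).
    exists (Num.min 1 (d / 8)); first by rewrite lt_min ltr01 divr_gt0.
    move=> y; rewrite lt_min => /andP[y1 yd].
    apply: (loc z z y d d0 dP _ (ltW yd)) => //.
      by rewrite subrr normc0 divr_ge0 // ltW.
    by have := normc_dist z y a; move: y1 (EL z Ez); clear; lra.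
  - move=> z nEz nXz; have [d d0 dP] := compact_dist cX nXz.
    exists (Num.min 1 (d / 8)); first by rewrite lt_min ltr01 divr_gt0.
    move=> y; rewrite lt_min => /andP[y1 yd] Ey; apply: nEz.
    apply: (loc z y z d d0 dP (ltW yd)) => //.
      by rewrite subrr normc0 divr_ge0 // ltW.
    by have := normc_dist y z a; rewrite (normcBC z y); move: y1 (EL y Ey); clear; lra.
case: Ez => k0 Ez; exists k0 => k /Ez[[i j] vz gv]; apply: gpath_trans gv _.
have : B + 8 <= `|complex.Re (pt k (i, j)) - complex.Re a| \/ B + 8 <= `|complex.Im (pt k (i, j)) - complex.Im a|.
  apply: contrapT => /not_orP[/negP h1 /negP h2]; rewrite -!ltNge in h1 h2.
  have h3 := normc_ReIm (pt k (i, j) - a).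
  have h4 := normc_dist (pt k (i, j)) z a; rewrite (normcBC z (pt k (i, j))) in h4.
  have h5 : normc (pt k (i, j) - a) < (B + 8) + (B + 8).
    by apply: le_lt_trans h3 _; apply: ltrD; rewrite /pt in h1 h2 *; case: (a) h1 h2 => ? ?.
  by move: h4 h5 zL vz (mesh_le1 k); rewrite /L; clear; lra.
case=> h.
  apply: (@gpath_trans _ _ (i, 0%N)).
    by apply: gpath_colI => m _ _; apply: (safe_far XB); left.
  by apply: gpath_rowI => m _ _; exact: row0.
apply: (@gpath_trans _ _ (0%N, j)).
  by apply: gpath_rowI => m _ _; apply: (safe_far XB); right.
by apply: gpath_colI => m _ _; exact: col0.
Qed.

Lemma pt_step k u v : gstep u v \/ gstep v u -> normc (pt k u - pt k v) <= mesh k.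
Proof.
have m0 := mesh_gt0 k.
have key x y : gstep x y -> normc (pt k x - pt k y) <= mesh k.
  case=> i j; rewrite /pt; apply: le_trans (normc_ReIm _) _ => /=;
    rewrite -!natr1 !mulrDl !mul1r.
    rewrite [X in `|X| + _](_ : _ = - mesh k); last by ring.
    by rewrite subrr normr0 addr0 normrN gtr0_norm.
  rewrite [X in _ + `|X|](_ : _ = - mesh k); last by ring.
  by rewrite subrr normr0 add0r normrN gtr0_norm.
by case=> /key //; rewrite normcBC.
Qed.

End Reach.

Section PoleTransport.
Variable R : realType.
Local Notation C := (R[i]^o).

(** The predicate [Q] separates the geometry from approximation theory: it holds far away and is
    inherited along steps short compared with the distance to the compact sets. It is carried back
    to [a] along a path avoiding both sets, supplied by [gpath_avoid2]. *)
Lemma pole_transport (K1 K2 : set C) (Q : C -> Prop) (L : R) (a : C) :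
  pconvex K1 -> pconvex K2 -> (forall z, K1 z -> K2 z -> False) ->
  (forall b, L <= normc b -> Q b) ->
  (forall v w, (forall x, K1 x \/ K2 x -> 4 * normc (v - w) <= normc (x - v)) -> Q v -> Q w) ->
  ~ K1 a -> ~ K2 a -> Q a.
Proof.
move=> p1 p2 K12 Qfar Qstep a1 a2; have [c1 _] := p1; have [c2 _] := p2.
have cf (x : C) : {for x, continuous (fun w : C => w - a : C)}.
  by apply: df_continuous; apply: dfC_B; [exact: df_id|exact: dfC_cst].
have [B1 B10 B1P] := compact_normc_bound (fun x _ => cf x) c1.
have [B2 B20 B2P] := compact_normc_bound (fun x _ => cf x) c2.
have [d d0 dP] := disjoint_dist c1 c2 K12.
pose N := Num.bound (2 * (B1 + B2) + 20 + `|L| + normc a).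
have NB : 2 * (B1 + B2) + 20 + `|L| + normc a < N%:R.
  apply: Num.Theory.archi_boundP; rewrite !addr_ge0 ?normc_ge0 //.
  by move: B10 B20; clear; lra.
have na := normc_ge0 a; have nL := normr_ge0 L; have lL := ler_norm L.
have [|[k1 g1] col1] := reach_far (N := N) p1 a1 (ltW B10) B1P.
  by move: NB na nL B20; clear; lra.
have [|[k2 g2] col2] := reach_far (N := N) p2 a2 (ltW B20) B2P.
  by move: NB na nL B10; clear; lra.
(* If one lattice square had corners near both sets, points of the two sets would be within twenty
   mesh widths of each other, less than [d]. *)
have [k3 k3P] := mesh_small (e := d / 32) (ltac:(by rewrite divr_gt0)).
pose k := maxn (maxn k1 k2) k3.
have kk1 : (k1 <= k)%N by rewrite !leq_max leqnn.
have kk2 : (k2 <= k)%N by rewrite !leq_max leqnn orbT.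
have kd : mesh R k <= d / 32 by apply: k3P; rewrite leq_max leqnn orbT.
have m0 := @mesh_gt0 R k.
pose bad (X : set C) (v : vertex) := ~~ `[<safe a N X k v>].
have nbad X v : (~~ bad X v) = `[<safe a N X k v>] by rewrite /bad negbK.
have gb X u v : gpath (safe a N X k) u v -> gpath (fun v => ~~ bad X v) u v.
  by apply: gpath_sub => x Sx; rewrite nbad; apply/asboolP.
have badP X v : bad X v -> exists2 w, X w & normc (w - pt a N k v) < 8 * mesh R k.
  move=> /asboolPn/existsNP[w /not_implyP[Xw /negP h]]; exists w => //; by rewrite ltNge.
suff : gpath (fun v => ~~ bad K1 v /\ ~~ bad K2 v) ((N * 2 ^ k)%N, (N * 2 ^ k)%N) (0%N, 0%N); last first.
  apply: gpath_avoid2 (gb _ _ _ (g1 k kk1)) (gb _ _ _ (g2 k kk2)) => [j|i j x y xF yF /badP[w1 Kw1 h1] /badP[w2 Kw2 h2]].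
    by rewrite nbad; apply/asboolP; exact: col1.
  have h3 := dP _ _ Kw1 Kw2.
  have near00 z : z \in [:: (i, j); (i.+1, j); (i, j.+1); (i.+1, j.+1)] ->
     normc (pt a N k z - pt a N k (i, j)) <= 2 * mesh R k.
    have s1 p q : normc (pt a N k (p.+1, q) - pt a N k (p, q)) <= mesh R k by apply: pt_step; right; constructor.
    have s2 p q : normc (pt a N k (p, q.+1) - pt a N k (p, q)) <= mesh R k by apply: pt_step; right; constructor.
    rewrite !inE => /or4P[] /eqP ->.
    + by rewrite subrr normc0 mulr_ge0 // ltW.
    + by move: (s1 i j) m0; clear; lra.
    + by move: (s2 i j) m0; clear; lra.
    + have := normc_dist (pt a N k (i, j.+1)) (pt a N k (i.+1, j.+1)) (pt a N k (i, j)).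
      by move: (s2 i j) (s1 i j.+1); clear; lra.
  have h4 := near00 x xF; have h5 := near00 y yF; rewrite normcBC in h5.
  have h6 := normc_dist (pt a N k x) w1 w2.
  have h7 := normc_dist (pt a N k (i, j)) (pt a N k x) w2.
  have h8 := normc_dist (pt a N k y) (pt a N k (i, j)) w2.
  rewrite (normcBC (pt a N k y) w2) in h8.
  by move: h1 h2 h3 h4 h5 h6 h7 h8 kd m0; clear; lra.
move=> /gpath_sym g.
have : Q (pt a N k (0%N, 0%N)).
  apply: Qfar; rewrite /pt /= !mul0r !addr0.
  have h1 := normc_ReB ((complex.Re a - N%:R) +i* (complex.Im a - N%:R) : C) a.
  move: h1; rewrite /= addrAC subrr add0r normrN normr_nat => h1.
  have := normcB ((complex.Re a - N%:R) +i* (complex.Im a - N%:R) : C) a.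
  by move: h1 NB lL B10 B20; clear; lra.
suff main v : gpath (fun v => ~~ bad K1 v /\ ~~ bad K2 v) (0%N, 0%N) v ->
   Q (pt a N k (0%N, 0%N)) -> Q (pt a N k v).
  by move=> /(main _ g); rewrite pt_center.
elim=> // u w gu IH uw _ /IH; apply: Qstep => x Kx.
have uw' : normc (pt a N k u - pt a N k w) <= mesh R k by exact: pt_step.
have [] := gpath_end gu; rewrite !nbad => /asboolP S1 /asboolP S2.
have : 8 * mesh R k <= normc (x - pt a N k u) by case: Kx => ?; [exact: S1|exact: S2].
by move: uw' m0; clear; lra.
Qed.

End PoleTransport.

(** * Uniform approximation by entire functions *)

Section Approximation.
Variable R : realType.
Local Notation C := (R[i]^o).
Variable K : set C.
Hypothesis cK : compact K.

Definition apx (u : C -> C) := forall e : R, 0 < e ->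
  exists2 p : C -> C, entire p & forall z, K z -> normc (p z - u z) <= e.

Lemma entire_bound (p : C -> C) : entire p ->
  exists2 B : R, 0 < B & forall z, K z -> normc (p z) <= B.
Proof. by move=> ep; apply: compact_normc_bound cK => x _; apply: df_continuous. Qed.

Lemma apx_bound (u : C -> C) : apx u -> exists2 B : R, 0 < B & forall z, K z -> normc (u z) <= B.
Proof.
move=> /(_ 1 ltr01)[p /entire_bound[B B0 BP] pu]; exists (B + 1); first by rewrite addr_gt0.
move=> z Kz; have := normcD (u z - p z) (p z); rewrite subrK normcBC.
by move: (BP z Kz) (pu z Kz); clear; lra.
Qed.

Lemma apx_ext (u v : C -> C) : (forall z, K z -> u z = v z) -> apx u -> apx v.
Proof. by move=> uv au e /au[p ep pu]; exists p => // z Kz; rewrite -uv //; exact: pu. Qed.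

Lemma apx_entire (p : C -> C) : entire p -> apx p.
Proof. by move=> ep e e0; exists p => // z _; rewrite subrr normc0 ltW. Qed.

Lemma apx_cst (c : C) : apx (fun=> c).
Proof. by apply: apx_entire => z; exact: dfC_cst. Qed.

Lemma apxD (u v : C -> C) : apx u -> apx v -> apx (fun z => u z + v z).
Proof.
move=> au av e e0; have e2 : 0 < e / 2 by rewrite divr_gt0.
have [p ep pu] := au _ e2; have [q eq qv] := av _ e2.
exists (fun z => p z + q z) => [z|z Kz]; first by apply: dfC_D; [exact: ep|exact: eq].
rewrite opprD addrACA; apply: le_trans (normcD _ _) _.
by move: (pu z Kz) (qv z Kz); clear; lra.
Qed.

Lemma apxM (u v : C -> C) : apx u -> apx v -> apx (fun z => u z * v z).
Proof.
move=> au av e e0; have [B B0 BP] := apx_bound au.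
have [q eq qv] := av (e / (2 * B)) (ltac:(by rewrite divr_gt0 // mulr_gt0)).
have [D D0 DP] := entire_bound eq.
have [p ep pu] := au (e / (2 * D)) (ltac:(by rewrite divr_gt0 // mulr_gt0)).
exists (fun z => p z * q z) => [z|z Kz]; first by apply: dfC_M; [exact: ep|exact: eq].
have -> : p z * q z - u z * v z = (p z - u z) * q z + u z * (q z - v z) by ring.
apply: le_trans (normcD _ _) _; rewrite !normcM.
have h1 : normc (p z - u z) * normc (q z) <= e / (2 * D) * D.
  by apply: ler_pM; rewrite ?normc_ge0 //; [exact: pu|exact: DP].
have h2 : normc (u z) * normc (q z - v z) <= B * (e / (2 * B)).
  by apply: ler_pM; rewrite ?normc_ge0 //; [exact: BP|exact: qv].
have e1 : e / (2 * D) * D = e / 2 by field; rewrite gt_eqF.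
have e2 : B * (e / (2 * B)) = e / 2 by field; rewrite gt_eqF.
by rewrite e1 in h1; rewrite e2 in h2; move: h1 h2; clear; lra.
Qed.

Lemma apx_prod n (u : 'I_n -> C -> C) : (forall i, apx (u i)) ->
  apx (fun z => \prod_(i < n) u i z).
Proof.
elim: n u => [|n IH] u au.
  by apply: apx_ext (apx_cst 1) => z _; rewrite big_ord0.
apply: apx_ext (apxM (au ord0) (IH (fun i => u (lift ord0 i)) (fun i => au _))) => z _.
by rewrite big_ord_recl.
Qed.

Lemma apx_lim (u : nat -> C -> C) (v : C -> C) (M : R) : 0 <= M -> (forall k, apx (u k)) ->
  (forall k z, K z -> normc (u k z - v z) <= M / 2 ^+ k) -> apx v.
Proof.
move=> M0 au uv e e0; have e2 : 0 < e / 2 by rewrite divr_gt0.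
have [k kP] := exp2_small M0 e2; have [p ep pu] := au k _ e2; exists p => // z Kz.
have := normc_dist (u k z) (p z) (v z).
by move: (pu z Kz) (uv k z Kz) (kP k (leqnn k)); clear; lra.
Qed.

(** The partial sums of the geometric series, written as u_{k+1} = 1 + v u_k, halve the error at
    each step. *)
Lemma apx_neumann (v : C -> C) : apx v -> (forall z, K z -> normc (v z) <= 1 / 2) ->
  apx (fun z => (1 - v z)^-1).
Proof.
move=> av v2; pose u := fix u k : C -> C := if k is k'.+1 then fun z => 1 + v z * u k' z else fun=> 0.
apply: (@apx_lim u _ 2) => [//|k|k z Kz].
  by elim: k => [|k IH]; [exact: apx_cst|apply: apxD (apx_cst 1) (apxM av IH)].
have vz := v2 z Kz; have n1 : 1 / 2 <= normc (1 - v z).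
  have := normcD (1 - v z) (v z); rewrite subrK normc1; move: vz; clear; lra.
have nz : 1 - v z != 0 by rewrite -normc_gt0; apply: lt_le_trans n1; rewrite divr_gt0.
elim: k => [|k IH].
  rewrite /= sub0r normcN normcV expr0 divr1 invf_ple ?posrE //; last by rewrite normc_gt0.
  by rewrite -[2^-1]mul1r.
have -> : u k.+1 z - (1 - v z)^-1 = v z * (u k z - (1 - v z)^-1) by rewrite /=; field.
rewrite normcM; apply: le_trans (ler_pM (normc_ge0 _) (normc_ge0 _) vz IH) _.
by rewrite exprS invfM mul1r mulrCA.
Qed.

Lemma apx_far_pole (b : C) (B : R) : 0 < B -> (forall z, K z -> normc z <= B) -> 2 * B <= normc b ->
  apx (fun z => (z - b)^-1).
Proof.
move=> B0 KB bB; have b0 : 0 < normc b by move: B0 bB; clear; lra.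
have nb : b != 0 by rewrite -normc_gt0.
have az : apx (fun z => z * b^-1).
  by apply: apxM; [apply: apx_entire => z; exact: df_id|exact: apx_cst].
apply: apx_ext (apxM (apx_cst (- b^-1)) (apx_neumann az _)) => [z Kz|z /KB zB].
  have -> : z - b = - b * (1 - z / b) by field.
  by rewrite invfM invrN.
rewrite normcM normcV ler_pdivrMr //; move: zB bB; clear; lra.
Qed.

(** 1/(z - w) is 1/(z - v) times a Neumann series in (w - v)/(z - v), whose modulus is at most
    1/4. *)
Lemma apx_push_pole (v w : C) : (forall z, K z -> 4 * normc (v - w) <= normc (z - v)) ->
  apx (fun z => (z - v)^-1) -> apx (fun z => (z - w)^-1).
Proof.
move=> h av.
have aq : apx (fun z => (w - v) * (z - v)^-1) by apply: apxM av; exact: apx_cst.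
apply: apx_ext (apxM av (apx_neumann aq _)) => [z Kz|z Kz].
  (* A pole on [K] is not excluded, as [0^-1 = 0]; the hypothesis then forces [v = w] and both sides
     are 0. *)
  have [zv|zv] := eqVneq (z - v) 0.
    have := h z Kz; rewrite zv normc0 => h'.
    have : normc (v - w) = 0 by apply/eqP; rewrite eq_le normc_ge0 andbT; move: h'; clear; lra.
    by move=> /(@eq0_normc R) vw; rewrite invr0 mul0r (_ : z - w = (z - v) + (v - w)); [rewrite zv vw addr0 invr0|ring].
  rewrite -invfM; congr (_^-1); field => //.
have [zv|zv] := eqVneq (z - v) 0.
  by rewrite zv invr0 mulr0 normc0 divr_ge0.
rewrite normcM normcV ler_pdivrMr ?normc_gt0 // normcBC.
by have := h z Kz; have := normc_ge0 (v - w); clear; lra.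
Qed.

(* With t = 1 - s the equation s^2 = 1 - u reads t = (u + t^2) / 2, a contraction
   on |t| <= 1/2. *)
Lemma apx_sqrt (u s : C -> C) : apx u -> (forall z, K z -> normc (u z) <= 1 / 2) ->
  (forall z, K z -> s z ^+ 2 = 1 - u z) -> (forall z, K z -> 0 <= complex.Re (s z)) -> apx s.
Proof.
move=> au u2 s2 s0.
pose t := fix t k : C -> C := if k is k'.+1 then fun z => (u z + t k' z * t k' z) * 2^-1 else fun=> 0.
have at_ k : apx (t k).
  by elim: k => [|k IH]; [exact: apx_cst|apply: apxM (apx_cst _); apply: apxD au (apxM IH IH)].
have half x : normc (x * 2^-1 : C) = normc x / 2.
  by rewrite normcM normcV (normc_nat R 2).
have lim : apx (fun z => 1 - s z).
  apply: (@apx_lim t _ 1) => // k z Kz; have uz := u2 z Kz.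
  have ns : normc (1 - s z) <= 1 / 2.
    have e : (1 - s z) * (1 + s z) = u z by have := s2 z Kz; rewrite expr2 => e; rewrite mulrDr mulr1 mulrBl mul1r e; ring.
    have h1 : 1 <= normc (1 + s z).
      apply: le_trans (normc_Re _); apply: le_trans (ler_norm _).
      by have := s0 z Kz; case: (s z) => x y /=; clear; lra.
    apply: le_trans uz; rewrite -e normcM; rewrite ler_peMr // normc_ge0 //.
  have tz j : normc (t j z) <= 1 / 2.
    elim: j => [|j IH]; first by rewrite normc0 divr_ge0.
    rewrite /= half ler_pdivrMr //; apply: le_trans (normcD _ _) _; rewrite normcM.
    have := ler_pM (normc_ge0 _) (normc_ge0 _) IH IH; move: uz; clear; lra.
  elim: k => [|k IH].
    by rewrite /= sub0r normcN expr0 divr1; move: ns; clear; lra.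
  have -> : t k.+1 z - (1 - s z) = (t k z - (1 - s z)) * (t k z + (1 - s z)) * 2^-1.
    have := s2 z Kz; rewrite expr2 /= => e.
    have -> : u z = 1 - s z * s z by rewrite e; ring.
    by field.
  rewrite half normcM exprS invfM mulrCA mulrC ler_pM2l // mulrC.
  have h1 : normc (t k z + (1 - s z)) <= 1.
    by apply: le_trans (normcD _ _) _; move: (tz k) ns; clear; lra.
  apply: le_trans IH; rewrite ler_piMl ?normc_ge0 //.
apply: apx_ext (apxD (apx_cst 1) (apxM (apx_cst (-1)) lim)) => z _; ring.
Qed.

End Approximation.

Lemma apx_pole (R : realType) (K1 K2 : set R[i]^o) (a : R[i]^o) :
  pconvex K1 -> pconvex K2 -> (forall z, K1 z -> K2 z -> False) ->
  ~ K1 a -> ~ K2 a -> apx (K1 `|` K2) (fun z => (z - a)^-1).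
Proof.
move=> p1 p2 K12 a1 a2; have cK : compact (K1 `|` K2).
  by apply: compactU; [exact: p1.1|exact: p2.1].
have [B B0 BP] := compact_normc_bound (fun x _ => @id_continuous_C R x) cK.
apply: (pole_transport (Q := fun a => apx (K1 `|` K2) (fun z => (z - a)^-1)) p1 p2 K12) a1 a2.
  move=> b; exact: (apx_far_pole cK B0 BP).
move=> v w h; apply: (apx_push_pole cK) => z Kz; exact: h.
Qed.

(** * Square roots along grid edges and the separating function *)

Section Idempotent.
Variable R : realType.
Local Notation C := (R[i]^o).

(** Records the quadrant of the principal root, and that comparing its real part with the modulus of
    its imaginary part tells the sign of the real part of [w]. *)
Lemma sqrt_pos_part (w : C) : exists x y : R,
  [/\ 0 <= x, 0 <= y, sqrtc w = x +i* (if 0 <= complex.Im w then y else - y) &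
      (x <= y) = (complex.Re w <= 0) /\ (y <= x) = (0 <= complex.Re w)].
Proof.
case: w => a b /=; set r := Num.sqrt (a ^+ 2 + b ^+ 2).
have ar : `|a| <= r.
  by rewrite -sqrtr_sqr ler_wsqrtr // lerDl sqr_ge0.
have : - r <= a <= r by rewrite -ler_norml.
move=> /andP[a1 a2].
exists (Num.sqrt ((r + a) / 2)), (Num.sqrt ((r - a) / 2)); split; rewrite ?sqrtr_ge0 //.
  congr (_ +i* _); case: (eqVneq b 0) => [->|b0]; first by rewrite lexx mul1r.
  by case: ltrgt0P b0 => // b0 _; [rewrite gtr0_sg // mul1r|rewrite ltr0_sg // mulN1r].
have h1 : 0 <= (r + a) / 2 by move: a1; clear; lra.
have h2 : 0 <= (r - a) / 2 by move: a2; clear; lra.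
by rewrite !ler_sqrt //; split; apply/idP/idP; clear; lra.
Qed.

(* The argument of [sqrtc] jumps exactly across the negative real axis. *)
Definition flip (A B : C) : bool :=
  (complex.Re A <= 0) && ((0 <= complex.Im A) (+) (0 <= complex.Im B)).

(** The quotient of roots is a square root of B/A, and [flip] supplies the sign that puts it in the
    right half-plane. Points on a common horizontal never jump; on a common vertical a jump happens
    only left of the origin. *)
Lemma sqrt_quotient_Re (A B : C) :
  complex.Im A = complex.Im B \/ complex.Re A = complex.Re B ->
  0 <= complex.Re ((-1) ^+ flip A B * (sqrtc B / sqrtc A)).
Proof.
move=> AB; have [x [y [x0 y0 -> [xy yx]]]] := sqrt_pos_part A.
have [x' [y' [x0' y0' -> [xy' yx']]]] := sqrt_pos_part B.
have key (e : bool) (u v u' v' : R) :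
    0 <= (-1) ^+ e * (u' * u + v' * v) ->
    0 <= complex.Re ((-1) ^+ e * ((u' +i* v' : C) / (u +i* v))).
  move=> h; rewrite (_ : complex.Re _ = (-1) ^+ e * (u' * u + v' * v) / (u ^+ 2 + v ^+ 2)).
    by rewrite divr_ge0 // addr_ge0 ?sqr_ge0.
  by case: e {h}; rewrite ?expr0 ?expr1 /=; ring.
apply: key; rewrite /flip.
have xx := mulr_ge0 x0' x0; have yy := mulr_ge0 y0' y0.
case: AB => AB.
  rewrite AB addbb andbF expr0 mul1r; case: ifP => _; rewrite ?mulrNN; exact: addr_ge0.
rewrite AB -AB -xy.
case: (0 <= complex.Im A); case: (0 <= complex.Im B); rewrite ?andbF ?andbT ?expr0 ?mul1r ?mulrNN ?addr_ge0 //=.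
  case: (leP x y) => h; rewrite ?expr0 ?expr1.
    have h' : x' <= y' by rewrite xy' -AB -xy.
    by have := ler_pM x0' x0 h' h; clear; nra.
  have h1 : y <= x := ltW h; have h' : y' <= x' by rewrite yx' -AB -yx.
  by have := ler_pM y0' y0 h' h1; clear; nra.
case: (leP x y) => h; rewrite ?expr0 ?expr1.
  have h' : x' <= y' by rewrite xy' -AB -xy.
  by have := ler_pM x0' x0 h' h; clear; nra.
have h1 : y <= x := ltW h; have h' : y' <= x' by rewrite yx' -AB -yx.
by have := ler_pM y0' y0 h' h1; clear; nra.
Qed.

(* The value at 0 only has to be nonzero: it occurs at interior vertices, whose
   contributions cancel. *)
Definition rt (w : C) : C := if w == 0 then 1 else sqrtc w.

Lemma rt_neq0 w : rt w != 0.
Proof. by rewrite /rt; case: ifPn => [_|w0]; rewrite ?oner_eq0 // sqrtc_eq0. Qed.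

(** Off the poles this is the root with nonnegative real part of 1 - (q - p)/(z - p), and the
    distance condition makes the subtracted term at most 1/2 in modulus, as [apx_sqrt] requires. *)
Lemma apx_edge (K : set C) (p q : C) : compact K -> p != q ->
  complex.Im p = complex.Im q \/ complex.Re p = complex.Re q ->
  (forall z, K z -> 2 * normc (q - p) <= normc (z - p)) ->
  (forall z, K z -> z != q) ->
  apx K (fun z => (z - p)^-1) ->
  apx K (fun z => (-1) ^+ flip (z - p) (z - q) * (rt (z - q) / rt (z - p))).
Proof.
move=> cK pq hv far zq ap.
have zp z : K z -> z - p != 0.
  move=> Kz; rewrite -normc_gt0; apply: lt_le_trans (far z Kz).
  by rewrite mulr_gt0 // normc_gt0 subr_eq0 eq_sym.
have zq' z : K z -> z - q != 0 by move=> /zq; rewrite subr_eq0.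
apply: (apx_sqrt cK (u := fun z => (q - p) * (z - p)^-1)).
- by apply: (apxM cK) ap; exact: apx_cst.
- move=> z Kz; rewrite normcM normcV ler_pdivrMr ?normc_gt0 ?zp //.
  by have := far z Kz; clear; lra.
- move=> z Kz; rewrite exprMn sqrr_sign mul1r exprMn exprVn /rt (negbTE (zp z Kz)) (negbTE (zq' z Kz)).
  by rewrite !sqr_sqrtc; field; exact: zp.
move=> z Kz; rewrite /rt (negbTE (zp z Kz)) (negbTE (zq' z Kz)).
apply: sqrt_quotient_Re; case: z p q hv {Kz far zq ap pq zp zq'} => [? ?] [? ?] [? ?] /=.
by case=> ->; [left|right].
Qed.

(** Shifting indices turns a product over edges into a product over faces; there are no boundary
    terms because [u] vanishes on the border. *)
Lemma summation_by_parts (n : nat) (u : nat -> nat -> bool) (h v : nat -> nat -> C) :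
  (forall i j, h i j != 0) -> (forall i j, v i j != 0) ->
  (forall j, u 0%N j = false) -> (forall j, u n j = false) ->
  (forall i, u i 0%N = false) -> (forall i, u i n = false) ->
  \prod_(i < n) \prod_(j < n)
    (h i j.+1 ^+ u i j.+1 / h i j.+1 ^+ u i j * (v i.+1 j ^+ u i j / v i.+1 j ^+ u i.+1 j)) =
  \prod_(i < n) \prod_(j < n) (h i j / h i j.+1 * (v i.+1 j / v i j)) ^+ u i j.
Proof.
move=> h0 v0 u0 un u0' un'.
have shift (f : nat -> C) : f 0%N = 1 -> f n = 1 -> \prod_(j < n) f j.+1 = \prod_(j < n) f j.
  move=> f0 fn; have : \prod_(j < n.+1) f j = \prod_(j < n.+1) f j by [].
  by rewrite {1}big_ord_recl big_ord_recr /= f0 fn mul1r mulr1.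
transitivity (\prod_(i < n) \prod_(j < n) (h i j ^+ u i j / h i j.+1 ^+ u i j) *
   \prod_(i < n) \prod_(j < n) (v i.+1 j ^+ u i j / v i j ^+ u i j)).
  rewrite -big_split /=; under eq_bigr do rewrite big_split /=.
  rewrite big_split /= [in RHS]big_split /=; congr (_ * _).
    apply: eq_bigr => i _; rewrite !prodf_div; congr (_ / _).
    by apply: (shift (fun j => h i j ^+ u i j)); rewrite ?u0' ?un' expr0.
  rewrite exchange_big [RHS]exchange_big /=; apply: eq_bigr => j _; rewrite !prodf_div; congr (_ / _).
  by apply: (shift (fun i => v i j ^+ u i j)); rewrite ?u0 ?un expr0.
rewrite -big_split /=; apply: eq_bigr => i _; rewrite -big_split /=; apply: eq_bigr => j _.
by case: (u i j); rewrite ?expr0 ?expr1 ?divr1 ?mulr1.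
Qed.

End Idempotent.

Section Idempotent.
Variable R : realType.
Local Notation C := (R[i]^o).

Lemma flip_sym (A B : C) : complex.Im A = complex.Im B \/ complex.Re A = complex.Re B ->
  flip A B = flip B A.
Proof. by rewrite /flip => -[] ->; rewrite ?addbb ?andbF // addbC. Qed.

(** The edge factor is written through roots attached to vertices, so that around a face the roots
    cancel and only the signs remain. *)
Definition quot (p q z : C) : C := (-1) ^+ flip (z - p) (z - q) * (rt (z - q) / rt (z - p)).

Lemma quot_neq0 p q z : quot p q z != 0.
Proof. by rewrite /quot !mulf_neq0 ?invr_eq0 ?rt_neq0 // signr_eq0. Qed.

(** The exponents say whether the two faces along the edge are selected. If they agree the factor is
    1, even when the edge meets the compact sets, so distance is demanded only when they differ. *)
Lemma apx_edge_pow (K1 K2 : set C) (p q : C) (b1 b2 : bool) :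
  pconvex K1 -> pconvex K2 -> (forall z, K1 z -> K2 z -> False) -> p != q ->
  complex.Im p = complex.Im q \/ complex.Re p = complex.Re q ->
  (b1 != b2 -> forall z, (K1 `|` K2) z ->
     2 * normc (q - p) <= normc (z - p) /\ 2 * normc (q - p) <= normc (z - q)) ->
  apx (K1 `|` K2) (fun z => quot p q z ^+ b1 / quot p q z ^+ b2).
Proof.
move=> p1 p2 K12 pq hv far.
have cK : compact (K1 `|` K2) by apply: compactU; [exact: p1.1|exact: p2.1].
have [b12|/far{}far] := eqVneq b1 b2.
  by apply: apx_ext (apx_cst _ 1) => z _; rewrite b12 divff // expf_neq0 // quot_neq0.
have d0 : 0 < 2 * normc (q - p) by rewrite mulr_gt0 // normc_gt0 subr_eq0 eq_sym.
have Kp : ~ (K1 `|` K2) p by move=> /far[]; rewrite subrr normc0 leNgt d0.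
have Kq : ~ (K1 `|` K2) q by move=> /far[_]; rewrite subrr normc0 leNgt d0.
have ap : apx (K1 `|` K2) (fun z => (z - p)^-1).
  by apply: apx_pole => // h; apply: Kp; [left|right].
have aq : apx (K1 `|` K2) (fun z => (z - q)^-1).
  by apply: apx_pole => // h; apply: Kq; [left|right].
have nK x : ~ (K1 `|` K2) x -> forall z, (K1 `|` K2) z -> z != x.
  by move=> Kx z Kz; apply: contra_notN Kx => /eqP <-.
have P1 : apx (K1 `|` K2) (quot p q).
  by apply: (apx_edge cK pq hv (fun z Kz => (far z Kz).1) (nK _ Kq) ap).
have P2 : apx (K1 `|` K2) (fun z => (quot p q z)^-1).
  have qp : q != p by rewrite eq_sym.
  have hv' : complex.Im q = complex.Im p \/ complex.Re q = complex.Re p by case: hv => ->; [left|right].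
  have far' z : (K1 `|` K2) z -> 2 * normc (p - q) <= normc (z - q).
    by move=> Kz; rewrite normcBC; exact: (far z Kz).2.
  apply: apx_ext (apx_edge cK qp hv' far' (nK _ Kp) aq) => z Kz.
  rewrite /quot [in RHS]flip_sym; last by case: z p q hv {pq far d0 Kp Kq ap aq nK P1 qp hv' far' Kz} => [? ?] [? ?] [? ?] /= [] ->; [left|right].
  rewrite !invfM invrK [rt (z - p) * _]mulrC; congr (_ * _).
  by case: (flip _ _); rewrite ?expr0 ?expr1 ?invrN invr1.
case: b1 b2 => [] [] //.
- by apply: apx_ext (apx_cst _ 1) => z _; rewrite divff // quot_neq0.
- by apply: apx_ext P1 => z _; rewrite divr1.
- by apply: apx_ext P2 => z _; rewrite mul1r.
by apply: apx_ext (apx_cst _ 1) => z _; rewrite divr1.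
Qed.

(** Cells are closed on the right for real parts and, in [grid_left], on the left for imaginary
    parts, as the weak inequalities in [flip] dictate. *)
Lemma grid_right (x : R) n : 0 < x -> x <= n%:R -> exists2 i, (i < n)%N & i%:R < x <= i.+1%:R.
Proof.
move=> x0; elim: n => [|n IH] xn; first by move: xn; rewrite leNgt x0.
have [/IH[i i_n ix]|nx] := leP x n%:R; first by exists i => //; exact: ltnW.
by exists n => //; rewrite nx.
Qed.

Lemma grid_left (x : R) n : 0 <= x -> x < n%:R -> exists2 i, (i < n)%N & i%:R <= x < i.+1%:R.
Proof.
move=> x0; elim: n => [|n IH] xn; first by move: xn; rewrite ltNge x0.
have [/IH[i i_n ix]|nx] := ltP x n%:R; first by exists i => //; exact: ltnW.
by exists n => //; rewrite nx.
Qed.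

(* [u i j] selects the faces near K2. The product T only involves edges between
   a selected and an unselected face; summed by parts it becomes a product over
   the selected faces, whose only nontrivial factor is -1, at the face of z. *)
Lemma disjoint_idempotent (K1 K2 : set C) (e : R) : 0 < e ->
  pconvex K1 -> pconvex K2 -> (forall z, K1 z -> K2 z -> False) ->
  exists p : C -> C, [/\ entire p, forall z, K1 z -> normc (p z) <= e &
    forall z, K2 z -> normc (p z - 1) <= e].
Proof.
move=> e0 p1 p2 K12.
have cK : compact (K1 `|` K2) by apply: compactU; [exact: p1.1|exact: p2.1].
have [B B0 BP] := compact_normc_bound (fun x _ => @id_continuous_C R x) cK.
have [d d0 dP] := disjoint_dist p1.1 p2.1 K12.
have [k0 /(_ k0 (leqnn _)) kd] := @mesh_small R (d / 32) (ltac:(by rewrite divr_gt0)).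
pose N := Num.bound (B + 20).
have NB : B + 20 < N%:R by apply: Num.Theory.archi_boundP; rewrite addr_ge0 // ltW.
pose n := (2 * N * 2 ^ k0)%N; pose m := mesh R k0; have m0 : 0 < m := mesh_gt0 R k0.
have m1 : m <= 1 := mesh_le1 R k0.
have nm : n%:R * m = 2 * N%:R.
  by rewrite /n /m /mesh !natrM natrX mulfK // expf_neq0 // pnatr_eq0.
pose P i j : C := pt 0 N k0 (i, j).
have PE i j : P i j = (- N%:R + i%:R * m) +i* (- N%:R + j%:R * m) by rewrite /P /pt /= !add0r.
(* A face is represented by its lower left corner and selected when that corner is within eight mesh
   widths of [K2]. *)
pose S := safe 0 N K2 k0; pose u i j : bool := ~~ `[<S (i, j)>].
have uN i j : S (i, j) -> u i j = false by move=> h; apply/negbTE; rewrite negbK; apply/asboolP.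
have B2 w : K2 w -> normc (w - 0) <= B by move=> Kw; rewrite subr0; apply: BP; right.
have u1 j : u 0%N j = false.
  apply/uN/(safe_far B2); left; rewrite -/(P 0%N j) PE /= mul0r addr0 subr0 normrN normr_nat.
  by move: NB; clear; lra.
have u2 j : u n j = false.
  apply/uN/(safe_far B2); left; rewrite -/(P n j) PE /= nm subr0 (_ : - N%:R + 2 * N%:R = N%:R); last by ring.
  by rewrite normr_nat; move: NB; clear; lra.
have u3 i : u i 0%N = false.
  apply/uN/(safe_far B2); right; rewrite -/(P i 0%N) PE /= mul0r addr0 subr0 normrN normr_nat.
  by move: NB; clear; lra.
have u4 i : u i n = false.
  apply/uN/(safe_far B2); right; rewrite -/(P i n) PE /= nm subr0 (_ : - N%:R + 2 * N%:R = N%:R); last by ring.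
  by rewrite normr_nat; move: NB; clear; lra.
have stepH i j : normc (P i.+1 j - P i j) = m.
  rewrite !PE -natr1 mulrDl mul1r (_ : _ - _ = m%:C).
    by rewrite normc_real gtr0_norm.
  by apply/eqP; rewrite eq_complex /=; apply/andP; split; apply/eqP; ring.
have stepV i j : normc (P i j.+1 - P i j) = m.
  rewrite !PE -natr1 mulrDl mul1r (_ : _ - _ = 'i * m%:C).
    by rewrite normcM normci mul1r normc_real gtr0_norm.
  by apply/eqP; rewrite eq_complex /=; apply/andP; split; apply/eqP; ring.
(* Next to an unselected corner [K2] is far away; next to a selected one some point of [K2] is
   close, so [K1] is far away. An edge between the two kinds is thus far from both sets. *)
have farc x c1 c2 : S c1 -> ~ S c2 -> normc (x - pt 0 N k0 c1) <= 2 * m ->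
    normc (x - pt 0 N k0 c2) <= 2 * m -> forall z, (K1 `|` K2) z -> 2 * m <= normc (z - x).
  move=> S1 /existsNP[w /not_implyP[Kw /negP]]; rewrite -ltNge => wc x1 x2 z [Kz|Kz].
    have h1 := dP _ _ Kz Kw; have h2 := normc_dist x z w; have h3 := normc_dist (pt 0 N k0 c2) x w.
    rewrite (normcBC (pt 0 N k0 c2) w) in h3.
    by move: h1 h2 h3 x2 wc kd m0; rewrite -/m; clear; lra.
  have h1 := S1 z Kz; have h2 := normc_dist x z (pt 0 N k0 c1).
  by move: h1 h2 x1 m0; rewrite -/m; clear; lra.
have far x i j i' j' : u i j != u i' j' -> normc (x - P i j) <= 2 * m ->
    normc (x - P i' j') <= 2 * m -> forall z, (K1 `|` K2) z -> 2 * m <= normc (z - x).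
  move=> uu x1 x2; have [S1|S1] := pselect (S (i, j)); have [S2|S2] := pselect (S (i', j')).
  - by move: uu; rewrite !uN.
  - exact: (farc x _ _ S1 S2 x1 x2).
  - exact: (farc x _ _ S2 S1 x2 x1).
  - move: uu; rewrite /u (asboolF S1) (asboolF S2) //.
have [d1 d2] : (forall i j, normc (P i j - P i j) <= 2 * m) /\ m <= 2 * m.
  by split=> [i j|]; [rewrite subrr normc0|]; move: m0; clear; lra.
have dH i j : normc (P i.+1 j - P i j) <= 2 * m by rewrite stepH.
have dV i j : normc (P i j.+1 - P i j) <= 2 * m by rewrite stepV.
have dD i j : normc (P i.+1 j.+1 - P i j) <= 2 * m.
  have := normc_dist (P i j.+1) (P i.+1 j.+1) (P i j); rewrite stepH stepV.
  by move: m0; clear; lra.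
pose h i j := quot (P i j) (P i.+1 j); pose v i j := quot (P i j) (P i j.+1).
pose T z := \prod_(i < n) \prod_(j < n)
    (h i j.+1 z ^+ u i j.+1 / h i j.+1 z ^+ u i j * (v i.+1 j z ^+ u i j / v i.+1 j z ^+ u i.+1 j)).
have aT : apx (K1 `|` K2) T.
  apply: (apx_prod cK) => i; apply: (apx_prod cK) => j; apply: (apxM cK); apply: apx_edge_pow => //.
  - by rewrite eq_sym -subr_eq0 -normc_gt0 stepH.
  - by left; rewrite !PE.
  - rewrite stepH => uu z Kz; split; apply: (far _ _ _ _ _ uu) Kz.
    + exact: d1. + exact: dV. + exact: dH. + exact: dD.
  - by rewrite eq_sym -subr_eq0 -normc_gt0 stepV.
  - by right; rewrite !PE.
  - rewrite stepV => uu z Kz; split; apply: (far _ _ _ _ _ uu) Kz.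
    + exact: dH. + exact: d1. + exact: dD. + exact: dV.
pose X i : R := - N%:R + i%:R * m.
(* [g z i j] says that [z] lies in the half-open face [(i, j)]; the root attached to a vertex jumps
   across the horizontal ray to its left. *)
pose g (z : C) i j : bool := [&& X i < complex.Re z, complex.Re z <= X i.+1, X j <= complex.Im z & complex.Im z < X j.+1].
have XS i : X i.+1 = X i + m by rewrite /X -natr1 mulrDl mul1r addrA.
have TE z : T z = \prod_(i < n) \prod_(j < n) ((-1) ^+ g z i j) ^+ u i j.
  rewrite /T (@summation_by_parts R n u (fun i j => h i j z) (fun i j => v i j z)) //; try by move=> *; exact: quot_neq0.
  apply: eq_bigr => i _; apply: eq_bigr => j _; congr (_ ^+ _).
  have fh i' j' : flip (z - P i' j') (z - P i'.+1 j') = false.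
    by rewrite /flip !PE; case: (z) => ? ? /=; rewrite addbb andbF.
  have fv i' : flip (z - P i' j) (z - P i' j.+1) = (complex.Re z <= X i') && (X j <= complex.Im z < X j.+1).
    rewrite /flip !PE -/(X _) -/(X j) -/(X j.+1); case: (z) => x y /=.
    rewrite subr_le0 !subr_ge0 XS; congr (_ && _).
    case: (leP (X j) y) => h1 /=; first by rewrite ltNge.
    by apply/negbTE; rewrite -ltNge; move: h1 m0; clear; lra.
  rewrite /h /v /quot !fh !fv expr0 !mul1r.
  have r1 := rt_neq0 (z - P i j); have r2 := rt_neq0 (z - P i.+1 j).
  have r3 := rt_neq0 (z - P i j.+1); have r4 := rt_neq0 (z - P i.+1 j.+1).
  (* The four roots cancel around the face and horizontal edges have no sign. The two vertical edges
     have different signs exactly when [z] is in the face. *)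
  transitivity ((-1) ^+ ((complex.Re z <= X i.+1) && (X j <= complex.Im z < X j.+1)) *
    (-1) ^+ ((complex.Re z <= X i) && (X j <= complex.Im z < X j.+1)) : C).
    move: ((complex.Re z <= X i.+1) && _) ((complex.Re z <= X i) && _) => b1 b2.
    move: r1 r2 r3 r4; move: (rt _) (rt _) (rt _) (rt _) => a1 a2 a3 a4 r1 r2 r3 r4.
    by case: b1; case: b2; rewrite ?expr0 ?expr1; field; rewrite ?r1 ?r2 ?r3 ?r4.
  rewrite /g XS; case: (X j <= _ < _); rewrite ?andbF ?expr0 ?mul1r // !andbT.
  case: (leP (complex.Re z) (X i)) => h1.
    have -> : complex.Re z <= X i + m by move: h1 m0; clear; lra.
    by rewrite expr1 mulrNN mulr1.
  by rewrite expr0 mulr1.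
have gP z i j : g z i j -> normc (z - P i j) <= 2 * m.
  rewrite /g !XS PE => /and4P[g1 g2 g3 g4]; apply: le_trans (normc_ReIm _) _.
  rewrite (_ : 2 * m = m + m); last by ring.
  apply: lerD; move: g1 g2 g3 g4; rewrite /X; case: (z) => x y /=; clear; rewrite ler_norml => *; lra.
have T1 z : K1 z -> T z = 1.
  move=> Kz; rewrite TE; apply: big1 => i _; apply: big1 => j _.
  case: (boolP (u i j)) => [|_]; last by rewrite expr0.
  move=> /asboolPn/existsNP[w /not_implyP[Kw /negP]]; rewrite -ltNge => wc.
  case: (boolP (g z i j)) => [/gP zP|_]; last by rewrite expr0 expr1.
  exfalso; have h1 := dP _ _ Kz Kw; have h2 := normc_dist (P i j) z w.
  rewrite (normcBC (P i j) w) in h2.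
  by move: h1 h2 zP wc kd m0; rewrite -/(P i j) -/m; clear; lra.
have T2 z : K2 z -> T z = -1.
  move=> Kz; rewrite TE; have zB : normc z <= B by apply: BP; right.
  have zr := le_trans (normc_Re z) zB; have zi := le_trans (normc_Im z) zB.
  rewrite ler_norml in zr; rewrite ler_norml in zi; case/andP: zr => zr1 zr2; case/andP: zi => zi1 zi2.
  have [i0 i0n /andP[i1 i2]] : exists2 i0, (i0 < n)%N & i0%:R < (complex.Re z + N%:R) / m <= i0.+1%:R.
    apply: grid_right; first by rewrite divr_gt0 //; move: zr1 NB; clear; lra.
    by rewrite ler_pdivrMr // nm; move: zr2 NB; clear; lra.
  have [j0 j0n /andP[j1 j2]] : exists2 j0, (j0 < n)%N & j0%:R <= (complex.Im z + N%:R) / m < j0.+1%:R.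
    apply: grid_left; first by rewrite divr_ge0 // ?(ltW m0) //; move: zi1 NB; clear; lra.
    by rewrite ltr_pdivrMr // nm; move: zi2 NB; clear; lra.
  rewrite ltr_pdivlMr // in i1; rewrite ler_pdivrMr // in i2.
  rewrite ler_pdivlMr // in j1; rewrite ltr_pdivrMr // in j2.
  have g0 : g z i0 j0.
    by apply/and4P; split; rewrite /X; move: i1 i2 j1 j2; clear; lra.
  have u0 : u i0 j0.
    rewrite /u; apply/asboolPn => /(_ z Kz); rewrite -/(P i0 j0) -/m.
    by have := gP _ _ _ g0; move: m0; clear; lra.
  have gu i j : g z i j -> i = i0 /\ j = j0.
    have nle a b : a%:R * m < b.+1%:R * m -> (a <= b)%N by rewrite ltr_pM2r // ltr_nat ltnS.
    move=> /and4P[]; rewrite /X => g1 g2 g3 g4; split; apply/eqP; rewrite eqn_leq; apply/andP; split; apply: nle.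
    - by move: g1 i2; clear; lra.
    - by move: i1 g2; clear; lra.
    - by move: g3 j2; clear; lra.
    - by move: j1 g4; clear; lra.
  rewrite (bigD1 (Ordinal i0n)) //= (bigD1 (Ordinal j0n)) //= g0 u0 !expr1 big1; last first.
    move=> j jj; case: (boolP (g z i0 j)) => [/gu[_ e']|_]; last by rewrite expr0 expr1n.
    by move: jj; rewrite -(inj_eq val_inj) /= e' eqxx.
  rewrite mulr1 big1 ?mulr1 // => i ii; apply: big1 => j _.
  case: (boolP (g z i j)) => [/gu[e' _]|_]; last by rewrite expr0 expr1n.
  by move: ii; rewrite -(inj_eq val_inj) /= e' eqxx.
(* (1 - T)/2 converts the values 1 and -1 into 0 and 1. *)
have aR : apx (K1 `|` K2) (fun z => 2^-1 * (1 + (-1) * T z)).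
  by apply: (apxM cK (apx_cst _ _)); apply: apxD (apx_cst _ _) (apxM cK (apx_cst _ _) aT).
have [p ep pP] := aR e e0; exists p; split => // z Kz.
  have := pP z (or_introl Kz); rewrite T1 // mulr1 subrr mulr0 subr0 //.
have := pP z (or_intror Kz); rewrite T2 // mulrNN mulr1 mulVf //.
Qed.

End Idempotent.

(** * Polynomial hulls and separation by an entire function *)

Section Hull.
Variable R : realType.
Local Notation C := (R[i]^o).

Lemma pconvex_hull (X : set C) : pconvex (polynomial_hull X).
Proof.
split; last first.
  move=> z /existsNP[f /not_implyP[ef /negP]]; rewrite -ltNge => fz.
  by exists f, (sup [set normc (f w) | w in X]); split => // w; apply.
have h := @closed_bounded_compact R (polynomial_hull X) (sup [set normc w | w in X]).
apply: h => [z zX f ef|z /(_ (fun w => w))]; last by apply => w; exact: df_id.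
apply/ler_addgt0Pr => e e0.
have [d d0 dP] := (continuous_rn f z).1 (df_continuous (ef z)) e e0.
have [y Xy yz] := zX d d0; have := dP y; rewrite !rnC => /(_ yz) fyz.
have := normcD (f z - f y) (f y); rewrite subrK normcBC; have := Xy f ef.
by move: fyz; clear; lra.
Qed.

Lemma sub_hull (X : set C) : compact X -> X `<=` polynomial_hull X.
Proof.
move=> cX z Xz f ef; have [B B0 BP] := @entire_bound R X cX f ef.
by apply: ub_le_sup; [exists B => _ [w Xw <-]; exact: BP|exists z].
Qed.

Lemma separation (T : topologicalType) (F : T -> C) (K L : set T) (e : R) : 0 < e ->
  continuous F -> compact K -> compact L ->
  polynomial_hull (F @` K) `&` polynomial_hull (F @` L) = set0 ->
  exists p : C -> C, [/\ entire p, forall z, K z -> normc (p (F z)) <= e &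
    forall z, L z -> normc (p (F z) - 1) <= e].
Proof.
move=> e0 cF cK cL KL.
have cK' : compact (F @` K) by apply: continuous_compact => //; exact: continuous_subspaceT.
have cL' : compact (F @` L) by apply: continuous_compact => //; exact: continuous_subspaceT.
have dis z : polynomial_hull (F @` K) z -> polynomial_hull (F @` L) z -> False.
  by move=> h1 h2; have : set0 z by rewrite -KL.
have [p [ep p1 p2]] := disjoint_idempotent e0 (pconvex_hull _) (pconvex_hull _) dis.
exists p; split => // z Kz; [apply: p1|apply: p2]; apply: sub_hull => //; by exists z.
Qed.

(** Closed discs are polynomially convex, as the function z - c shows; for empty [K] the supremum is
    0, which is why [0 <= r] is assumed. *)
Lemma hull_disc (T : Type) (F : T -> C) (K : set T) (c : C) (r : R) : 0 <= r ->
  (forall z, K z -> normc (F z - c) <= r) ->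
  forall w, polynomial_hull (F @` K) w -> normc (w - c) <= r.
Proof.
move=> r0 Kr w /(_ (fun z => z - c)) h; apply: le_trans (h _) _.
  by move=> z; apply: dfC_B; [exact: df_id|exact: dfC_cst].
have [K0|/set0P K0] := eqVneq K set0.
  by rewrite K0 !image_set0 sup0.
apply: ge_sup => [|_ [_ [z Kz <-] <-]]; last exact: Kr.
by case: K0 => z Kz; exists (normc (F z - c)), (F z) => //; exists z.
Qed.

End Hull.

(** * Holomorphic functions on a manifold *)

Section Charts.
Variables (R : realType) (N : nat) (M : complexManifold R N).
Local Notation C := (R[i]^o).
Implicit Types (c d : chart R N M) (z : M) (f g : M -> C).

Lemma chart_ball c z (A : set M) : chart_dom c z -> nbhs z A ->
  exists2 r : R, 0 < r & forall y, rn (y - chart_to c z) < r ->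
    exists x, [/\ A x, chart_dom c x, chart_to c x = y & chart_from c y = x].
Proof.
move=> cz zA.
have cf : chart_from c @ chart_to c z --> z.
  rewrite -[X in _ --> X](chart_toK cz).
  have := @chart_from_continuous _ _ _ c.
  rewrite (continuous_open_subspace _ (@chart_img_open _ _ _ c)).
  by apply; apply/mem_set; exists z.
have n1 : nbhs (chart_to c z) (chart_from c @^-1` A) by exact: cf.
have n2 : nbhs (chart_to c z) (chart_to c @` chart_dom c).
  by apply: open_nbhs_nbhs; split; [exact: chart_img_open|exists z].
have [r r0 rP] := (@nbhs_rn _ 'rV[R[i]]_N _ _).1 (filterI n1 n2).
exists r => // y /rP[Ay [x cx xy]]; exists x; split => //.
  by move: Ay; rewrite /= -xy chart_toK.
by rewrite -xy chart_toK.
Qed.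

Lemma chart_nbhs c z (r : R) : chart_dom c z -> 0 < r ->
  nbhs z [set x | chart_dom c x /\ rn (chart_to c x - chart_to c z) < r].
Proof.
move=> cz r0; have ct : chart_to c @ z --> chart_to c z.
  have := @chart_to_continuous _ _ _ c.
  rewrite (continuous_open_subspace _ (@chart_dom_open _ _ _ c)).
  by apply; exact: mem_set.
apply: filterI; first by apply: open_nbhs_nbhs; split; [exact: chart_dom_open|].
by apply: (ct [set y | rn (y - chart_to c z) < r]); apply/(@nbhs_rn _ 'rV[R[i]]_N); exists r.
Qed.

Lemma chart_to_inj c z w : chart_dom c z -> chart_dom c w -> chart_to c z = chart_to c w -> z = w.
Proof. by move=> cz cw zw; rewrite -(chart_toK cz) zw chart_toK. Qed.

(** Compatibility of the atlas transports differentiability from one chart around each point to all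
    of them. *)
Lemma holo_at_chart (U : set M) f : (forall z, U z -> exists c, [/\ atlas c, chart_dom c z &
    differentiable (f \o chart_from c) (chart_to c z)]) -> holomorphic_on U f.
Proof.
move=> H d ad z Uz dz; have [c [ac cz df]] := H z Uz.
have [r r0 rP] := chart_ball dz (open_nbhs_nbhs (conj (@chart_dom_open _ _ _ c) cz)).
apply: (@near_eq_df _ _ _ (fun y => (f \o chart_from c) ((chart_to c \o chart_from d) y)) _ _ r r0).
  by move=> y /rP[x [cx dx xy yx]]; rewrite /= yx chart_toK.
apply: (@df_comp _ _ _ _ (chart_to c \o chart_from d) (f \o chart_from c)).
  exact: atlas_compatible.
by rewrite /= (chart_toK dz).
Qed.

Lemma holo_continuous_at (U : set M) (W : normedModType R[i]) (f : M -> W) z :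
  holomorphic_on U f -> U z -> {for z, continuous f}.
Proof.
move=> hf Uz; have [c ac cz] := atlas_cover z; have := df_continuous (hf c ac z Uz cz).
move=> cf A /= zA.
have zA' : nbhs ((f \o chart_from c) (chart_to c z)) A by rewrite /= (chart_toK cz).
have [r r0 rP] := (@nbhs_rn _ 'rV[R[i]]_N _ _).1 (cf A zA').
apply: filterS (chart_nbhs cz r0) => x [cx xr] /=.
by have := rP _ xr; rewrite /= (chart_toK cx).
Qed.

Lemma holo_continuous f : holomorphic f -> continuous f.
Proof. by move=> hf z; exact: (holo_continuous_at hf). Qed.

Lemma holo_cst (a : C) : holomorphic (fun _ : M => a).
Proof. by move=> c _ z _ _; exact: dfC_cst. Qed.

Lemma holoD f g : holomorphic f -> holomorphic g -> holomorphic (fun x => f x + g x : C).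
Proof.
by move=> hf hg c ac z Uz cz; exact: (dfC_D (hf c ac z Uz cz) (hg c ac z Uz cz)).
Qed.

Lemma holoB f g : holomorphic f -> holomorphic g -> holomorphic (fun x => f x - g x : C).
Proof.
by move=> hf hg c ac z Uz cz; exact: (dfC_B (hf c ac z Uz cz) (hg c ac z Uz cz)).
Qed.

Lemma holoM f g : holomorphic f -> holomorphic g -> holomorphic (fun x => f x * g x : C).
Proof.
by move=> hf hg c ac z Uz cz; exact: (dfC_M (hf c ac z Uz cz) (hg c ac z Uz cz)).
Qed.

Lemma holo_entire f (p : C -> C) : holomorphic f -> entire p -> holomorphic (fun x => p (f x)).
Proof.
by move=> hf ep c ac z Uz cz; apply: (df_comp (hf c ac z Uz cz)); exact: ep.
Qed.

Lemma holo_iter (phi : M -> M) m f : holomorphic_self_map phi -> holomorphic f ->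
  holomorphic (fun x => f (iter m phi x)).
Proof.
move=> hphi; elim: m f => [|m IH] f hf //.
exact: (IH (f \o phi) (holomorphic_comp hphi hf)).
Qed.

Lemma iter_continuous (phi : M -> M) m : continuous phi -> continuous (iter m phi).
Proof.
move=> cphi; elim: m => [|m IH] z; first exact: cvg_id.
exact: (@continuous_comp _ _ _ (iter m phi) phi z (IH z) (cphi _)).
Qed.

Lemma compact_image (T : topologicalType) (phi : M -> T) (K : set M) : continuous phi -> compact K -> compact (phi @` K).
Proof. by move=> cphi; apply: continuous_compact; exact: continuous_subspaceT. Qed.

Lemma holo_bound f K : holomorphic f -> compact K ->
  exists2 B : R, 0 < B & forall x, K x -> normc (f x) <= B.
Proof. by move=> hf; apply: compact_normc_bound => x _; exact: holo_continuous. Qed.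

Lemma holo_limit f : (forall z, exists (F : nat -> M -> C) K (B : R),
    [/\ forall k, holomorphic (F k), compact K, nbhs z K &
     forall k x, K x -> normc (F k x - f x) <= B / 2 ^+ k]) -> holomorphic f.
Proof.
move=> H c ac z _ cz; have [F [K [B [hF cK zK KB]]]] := H z.
have [D D0 DP] := holo_bound (hF 0%N) cK.
have [r r0 rP] := chart_ball cz zK.
apply: (@weierstrass _ _ (f \o chart_from c) (fun k => F k \o chart_from c) _ r B (D + B) r0).
- by move=> k y /rP[x [_ cx xy _]]; rewrite -xy; exact: hF.
- by move=> k y /rP[x [Kx _ _ /= ->]]; exact: KB.
- move=> y /rP[x [Kx _ _ /= ->]].
  have := KB 0%N x Kx; rewrite expr0 divr1 normcBC => h.
  have := normcD (f x - F 0%N x) (F 0%N x); rewrite subrK.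
  by move: h (DP x Kx); clear; lra.
Qed.

End Charts.

(** * Basic neighbourhoods in the space of holomorphic functions *)

Section HoloSpace.
Variables (R : realType) (N : nat) (M : complexManifold R N).
Local Notation C := (R[i]^o).

Definition holo_near (f : holo_space M) (K : set M) (e : R) : set (holo_space M) :=
  [set g | forall z, K z -> normc (\val g z - \val f z) < e].

Lemma entourage_normc (E : set (C * C)) : entourage E ->
  exists2 e : R, 0 < e & forall x y : C, normc (y - x) < e -> E (x, y).
Proof.
rewrite -entourage_ballE => -[e /= e0 eE].
have ee : e = (complex.Re e)%:C by rewrite RRe_real // gtr0_real.
exists (complex.Re e); first by rewrite -ltcR -ee.
move=> x y xy; apply: eE => /=; rewrite /ball /= ee normcE_C ltcR normcBC //.
Qed.

Lemma holo_near_nbhs (f : holo_space M) (K : set M) (e : R) : compact K -> 0 < e ->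
  nbhs f (holo_near f K e).
Proof.
move=> cK e0.
have entE : entourage [set xy : C * C | normc (xy.2 - xy.1) < e].
  rewrite -entourage_ballE; exists e%:C; first by rewrite /= ltcR.
  by move=> [x y] /=; rewrite /ball /= normcE_C ltcR normcBC.
have Q := @fam_nbhs M C compact _ _ (set_val f) entE cK.
have /= Q' := @initial_continuous (holo_space M) _ set_val f _ Q.
apply: (@filterS _ _ (nbhs_filter (f : holo_space M)) _ _ _ Q') => g /= H z Kz.
exact: H.
Qed.

(** The sets [holo_near f K e] generate a filter converging to [f] in the topology of compact
    convergence; hence it contains every neighbourhood of [f]. *)
Lemma nbhs_holo_near (f : holo_space M) (U : set (holo_space M)) : nbhs f U ->
  exists K (e : R), [/\ compact K, 0 < e & holo_near f K e `<=` U].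
Proof.
pose G := filter_from [set p : set M * R | compact p.1 /\ 0 < p.2] (fun p => holo_near f p.1 p.2).
have GF : Filter G.
  apply: filter_from_filter; first by exists (set0, 1); split => //; exact: compact0.
  move=> [K e] [K' e'] [/= cK e0] [/= cK' e0'].
  exists (K `|` K', Num.min e e').
    by split => /=; [exact: compactU|rewrite lt_min e0].
  move=> g /= H; split => z Kz /=.
    by have := H z (or_introl Kz); rewrite lt_min => /andP[].
  by have := H z (or_intror Kz); rewrite lt_min => /andP[].
have H : {family compact, (set_val @ G) --> (set_val f : M -> C)}.
  apply/(@fam_cvgP _ _ _ _ _ (fmap_filter _ GF)) => K cK P /uniform_nbhs[E [entE EP]].
  have [e e0 eE] := entourage_normc entE.
  exists (K, e) => // g gP; apply: EP => z Kz; apply: eE; exact: gP.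
move=> [_ [[W oW <-] /= Wf WU]].
have [[K e] [cK e0] KW] := H W (open_nbhs_nbhs (conj oW Wf)).
by exists K, e; split => // g /KW; exact: WU.
Qed.

Definition Holo (f : M -> C) (hf : holomorphic f) : holo_space M :=
  exist _ (f : {family compact, M -> C}) (mem_set hf).

Lemma holo_val (f : holo_space M) : holomorphic (\val f : M -> C).
Proof. exact: set_mem (valP f). Qed.

Lemma iter_comp_op (phi : M -> M) (hphi : holomorphic_self_map phi) m (f : holo_space M) z :
  \val (iter m (comp_op hphi) f) z = \val f (iter m phi z).
Proof. by elim: m z => [|m IH] z //; rewrite iterS iterSr /= -IH. Qed.

Lemma hypercyclicP (phi : M -> M) (hphi : holomorphic_self_map phi) (n : nat -> nat) :
  hypercyclic_wrt (comp_op hphi) n <->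
  exists2 f : M -> C, holomorphic f & forall (g : M -> C) (K : set M) (e : R),
    holomorphic g -> compact K -> 0 < e ->
    exists l, forall z, K z -> normc (f (iter (n l) phi z) - g z) < e.
Proof.
split=> [[f df]|[f hf fP]].
  exists (\val f : M -> C); first exact: holo_val.
  move=> g K e hg cK e0; have nU := @holo_near_nbhs (Holo hg) K e cK e0.
  have [h [Uh [l _ lh]]] := df _ (ex_intro _ (Holo hg) (nbhs_singleton (nbhs_interior nU)))
    (@open_interior _ (holo_near (Holo hg) K e)).
  exists l => z Kz; have := interior_subset Uh z Kz; rewrite -lh /=.
  by rewrite iter_comp_op.
exists (Holo hf) => U [g Ug] oU.
have [K [e [cK e0 KU]]] := nbhs_holo_near (open_nbhs_nbhs (conj oU Ug)).
have [l lP] := fP (\val g : M -> C) K e (holo_val g) cK e0.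
exists (iter (n l) (comp_op hphi) (Holo hf)); split; last by exists l.
by apply: KU => z Kz; rewrite iter_comp_op; exact: lP.
Qed.

End HoloSpace.

(** * Injective self-maps are biholomorphic onto their image *)

Section InjectiveMap.
Variables (R : realType) (N : nat) (M : complexManifold R N).
Local Notation C := (R[i]^o).
Variable phi : M -> M.
Hypotheses (hphi : holomorphic_self_map phi) (iphi : injective phi).

(** Osgood's theorem makes the map in charts satisfy the inverse function theorem. The set [A]
    confines the preimages, which gives openness as well as a holomorphic inverse. *)
Lemma local_inverse (z : M) (A : set M) : nbhs z A -> exists c d (g : 'rV[R[i]]_N -> 'rV[R[i]]_N) (e : R),
  [/\ atlas c /\ atlas d, chart_dom c z /\ chart_dom d (phi z), 0 < e &
    forall w, rn (w - chart_to d (phi z)) < e -> differentiable g w /\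
      exists x, [/\ A x, chart_dom c x, g w = chart_to c x, chart_dom d (phi x) & chart_to d (phi x) = w]].
Proof.
move=> zA; have [cphi dphi] := hphi.
have [c ac cz] := atlas_cover z; have [d ad dz] := atlas_cover (phi z).
have zB : nbhs z (A `&` phi @^-1` chart_dom d).
  by apply: filterI => //; apply: cphi; exact: open_nbhs_nbhs (conj (@chart_dom_open _ _ _ d) dz).
have [r r0 rP] := chart_ball cz zB.
pose psi := chart_to d \o phi \o chart_from c.
have psiP y : rn (y - chart_to c z) < r -> differentiable psi y.
  by move=> /rP[x [[_ dx] cx <- _]]; exact: dphi.
have psi_inj x x' : rn (x - chart_to c z) < r -> rn (x' - chart_to c z) < r -> psi x = psi x' -> x = x'.
  move=> /rP[p [[_ dp] cp <- pE]] /rP[q [[_ dq] cq <- qE]].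
  by rewrite /psi /= pE qE => /(chart_to_inj dp dq)/iphi ->.
have [e [g [e0 _ gP]]] := inverse_function r0 r0 psiP (osgood r0 psiP psi_inj).
exists c, d, g, e; split => // w wz.
have := gP w; rewrite /psi /= (chart_toK cz) => /(_ wz)[gw /rP[x [[Ax dx] cx xg xE]] dg].
split => //; exists x; split => //; by rewrite -?xg // -gw xE.
Qed.

Lemma injective_open (A : set M) : open A -> open (phi @` A).
Proof.
rewrite !openE => oA _ [z Az <-].
have [c [d [g [e [_ [_ dz] e0 gP]]]]] := local_inverse (oA z Az).
apply: filterS (chart_nbhs dz e0) => y [dy /gP[_ [x [Ax _ _ dx xy]]]].
by exists x => //; exact: chart_to_inj xy.
Qed.

Lemma inverse_holo (f : M -> C) : holomorphic f ->
  exists2 h : M -> C, holomorphic_on (range phi) h & forall z, h (phi z) = f z.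
Proof.
move=> hf.
(* Injectivity makes the chosen preimage the only one; the value 0 off the range is immaterial. *)
pose h y : C := if pselect (exists x, phi x = y) is left H then f (sval (cid H)) else 0.
have hE z : h (phi z) = f z.
  rewrite /h; case: pselect => [H|]; last by case; exists z.
  by congr f; apply: iphi; exact: (svalP (cid H)).
exists h => //; apply: holo_at_chart => _ [z _ <-].
have [c [d [g [e [[ac ad] [cz dz] e0 gP]]]]] := local_inverse (filterT : nbhs z setT).
exists d; split => //.
have [r r0 rP] := chart_ball dz (filterT : nbhs (phi z) setT).
apply: (@near_eq_df _ _ _ (fun y => (f \o chart_from c) (g y)) _ _ (Num.min e r)).
- by rewrite lt_min e0.
- move=> y; rewrite lt_min => /andP[/gP[_ [x [_ cx -> dx xy]]] /rP[y' [_ dy yy' /= ->]]].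
  by rewrite (chart_toK cx) -hE; congr h; apply: chart_to_inj dx dy _; rewrite xy.
have zz : rn (chart_to d (phi z) - chart_to d (phi z)) < e by rewrite subrr rn0.
have [dg [x [_ cx gx _ _]]] := gP _ zz.
by apply: (df_comp dg); rewrite gx; exact: hf.
Qed.

End InjectiveMap.

(** * Universal functions *)

Section Transitivity.
Variables (R : realType) (N : nat) (M : complexManifold R N).
Local Notation C := (R[i]^o).

Lemma uniform_cvg_normc (V : set M) (g : nat -> M -> C) (f : M -> C) (e : R) :
  {uniform V, g @ \oo --> f} -> 0 < e ->
  \forall k \near \oo, forall z, V z -> normc (g k z - f z) < e.
Proof.
move=> gf e0; apply: (gf [set h : M -> C | forall z, V z -> normc (h z - f z) < e]).
apply/uniform_nbhs; exists [set xy : C * C | normc (xy.2 - xy.1) < e]; split => //.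
rewrite -entourage_ballE; exists e%:C; first by rewrite /= ltcR.
by move=> [x y] /=; rewrite /ball /= normcE_C ltcR normcBC.
Qed.

Lemma normc_uniform_cvg (V : set M) (g : nat -> M -> C) (f : M -> C) :
  (forall e : R, 0 < e -> \forall k \near \oo, forall z, V z -> normc (g k z - f z) < e) ->
  {uniform V, g @ \oo --> f}.
Proof.
move=> gf P /uniform_nbhs[E [entE EP]]; have [e e0 eE] := entourage_normc entE.
by apply: filterS (gf e e0) => k H; apply: EP => z Vz; apply: eE; exact: H.
Qed.

Variable phi : M -> M.
Hypotheses (hphi : holomorphic_self_map phi) (iphi : injective phi).
Hypothesis rphi : runge_domain (range phi).

Lemma dense_range1 (g : M -> C) (K : set M) (e : R) : holomorphic g -> compact K -> 0 < e ->
  exists2 h : M -> C, holomorphic h & forall z, K z -> normc (h (phi z) - g z) < e.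
Proof.
move=> hg cK e0; have [G hG GE] := inverse_holo hphi iphi hg.
have [_ _ /(_ G hG)[q hq qP]] := rphi.
have cK' : compact (phi @` K) by apply: compact_image => //; exact: hphi.1.
(* Locally uniform convergence on the range becomes uniform on the compact image of [K]. *)
have [] := (compact_near_coveringP _).1 cK' nat \oo (fun k y => normc (q k y - G y) < e) _.
  move=> _ [z Kz <-]; have [V nV uV] := qP (phi z) (ltac:(by exists z)).
  have H := uniform_cvg_normc uV e0.
  exists (V, [set k | forall z, V z -> normc (q k z - G z) < e]); first by split.
  by move=> [y k] [/= Vy]; apply.
move=> k _ /(_ k (leqnn k)) H; exists (q k) => // z Kz.
by rewrite -GE; apply: H; exists z.
Qed.

Lemma dense_range (m : nat) (g : M -> C) (K : set M) (e : R) : holomorphic g -> compact K -> 0 < e ->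
  exists2 h : M -> C, holomorphic h & forall z, K z -> normc (h (iter m phi z) - g z) < e.
Proof.
elim: m g K e => [|m IH] g K e hg cK e0.
  by exists g => // z _; rewrite subrr normc0.
have e2 : 0 < e / 2 by rewrite divr_gt0.
have [h hh hP] := dense_range1 hg cK e2.
have [h' hh' hP'] := IH h (phi @` K) (e / 2) hh (compact_image hphi.1 cK) e2.
exists h' => // z Kz; rewrite iterSr.
apply: le_lt_trans (normc_dist (h (phi z)) _ _) _.
have := hP' (phi z) (ltac:(by exists z)); move: (hP z Kz); clear; lra.
Qed.

Lemma transitivity_step (m : nat) (K : set M) (f g : M -> C) (e : R) :
  compact K -> separable K (iter m phi @` K) -> holomorphic f -> holomorphic g -> 0 < e ->
  exists2 h : M -> C, holomorphic h & forall z, K z ->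
    normc (h z - f z) < e /\ normc (h (iter m phi z) - g z) < e.
Proof.
move=> cK [F hF sep] hf hg e0; have e2 : 0 < e / 2 by rewrite divr_gt0.
have cphi : continuous (iter m phi) by apply: iter_continuous; exact: hphi.1.
have cL := compact_image cphi cK; have cKL := compactU cK cL.
have [g' hg' gP] := dense_range m hg cK e2.
(* The correction is bounded on both [K] and its image, so [p] close to 0 or 1 within [e / (4 * B)]
   costs at most [e / 4]. *)
have [B B0 BP] := holo_bound (holoB hg' hf) cKL.
have d0 : 0 < e / (4 * B) by rewrite divr_gt0 // mulr_gt0.
have [p [ep p1 p2]] := separation d0 (holo_continuous hF) cK cL sep.
exists (fun x => f x + (g' x - f x) * p (F x)) => [|z Kz].
  exact: (holoD hf (holoM (holoB hg' hf) (holo_entire hF ep))).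
have eB : B * (e / (4 * B)) = e / 4 by field; rewrite gt_eqF.
split.
  rewrite addrAC subrr add0r normcM.
  have := ler_pM (normc_ge0 _) (normc_ge0 _) (BP z (or_introl Kz)) (p1 z Kz).
  by rewrite eB; move: e0; clear; lra.
have Lz : (iter m phi @` K) (iter m phi z) by exists z.
have -> : f (iter m phi z) + (g' (iter m phi z) - f (iter m phi z)) * p (F (iter m phi z)) - g z =
  (g' (iter m phi z) - f (iter m phi z)) * (p (F (iter m phi z)) - 1) + (g' (iter m phi z) - g z) by ring.
apply: le_lt_trans (normcD _ _) _; rewrite normcM.
have := ler_pM (normc_ge0 _) (normc_ge0 _) (BP _ (or_intror Lz)) (p2 _ Lz).
by rewrite eB; move: e0 (gP z Kz); clear; lra.
Qed.

End Transitivity.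

(** Near-covering compactness is applied to the filter of sufficiently large finite lists of
    admissible indices: a list containing the index chosen at [x] serves a whole neighbourhood of
    [x]. *)
Lemma compact_finite_cover (T : topologicalType) (I : eqType) (K : set T) (Q : I -> Prop)
    (f : I -> set T) : compact K -> (forall x, K x -> exists2 i, Q i & nbhs x (f i)) ->
  exists2 l : seq I, (forall i, i \in l -> Q i) &
    forall x, K x -> exists2 i, i \in l & f i x.
Proof.
move=> /compact_near_coveringP cK H.
pose F := filter_from [set l : seq I | forall i, i \in l -> Q i]
  (fun l0 => [set l : seq I | {subset l0 <= l} /\ forall i, i \in l -> Q i]).
have FF : Filter F.
  apply: filter_from_filter; first by exists [::].
  move=> l1 l2 h1 h2; exists (l1 ++ l2).
    by move=> i; rewrite mem_cat => /orP[]; [exact: h1|exact: h2].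
  move=> l [sl hl]; split; split => // i il; apply: sl; by rewrite mem_cat il ?orbT.
have [] := cK _ F (fun (l : seq I) x => exists2 i, i \in l & f i x) FF.
  move=> x Kx; have [i Qi xi] := H x Kx.
  exists (f i, [set l : seq I | i \in l]); first split => //.
    exists [:: i]; first by move=> j; rewrite inE => /eqP ->.
    by move=> l [sl _]; apply: sl; rewrite inE.
  by move=> [y l] [/= yi il]; exists i.
by move=> l hl lP; exists l => //; apply: (lP l); split.
Qed.

(** * A countable dense family of holomorphic functions *)

Section Separability.
Variables (R : realType) (N : nat) (M : complexManifold R N).
Local Notation C := (R[i]^o).

Definition ratc (q : rat * rat) : C := ratr q.1 +i* ratr q.2.
Definition ratv (q : 'rV[rat * rat]_N) : 'rV[R[i]]_N := \row_k ratc (q ord0 k).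

Lemma ratc_dense (z : C) (e : R) : 0 < e -> exists q, normc (z - ratc q) < e.
Proof.
move=> e0; have e2 : 0 < e / 2 by rewrite divr_gt0.
have near (x : R) : exists q : rat, `|x - ratr q| < e / 2.
  have [q] := @rat_in_itvoo R (x - e / 2) (x + e / 2) (ltac:(move: e2; clear; lra)).
  rewrite in_itv /= => /andP[q1 q2]; exists q; rewrite ltr_norml; apply/andP.
  by split; move: q1 q2; clear; lra.
have [q1 h1] := near (complex.Re z); have [q2 h2] := near (complex.Im z).
exists (q1, q2); apply: le_lt_trans (normc_ReIm _) _.
rewrite /ratc /=; case: z h1 h2 => x y /= h1 h2.
by rewrite (_ : e = e / 2 + e / 2); [exact: ltrD|field].
Qed.

Lemma ratv_dense (y : 'rV[R[i]]_N) (e : R) : 0 < e -> exists q, rn (y - ratv q) < e.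
Proof.
move=> e0; have /choice[q qP] k : exists q, normc (y ord0 k - ratc q) < e by exact: ratc_dense.
exists (\row_k q k); apply: rn_rV_lt => // k.
by rewrite !mxE; exact: qP.
Qed.

(** A code lists the position of a chart in a finite list, a rational centre, an exponent for the
    radius, and a rational value. Codes are countable, and so are finite lists of them. *)
Local Notation code := (nat * 'rV[rat * rat]_N * nat * (rat * rat))%type.

Section Compact.
Variables (K : set M) (e : R).
Hypotheses (cK : compact K) (e0 : 0 < e).

Definition cell (s : seq M) (cx : M -> chart R N M) (t : code) : set M :=
  [set z | exists x, [/\ onth s t.1.1.1 = Some x, chart_dom (cx x) z &
    rn (chart_to (cx x) z - ratv t.1.1.2) < 1 / 2 ^+ t.1.2]].

Lemma cell_open s cx t : open (cell s cx t).
Proof.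
rewrite openE => z [x [sx xz rz]].
have r0 : 0 < 1 / 2 ^+ t.1.2 - rn (chart_to (cx x) z - ratv t.1.1.2) by rewrite subr_gt0.
apply: filterS (chart_nbhs xz r0) => y [xy ry]; exists x; split => //.
have := rn_dist (chart_to (cx x) z) (chart_to (cx x) y) (ratv t.1.1.2).
by move: ry; clear; lra.
Qed.

(* Up to e on K, a holomorphic function is determined by finitely many cells
   covering K together with an approximate rational value on each of them. *)
Lemma countable_net : exists2 D : nat -> M -> C, (forall i, holomorphic (D i)) &
  forall g : M -> C, holomorphic g -> exists i, forall z, K z -> normc (D i z - g z) < e.
Proof.
have /choice[cx cxP] (z : M) : exists c, atlas c /\ chart_dom c z.
  by have [c ? ?] := atlas_cover z; exists c.
have [s _ KD] : exists2 s : seq M, (forall x, x \in s -> True) &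
    forall z, K z -> exists2 x, x \in s & chart_dom (cx x) z.
  apply: compact_finite_cover cK _ => z _; exists z => //.
  by apply: open_nbhs_nbhs; split; [exact: chart_dom_open|exact: (cxP z).2].
have e4 : 0 < e / 4 by rewrite divr_gt0.
pose fits (l : seq code) (g : M -> C) := K `<=` [set z | exists2 t, t \in l & cell s cx t z] /\
  forall t z, t \in l -> cell s cx t z -> normc (g z - ratc t.2) < e / 2.
have ex_fits g : holomorphic g -> exists l, fits l g.
  move=> hg.
  suff [l lP Kl] : exists2 l : seq code,
      (forall t, t \in l -> forall z, cell s cx t z -> normc (g z - ratc t.2) < e / 2) &
      forall z, K z -> exists2 t, t \in l & cell s cx t z.
    by exists l; split => // t z /lP; apply.
  apply: compact_finite_cover cK _ => z Kz.
  have [x xs xz] := KD z Kz.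
  have [v vP] := ratc_dense (g z) e4.
  have nz : nbhs z [set y | normc (g y - g z) < e / 4].
    have /= := @holo_continuous _ _ _ _ hg z [set y | normc (y - g z) < e / 4].
    by apply; apply/nbhs_rn; exists (e / 4) => // y; rewrite rnC.
  have [r r0 rP] := chart_ball xz nz.
  have [j jP] := @exp2_small R 1 (r / 2) ler01 (ltac:(by rewrite divr_gt0)).
  have j0 : 0 < 1 / 2 ^+ j :> R by rewrite divr_gt0 // exprn_gt0.
  have [q qP] := ratv_dense (chart_to (cx x) z) j0.
  have sx : onth s (index x s) = Some x.
    by rewrite onthE (nth_map x) ?index_mem // nth_index.
  exists (index x s, q, j, v).
    move=> y [x' [/= sx' xy yq]]; move: sx'; rewrite sx => -[xx']; rewrite -xx' in xy yq.
    have yr : rn (chart_to (cx x) y - chart_to (cx x) z) < r.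
      have := rn_dist (ratv q) (chart_to (cx x) y) (chart_to (cx x) z).
      rewrite (rnBC (ratv q)); move: yq qP (jP j (leqnn j)); clear; lra.
    have [y' [yP _ _ yE]] := rP _ yr.
    rewrite (chart_toK xy) in yE; rewrite -yE in yP.
    have := normc_dist (g z) (g y) (ratc v); move: yP vP => /= yP vP.
    by move: yP vP; clear; lra.
  apply: open_nbhs_nbhs; split; first exact: cell_open.
  by exists x; split.
(* One representative is kept for each list that some holomorphic function fits; two functions
   fitting the same list differ by less than [e] on [K]. *)
have /choice[G GP] (l : seq code) : exists g : M -> C, holomorphic g /\
    ((exists2 g', holomorphic g' & fits l g') -> fits l g).
  have [[g hg fg]|H] := pselect (exists2 g', holomorphic g' & fits l g').
    by exists g.
  by exists (fun=> 0); split=> [|/H[]]; exact: holo_cst.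
exists (fun i => if unpickle i is Some l then G l else fun=> 0).
  by move=> i; case: unpickle => [l|]; [exact: (GP l).1|exact: holo_cst].
move=> g hg; have [l fl] := ex_fits g hg; exists (pickle l) => z Kz; rewrite pickleK.
have [_ /(_ (ex_intro2 _ _ g hg fl))[_ fG]] := GP l.
have [/(_ z Kz)[t tl tz] fg] := fl.
have := normc_dist (ratc t.2) (G l z) (g z); rewrite (normcBC (ratc t.2)).
by move: (fG t z tl tz) (fg t z tl tz); clear; lra.
Qed.

End Compact.

(** The 2-adic valuation makes every member recur at arbitrarily large indices [2 ^ i * 3 ^ j0], so
    a target can be met at a stage where later errors are already small. *)
Lemma dense_sequence (K : nat -> set M) : (forall l, compact (K l)) ->
  exists2 d : nat -> M -> C, (forall i, holomorphic (d i)) &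
    forall (g : M -> C) l (e : R) j0, holomorphic g -> 0 < e ->
      exists2 j, (j0 <= j)%N & forall z, K l z -> normc (d j z - g z) < e.
Proof.
move=> cK.
have /choice[D DP] (p : nat * nat) : exists D : nat -> M -> C, (forall i, holomorphic (D i)) /\
    forall g : M -> C, holomorphic g -> exists i, forall z, K p.1 z -> normc (D i z - g z) < 1 / 2 ^+ p.2.
  have [D ? ?] := @countable_net (K p.1) (1 / 2 ^+ p.2) (cK p.1) (ltac:(by rewrite divr_gt0 // exprn_gt0)).
  by exists D.
pose d' i := if unpickle i is Some (p, k) then D p k else fun=> 0.
have hd i : holomorphic (d' i).
  by rewrite /d'; case: unpickle => [[p k]|]; [exact: (DP p).1|exact: holo_cst].
exists (fun j => d' (logn 2 j)) => // g l e j0 hg e0.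
have [q qP] := @exp2_small R 1 e ler01 e0.
have [k kP] := (DP (l, q)).2 g hg.
exists (2 ^ pickle ((l, q), k) * 3 ^ j0)%N.
  by rewrite (leq_trans (ltnW (ltn_expl j0 (isT : 1 < 3)%N))) // leq_pmull // expn_gt0.
move=> z Kz; rewrite lognM ?expn_gt0 // pfactorK // (_ : logn 2 (3 ^ j0) = 0%N); last first.
  by rewrite logn_coprime // coprimeXr.
by rewrite addn0 /d' pickleK; apply: lt_le_trans (kP z Kz) _; exact: ltW (qP q (leqnn q)).
Qed.

End Separability.

Section Universal.
Variables (R : realType) (N : nat) (M : complexManifold R N).
Local Notation C := (R[i]^o).

Lemma compact_exhaustion (X : nat -> set M) (K : set M) : (forall l, X l `<=` interior (X l.+1)) ->
  \bigcup_l X l = setT -> compact K -> exists l0, forall l, (l0 <= l)%N -> K `<=` X l.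
Proof.
move=> Xi XT /compact_near_coveringP cK.
have mono l k : (l <= k)%N -> X l `<=` X k.
  move=> /subnKC <-; elim: (k - l)%N => [|m IH]; first by rewrite addn0.
  by rewrite addnS => z /IH /Xi; exact: interior_subset.
have [] := cK nat \oo (fun l x => X l x) _.
  move=> x Kx; have : (\bigcup_l X l) x by rewrite XT.
  case=> j _ /Xi xj; exists (X j.+1, [set l | (j.+1 <= l)%N]); first by split => //; exists j.+1.
  by move=> [y l] [/= yj jl]; exact: mono jl _ yj.
by move=> l0 _ H; exists l0.
Qed.

(* The state at stage j is an approximation of f together with a compact set on
   which all later corrections are small. *)
Lemma universal_function (phi : M -> M) (n : nat -> nat) (X : nat -> set M) :
  holomorphic_self_map phi -> (forall l, compact (X l)) ->
  (forall l, X l `<=` interior (X l.+1)) -> \bigcup_l X l = setT ->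
  (forall (K : set M) (f g : M -> C) (e : R), compact K -> holomorphic f -> holomorphic g -> 0 < e ->
    exists l, exists2 h : M -> C, holomorphic h & forall z, K z ->
      normc (h z - f z) < e /\ normc (h (iter (n l) phi z) - g z) < e) ->
  exists2 f : M -> C, holomorphic f & forall (g : M -> C) (K : set M) (e : R),
    holomorphic g -> compact K -> 0 < e ->
    exists l, forall z, K z -> normc (f (iter (n l) phi z) - g z) < e.
Proof.
move=> hphi cX Xi XT trans; have [d hd dP] := dense_sequence cX.
pose good (s : (M -> C) * set M) := holomorphic s.1 /\ compact s.2.
(* The new compact set contains the image of the old one under the iterate, so that later
   corrections stay small exactly where the target [d j] was met. *)
pose next j (s s' : (M -> C) * set M) := [/\ good s', s.2 `|` X j.+1 `<=` s'.2,
  forall z, s.2 z -> normc (s'.1 z - s.1 z) <= 1 / 2 ^+ j &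
  exists l, forall z, s.2 z -> s'.2 (iter (n l) phi z) /\
     normc (s'.1 (iter (n l) phi z) - d j z) < 1 / 2 ^+ j].
have /choice[S SP] (p : nat * ((M -> C) * set M)) : exists s', good p.2 -> next p.1 p.2 s'.
  case: p => j s; have [[hs cs]|] := pselect (good s); last by exists s.
  have [l [h hh hP]] := trans s.2 s.1 (d j) (1 / 2 ^+ j) cs hs (hd j) (ltac:(by rewrite divr_gt0 // exprn_gt0)).
  exists (h, s.2 `|` X j.+1 `|` (iter (n l) phi @` s.2)) => _; split => //=.
  - split => //=; apply: compactU; first by apply: compactU.
    by apply: compact_image cs; apply: iter_continuous; exact: hphi.1.
  - by move=> z /hP[/ltW].
  - by exists l => z sz; split; [right; exists z|exact: (hP z sz).2].
pose st := fix st j : (M -> C) * set M := if j is j'.+1 then S (j', st j') else ((fun=> 0), X 0%N).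
have gst j : good (st j).
  elim: j => [|j IH]; first by split; [exact: holo_cst|exact: cX].
  by have [] := SP (j, st j) IH.
have nst j : next j (st j) (st j.+1) by exact: (SP (j, st j) (gst j)).
pose F j := (st j).1; pose L j := (st j).2.
have LS j : L j `<=` L j.+1 by have [_ h _ _] := nst j; move=> z Lz; apply: h; left.
have mono j k : (j <= k)%N -> L j `<=` L k.
  by move=> /subnKC <-; elim: (k - j)%N => [|m IH]; rewrite ?addn0 // addnS => z /IH /LS.
have XL j : X j `<=` L j.
  by case: j => [|j] //; have [_ h _ _] := nst j; move=> z Xz; apply: h; right.
(* From the first stage whose compact set contains [z], corrections at [z] are geometric; the bound
   [2 / 2 ^+ j] is their tail. *)
have /choice[f fP] (z : M) : exists y : C, forall j, L j z -> normc (F j z - y) <= 2 / 2 ^+ j.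
  have exL : exists j, `[<L j z>].
    have : (\bigcup_l X l) z by rewrite XT.
    by case=> j _ /XL Lz; exists j; apply/asboolP.
  case: (ex_minnP exL) => j0 /asboolP Lj0 minj.
  have [y yP] := @geometric_limit R (fun k => F (j0 + k)%N z) (1 / 2 ^+ j0) (ltac:(
    move=> k; rewrite -mulrA -invfM -exprD addnS; have [_ _ h _] := nst (j0 + k)%N;
    apply: h; exact: mono (leq_addr _ _) _ Lj0)).
  exists y => j Lj; have jj : (j0 <= j)%N by apply: minj; apply/asboolP.
  by have := yP (j - j0)%N; rewrite subnKC // mulrA mulr1 -mulrA -invfM -exprD subnKC.
exists f.
  apply: holo_limit => z; have : (\bigcup_l X l) z by rewrite XT.
  case=> j _ Xz; exists (fun k => F (j.+1 + k)%N), (X j.+1), 2; split.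
  - by move=> k; exact: (gst _).1.
  - exact: cX.
  - exact: Xi.
  - move=> k x Xx; apply: le_trans (fP _ _ (mono _ _ (leq_addr _ _) _ (XL _ _ Xx))) _.
    rewrite ler_pM2l // lef_pV2 ?posrE ?exprn_gt0 // ler_weXn2l ?ler1n //.
    exact: leq_addl.
move=> g K e hg cK e0; have e2 : 0 < e / 2 by rewrite divr_gt0.
have [l0 l0P] := compact_exhaustion Xi XT cK.
have [q qP] := @exp2_small R 2 (e / 2) (ltac:(by [])) e2.
have [j jl dj] := dP g l0 (e / 2) (maxn l0 q) hg e2.
move: jl; rewrite geq_max => /andP[jl jq].
have [_ _ _ [l lP]] := nst j; exists l => z Kz.
have [Lz Fz] := lP z (XL _ _ (l0P j jl z Kz)).
have h1 := fP _ _ Lz; have h2 := dj z (l0P l0 (leqnn _) z Kz); have h3 := qP j jq.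
have h4 := normc_dist (F j.+1 (iter (n l) phi z)) (f (iter (n l) phi z)) (g z).
have h5 := normc_dist (d j z) (F j.+1 (iter (n l) phi z)) (g z).
rewrite (normcBC (f _) (F _ _)) in h4.
have h6 : 2 / 2 ^+ j.+1 = 1 / 2 ^+ j :> R by rewrite exprS invfM mulrA divff ?mul1r // pnatr_eq0.
have h7 : 2 / 2 ^+ j = 2 * (1 / 2 ^+ j) :> R by rewrite mul1r.
rewrite h6 in h1; rewrite h7 in h3; move: Fz; rewrite -/(F j.+1) => Fz.
move: (1 / 2 ^+ j) h1 h2 h3 h4 h5 Fz => w.
by move: (normc _) (normc _) (normc _) (normc _) (normc _) => a1 a2 a3 a4 a5; clear; lra.
Qed.

Lemma sub_holomorphic_hull (K : set M) : compact K -> K `<=` holomorphic_hull K.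
Proof.
move=> cK z Kz f hf; have [B B0 BP] := holo_bound hf cK.
by apply: ub_le_sup; [exists B => _ [w Kw <-]; exact: BP|exists z].
Qed.

Lemma holomorphic_hull_convex (K : set M) : compact (holomorphic_hull K) ->
  holomorphically_convex (holomorphic_hull K).
Proof.
move=> cK; apply/seteqP; split; first exact: sub_holomorphic_hull.
move=> z zK f hf; apply: le_trans (zK f hf) _.
(* Over the empty set the supremum is 0, and the constant 1 shows that the hull is empty as well. *)
have [K0|/set0P[w Kw]] := eqVneq (holomorphic_hull K) set0.
  have := zK (fun=> 1) (@holo_cst _ _ M 1); rewrite K0 image_set0 sup0 normc1.
  by rewrite leNgt ltr01.
apply: ge_sup; first by exists (normc (f w)), w.
by move=> _ [x Kx <-]; exact: Kx.
Qed.

End Universal.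

(** * Consequences of a universal function *)

Section Necessity.
Variables (R : realType) (N : nat) (M : complexManifold R N).
Local Notation C := (R[i]^o).
Variables (phi : M -> M) (n : nat -> nat) (f : M -> C).
Hypotheses (hphi : holomorphic_self_map phi) (n_incr : {homo n : i j / (i < j)%N}).
Hypothesis hf : holomorphic f.
Hypothesis fP : forall (g : M -> C) (K : set M) (e : R),
  holomorphic g -> compact K -> 0 < e ->
  exists l, forall z, K z -> normc (f (iter (n l) phi z) - g z) < e.

(* n 0 may vanish; that index cannot serve both g and g + e / 2. *)
Lemma universal_pos (g : M -> C) (K : set M) (e : R) : holomorphic g -> compact K -> 0 < e ->
  exists2 m, (0 < n m)%N & forall z, K z -> normc (f (iter (n m) phi z) - g z) < e.
Proof.
move=> hg cK e0.
have npos l : l != 0%N -> (0 < n l)%N.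
  by rewrite -lt0n => l0; exact: leq_ltn_trans (leq0n _) (n_incr l0).
have [K0|/set0P[z0 Kz0]] := eqVneq K set0.
  by exists 1%N; [exact: npos|rewrite K0].
have e4 : 0 < e / 4 by rewrite divr_gt0.
have hg2 : holomorphic (fun z => g z + (e / 2)%:C : C) by apply: holoD hg _; exact: holo_cst.
have [l lP] := fP hg cK e4; have [l' lP'] := fP hg2 cK e4.
have [l0|l0] := eqVneq l 0%N; last first.
  exists l => [|z /lP h]; first exact: npos.
  by apply: lt_trans h _; move: e0; lra.
have e2 : normc ((e / 2)%:C : C) = e / 2 by rewrite normc_real gtr0_norm // divr_gt0.
have [l0'|l0'] := eqVneq l' 0%N; last first.
  exists l' => [|z /lP' h]; first exact: npos.
  have := normcD (f (iter (n l') phi z) - (g z + (e / 2)%:C)) (e / 2)%:C.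
  rewrite opprD addrA subrK e2; move: h; rewrite opprD addrA.
  by move: e0; lra.
exfalso; have h1 := lP z0 Kz0; have h2 := lP' z0 Kz0; rewrite l0 in h1; rewrite l0' in h2.
have := normcB (f (iter (n 0%N) phi z0) - g z0) (f (iter (n 0%N) phi z0) - (g z0 + (e / 2)%:C)).
rewrite (_ : _ - _ = (e / 2)%:C); last by ring.
by rewrite e2; move: h1 h2 e0; lra.
Qed.

Lemma universal_injective : (forall z w : M, z <> w ->
    exists2 g : M -> C, holomorphic g & g z <> g w) -> injective phi.
Proof.
move=> sep x y xy; apply: contrapT => /sep[g hg gxy].
have d0 : 0 < normc (g x - g y) by rewrite normc_gt0 subr_eq0; apply/eqP.
have d2 : 0 < normc (g x - g y) / 2 by rewrite divr_gt0.
have [m m0 mP] := universal_pos hg (compactU (@compact_set1 _ x) (@compact_set1 _ y)) d2.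
have h1 := mP x (or_introl erefl); have h2 := mP y (or_intror erefl).
have e : iter (n m) phi x = iter (n m) phi y by rewrite -(prednK m0) !iterSr xy.
rewrite e normcBC in h1; have := normc_dist (f (iter (n m) phi y)) (g x) (g y).
by move: h1 h2; lra.
Qed.

Lemma universal_runge (X : nat -> set M) : (forall l, compact (X l)) ->
  (forall l, X l `<=` interior (X l.+1)) -> \bigcup_l X l = setT ->
  connected [set: M] -> injective phi -> runge_domain (range phi).
Proof.
move=> cX Xi XT cM iphi; split.
- exact: injective_open openT.
- apply: connected_continuous_connected cM _.
  by apply: continuous_subspaceT; exact: hphi.1.
move=> h hh.
have hc : holomorphic (fun z => h (phi z)).
  apply: holo_at_chart => z _.
  have [c ac cz] := atlas_cover z; exists c; split => //.
  have [d ad dz] := atlas_cover (phi z).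
  have nd : nbhs z (phi @^-1` chart_dom d).
    by apply: hphi.1; exact: open_nbhs_nbhs (conj (@chart_dom_open _ _ _ d) dz).
  have [r r0 rP] := chart_ball cz nd.
  apply: (@near_eq_df _ _ _ (fun y => (h \o chart_from d) ((chart_to d \o phi \o chart_from c) y)) _ _ r r0).
    by move=> y /rP[x [dx _ _ yx]]; rewrite /= yx (chart_toK dx).
  apply: (@df_comp _ _ _ _ (chart_to d \o phi \o chart_from c) (h \o chart_from d)).
    exact: hphi.2.
  by rewrite /= (chart_toK cz); apply: hh => //; exists z.
have /choice[m mP] k : exists m, (0 < n m)%N /\
    forall z, X k z -> normc (f (iter (n m) phi z) - h (phi z)) < 1 / 2 ^+ k.
  have [m ? ?] := universal_pos hc (cX k) (ltac:(by rewrite divr_gt0 // exprn_gt0) : 0 < 1 / 2 ^+ k).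
  by exists m.
exists (fun k z => f (iter (n (m k)).-1 phi z)); first by move=> k; exact: holo_iter.
move=> _ [z _ <-]; have : (\bigcup_l X l) z by rewrite XT.
(* Openness of [phi] makes the image of the interior of [X l.+1] a neighbourhood of [phi z];
   convergence on it is uniform since [X k] contains [X l.+1] for large [k]. *)
case=> l _ Xz; exists (phi @` interior (X l.+1)).
  apply: open_nbhs_nbhs; split; first by apply: injective_open => //; exact: open_interior.
  by exists z => //; exact: Xi.
apply: normc_uniform_cvg => e e0; have [q qP] := @exp2_small R 1 e ler01 e0.
have mono k : (l.+1 <= k)%N -> X l.+1 `<=` X k.
  move=> /subnKC <-; elim: (k - l.+1)%N => [|j IH]; first by rewrite addn0.
  by rewrite addnS => y /IH /Xi; exact: interior_subset.
exists (maxn l.+1 q) => // k /=; rewrite geq_max => /andP[lk qk] _ [y /interior_subset Xy <-].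
have [m0 /(_ y (mono k lk y Xy))] := mP k.
rewrite -[in X in X -> _](prednK m0) iterSr => H.
exact: lt_trans H (qP k qk).
Qed.

Lemma universal_separable (K : set M) : compact K -> exists l, separable K (iter (n l) phi @` K).
Proof.
move=> cK; have e4 : 0 < 1 / 4 :> R by rewrite divr_gt0.
have [m mP] := fP (@holo_cst _ _ M 0) cK e4.
have cphi j : continuous (iter j phi) by apply: iter_continuous; exact: hphi.1.
have [l lP] := fP (@holo_cst _ _ M 1) (compact_image (cphi (n m)) cK) e4.
exists l; exists (fun z => f (iter (n m) phi z)); first exact: holo_iter.
apply/seteqP; split => // w [h1 h2].
have w1 : normc (w - 0) <= 1 / 4.
  by apply: hull_disc h1; [exact: ltW|move=> z /mP/ltW].
have w2 : normc (w - 1) <= 1 / 4.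
  apply: hull_disc h2; first exact: ltW.
  (* Iterates commute, so on the image of [K] under the [n l]-th iterate the function equals [f]
     composed with that iterate, evaluated on the compact set where it is close to 1. *)
  move=> _ [z Kz <-]; rewrite -iterD addnC iterD; apply: ltW; apply: lP.
  by exists z.
have := normc_dist w 1 0; rewrite subr0 normc1 (normcBC 1).
by move: w1 w2; lra.
Qed.

End Necessity.

(** * The two equivalences *)

Section Main.
Variables (R : realType) (N : nat) (M : complexManifold R N).
Local Notation C := (R[i]^o).
Hypotheses (stein_M : stein_manifold M) (connected_M : connected [set: M]).
Variable phi : M -> M.
Hypothesis hphi : holomorphic_self_map phi.

Lemma hypercyclic_iff (n : nat -> nat) : {homo n : i j / (i < j)%N} ->
  hypercyclic_wrt (comp_op hphi) n <->
    [/\ injective phi, runge_domain (range phi) &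
        forall K : set M, compact K -> holomorphically_convex K ->
          exists l, separable K (iter (n l) phi @` K)].
Proof.
move=> n_incr; rewrite hypercyclicP; have [X [cX Xi XT]] := stein_exhaustion stein_M.
split=> [[f hf fP]|[iphi rphi sep]].
  have iphi := universal_injective n_incr fP (stein_separates_points stein_M).
  split => //; first exact: (universal_runge hphi n_incr hf fP cX Xi XT connected_M iphi).
  by move=> K cK _; exact: (universal_separable hphi hf fP cK).
apply: (universal_function hphi cX Xi XT) => K f g e cK hf hg e0.
(* Separability is given for convex compact sets only, so [K] is enlarged to its hull, compact on a
   Stein manifold. *)
have cH := stein_hull_compact stein_M cK.
have [l sl] := sep _ cH (holomorphic_hull_convex cH).
have [h hh hP] := transitivity_step hphi iphi rphi cH sl hf hg e0.
by exists l, h => // z Kz; apply: hP; exact: sub_holomorphic_hull cK z Kz.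
Qed.

Lemma homo_ltn_ge (k : nat -> nat) : {homo k : i j / (i < j)%N} -> forall l, (l <= k l)%N.
Proof. by move=> kk; elim=> // l IH; exact: leq_ltn_trans IH (kk _ _ (ltnSn l)). Qed.

Lemma frequently_subsequence (P : nat -> Prop) : (forall l0, exists2 l, (l0 <= l)%N & P l) ->
  exists2 k : nat -> nat, {homo k : i j / (i < j)%N} & forall i, P (k i).
Proof.
move=> H; have /choice[s sP] l0 : exists l, (l0 <= l)%N /\ P l by have [l ? ?] := H l0; exists l.
pose k := fix k i := if i is i'.+1 then s (k i').+1 else s 0%N.
exists k => [|i]; last by case: i => [|i]; exact: (sP _).2.
by apply: homo_ltn => [? ? ?|i]; [exact: ltn_trans|exact: (sP _).1].
Qed.

Lemma hereditarily_hypercyclic_iff (n : nat -> nat) : {homo n : i j / (i < j)%N} ->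
  hereditarily_hypercyclic_wrt (comp_op hphi) n <->
    [/\ injective phi, runge_domain (range phi) &
        forall K : set M, compact K -> holomorphically_convex K ->
          exists l0, forall l, (l0 <= l)%N -> separable K (iter (n l) phi @` K)].
Proof.
move=> n_incr; split=> [H|[iphi rphi sep] k k_incr].
  have [] := (hypercyclic_iff n_incr).1 (H id (fun i j ij => ij)).
  move=> iphi rphi _; split => // K cK xK; apply: contrapT => nl.
  (* If separability failed for arbitrarily large [l], it would fail along a whole subsequence,
     whose universality contradicts the first equivalence. *)
  have [l0|k k_incr kP] := @frequently_subsequence (fun l => ~ separable K (iter (n l) phi @` K)).
    apply: contrapT => nl0; apply: nl; exists l0 => l ll; apply: contrapT => ns.
    by apply: nl0; exists l.
  have nk_incr : {homo n \o k : i j / (i < j)%N} by move=> i j /k_incr /n_incr.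
  have [_ _ /(_ K cK xK)[l]] := (hypercyclic_iff nk_incr).1 (H k k_incr).
  exact: kP.
have nk_incr : {homo n \o k : i j / (i < j)%N} by move=> i j /k_incr /n_incr.
apply: (hypercyclic_iff nk_incr).2; split => // K cK xK.
(* The index [l0] itself serves for the subsequence, because [l0 <= k l0]. *)
have [l0 l0P] := sep K cK xK; exists l0; apply: l0P; exact: homo_ltn_ge.
Qed.

End Main.

Theorem theorem3p5 (R : realType) (N : nat) (Omega : complexManifold R N)
    (stein_Omega : stein_manifold Omega)
    (connected_Omega : connected [set: Omega])
    (phi : Omega -> Omega) (hol_phi : holomorphic_self_map phi)
    (n : nat -> nat) (n_incr : {homo n : i j / (i < j)%N}) :
  (hypercyclic_wrt (comp_op hol_phi) n <->
    [/\ injective phi,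
        runge_domain (range phi) &
        forall K : set Omega, compact K -> holomorphically_convex K ->
          exists l, separable K (iter (n l) phi @` K)]) /\
  (hereditarily_hypercyclic_wrt (comp_op hol_phi) n <->
    [/\ injective phi,
        runge_domain (range phi) &
        forall K : set Omega, compact K -> holomorphically_convex K ->
          exists l0, forall l, (l0 <= l)%N ->
            separable K (iter (n l) phi @` K)]).
Proof.
by split; [exact: hypercyclic_iff|exact: hereditarily_hypercyclic_iff].
Qed.
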